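(* Consider the ZO-HFL method described in the context for the problem $\min_x f_1(x)+\frac1m\sum_i f_2(x,y_i(x))$, under Assumption A, where the local outputs satisfy $\mathbb E[\|y^{\pm}_{\varepsilon_{i,r}}-y_i(\hat x_r\pm\eta v_{i,r})\|^2]\le\varepsilon_{i,r}$ for all $i,r$. Let $\gamma_r\le\frac{\eta}{4(\eta L_1^{f_1}+L_0^{\mathrm{imp}}\sqrt n)}$ for all $r$, let $\{\gamma_r\}$ be nonnegative, nonsummable and square-summable, and let the sequence $\{\gamma_r\frac1m\sum_{i=1}^m\varepsilon_{i,r}\}$ be nonnegative and summable. Then $$\liminf_{r\to\infty}\|\nabla f^\eta(\hat x_r)\|=0\quad\text{almost surely}.$$
   Context: Problem setting. Let $m,n\ge1$, $[m]=\{1,\dots,m\}$. The server has objective $f_1(x)=\mathbb E_\xi[\tilde f_1(x,\xi)]$, $x\in\mathbb R^n$. Client $i$ has objective $h_i(x,y)=\mathbb E_{\zeta_i}[\tilde h_i(x,y,\zeta_i)]$ and a constraint set $Y_i(x)\subseteq\mathbb R^n$; $y_i(x)=\arg\min_{y\in Y_i(x)}h_i(x,y)$. A penalty $f_2:\mathbb R^n\times\mathbb R^n\to\mathbb R$ is given. Let $\mathbb B$ and $\mathbb S$ be the unit ball and unit sphere of $\mathbb R^n$. For a smoothing parameter $\eta>0$ define $f_2^\eta(x)=\frac1m\sum_{i=1}^m\mathbb E_{u\sim\mathrm{Unif}(\mathbb B)}[f_2(x+\eta u,y_i(x+\eta u))]$ and $f^\eta=f_1+f_2^\eta$. Assumption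 A. (i) For all $i$, $x\mapsto f_2(x,y_i(x))$ is $L_0^{\mathrm{imp}}$-Lipschitz, $f_2(\cdot,y)$ is $L_{0,x}^{f_2}$-Lipschitz for any $y$, and $f_2(x,\cdot)$ is $L_{0,y}^{f_2}$-Lipschitz for any $x$. (ii) For all $i$ and any $x$, $h_i(x,\cdot)$ is $L_{1,y}^{h_i}$-smooth and $\mu_{h_i}$-strongly convex; for any $y$, $\nabla_y h_i(\cdot,y)$ is $L_{0,x}^{\nabla h_i}$-Lipschitz; $\mathbb E[\nabla_y\tilde h_i(x,y,\zeta_i)\mid y]=\nabla_y h_i(x,y)$ and $\mathbb E[\|\nabla_y h_i(x,y)-\nabla_y\tilde h_i(x,y,\zeta_i)\|^2\mid y]\le\sigma_i^2$. (iii) $f_1$ is $L_1^{f_1}$-smooth, $\mathbb E[\nabla\tilde f_1(x,\xi)\mid x]=\nabla f_1(x)$, $\mathbb E[\|\nabla\tilde f_1(x,\xi)-\nabla f_1(x)\|^2\mid x]\le\sigma^2$. (iv) For all $i$ and $x$, $Y_i(x)$ is (nonempty) closed and convex. Method ZO-HFL. Start from $\hat x_0$. At round $r=0,1,\dots$: for each $i$ draw $v_{i,r}$ uniformly on $\mathbb S$ (independently); client $i$ runs $H_{i,r}$ steps of projected SGD $y_{t+1}=\Pi_{Y_i(x)}[y_t-\tilde\gamma_{i,t}\nabla_y\tilde h_i(x,y_t,\zeta_{i,t})]$ once with $x=\hat x_r+\eta v_{i,r}$ and once with $x=\hat x_r-\eta v_{i,r}$, returning $y^+_{\varepsilon_{i,r}}$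 and $y^-_{\varepsilon_{i,r}}$; the server draws $\xi_r$ and sets $\hat x_{r+1}=\hat x_r-\gamma_r\big(\nabla\tilde f_1(\hat x_r,\xi_r)+\frac1m\sum_{i=1}^m\frac n{2\eta}\big(f_2(\hat x_r+\eta v_{i,r},y^+_{\varepsilon_{i,r}})-f_2(\hat x_r-\eta v_{i,r},y^-_{\varepsilon_{i,r}})\big)v_{i,r}\big)$.
   Formalization: The formal statement additionally assumes that the objective f_1(x)+(1/m)∑_i f_2(x,y_i(x)) is bounded below; without this the claim fails, e.g. for f_1(x)=-x_1, f_2=0 with exact gradients, where ‖∇f^η‖=1 everywhere. *)

(* Defs.v *)
From HB Require Import structures.
From mathcomp Require Import all_boot all_order all_algebra.
From mathcomp Require Import all_classical all_reals all_analysis.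

Set Implicit Arguments.
Unset Strict Implicit.
Unset Printing Implicit Defensive.

Import Order.TTheory GRing.Theory Num.Theory.
Import numFieldNormedType.Exports.

Local Open Scope classical_set_scope.
Local Open Scope ring_scope.

Section Defs.
Variable R : realType.

Definition enorm n (x : 'rV[R]_n) : R := Num.sqrt (\sum_(j < n) x 0 j ^+ 2).

Definition grad n (f : 'rV[R]_n -> R) (x : 'rV[R]_n) : 'rV[R]_n :=
  \row_(j < n) ('d f x (delta_mx 0 j : 'rV[R]_n)).

Definition e_lipschitz n p (L : R) (g : 'rV[R]_n -> 'rV[R]_p) :=
  forall x x', enorm (g x - g x') <= L * enorm (x - x').
Definition e_lipschitzR n (L : R) (g : 'rV[R]_n -> R) :=
  forall x x', `|g x - g x'| <= L * enorm (x - x').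

Definition e_smooth n (L : R) (f : 'rV[R]_n -> R) :=
  (forall x, differentiable f x) /\ e_lipschitz L (grad f).

Definition e_strongly_convex n (mu : R) (f : 'rV[R]_n -> R) :=
  forall (a b : 'rV[R]_n) (t : R), 0 <= t <= 1 ->
    f (t *: a + (1 - t) *: b) <=
      t * f a + (1 - t) * f b - mu / 2 * t * (1 - t) * enorm (a - b) ^+ 2.

Definition e_convex_set n (C : set 'rV[R]_n) :=
  forall a b (t : R), C a -> C b -> 0 <= t <= 1 -> C (t *: a + (1 - t) *: b).

Definition rv_borel n : set (set 'rV[R]_n) := <<s [set U | open U] >>.

(** Lebesgue integral over R^n, defined as the iterated integral over the
    coordinates (Fubini), each coordinate carrying the Lebesgue measure. *)
Fixpoint iter_int (n : nat) : ('rV[R]_n -> R) -> R :=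
  match n return ('rV[R]_n -> R) -> R with
  | 0 => fun f => f 0
  | k.+1 => fun f =>
      Rintegral (@lebesgue_measure R) setT
        (fun t : R => iter_int (fun x : 'rV[R]_k => f (row_mx (const_mx t : 'rV[R]_1) x)))
  end.

Definition unit_ball n : set 'rV[R]_n := [set u | enorm u <= 1].
Definition ball_avg n (g : 'rV[R]_n -> R) : R :=
  iter_int (fun u => \1_(@unit_ball n) u * g u) / iter_int (\1_(@unit_ball n)).

(** Uniform (normalised surface) probability on the unit sphere S, given as
    the normalised cone measure: unif_sphere B = vol{u in B_ball, u <> 0,
    u/|u| in B} / vol(B_ball). *)
Definition unif_sphere n (B : set 'rV[R]_n) : R :=
  ball_avg (fun u => if u == 0 then 0 else \1_B ((enorm u)^-1 *: u)).

Definition rv_meas (T : Type) n (G : set (set T)) (X : T -> 'rV[R]_n) :=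
  forall B, rv_borel B -> G (X @^-1` B).

Definition f2_eta m n (eta : R) (f2 : 'rV[R]_n -> 'rV[R]_n -> R)
    (y : 'I_m -> 'rV[R]_n -> 'rV[R]_n) (x : 'rV[R]_n) : R :=
  m%:R^-1 * \sum_(i < m)
     ball_avg (fun u => f2 (x + eta *: u) (y i (x + eta *: u))).

Definition f_eta m n (eta : R) (f1 : 'rV[R]_n -> R)
    (f2 : 'rV[R]_n -> 'rV[R]_n -> R) (y : 'I_m -> 'rV[R]_n -> 'rV[R]_n)
    (x : 'rV[R]_n) : R :=
  f1 x + f2_eta eta f2 y x.

End Defs.

(* Main.v *)
(* Each F_i(x) = f2(x, y_i(x)) is Lipschitz, so its ball average satisfies a
   second-order Taylor estimate |phi(x + d) - phi(x) - <G(x), d>| <= C |d|^2, where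
   G(x) is the mean over the sphere of the two-point quotient times the direction.
   This needs no divergence theorem: translating the ball by a small d is a
   star-shaped perturbation, integrated in polar coordinates, which are obtained
   from the homogeneity of Lebesgue measure alone.

   Hence f^eta is differentiable with an explicit gradient, and the method is a
   stochastic gradient iteration for f^eta whose increments split into the
   gradient, two zero-mean noises (sampling of xi and of the directions), and an
   error whose mean square is bounded by a multiple of the mean of the eps_i.
   Taking total expectations in the Taylor estimate and telescoping gives
   sum_r gamma_r E|grad f^eta(x_r)|^2 < oo; by Tonelli the sum
   sum_r gamma_r |grad f^eta(x_r)|^2 is almost surely finite, and since gamma is
   not summable the lower limit vanishes. *)
Require Import Defs.
From HB Require Import structures.
From mathcomp Require Import all_boot all_order all_algebra.
From mathcomp Require Import all_classical all_reals all_analysis.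
From mathcomp Require Import measurable_realfun ring lra.
Import Order.TTheory GRing.Theory Num.Theory.
Import numFieldNormedType.Exports.
Local Open Scope classical_set_scope.
Local Open Scope ring_scope.
Set Implicit Arguments.
Unset Strict Implicit.
Unset Printing Implicit Defensive.

(** * Euclidean norm and Borel vectors *)

(** The positivity of the ball's volume is not computed. A zero volume would make [unif_sphere]
    vanish, whereas the assumed law of the directions gives it total mass 1.

    A Lipschitz function has no derivative to expand, so second order has to come from geometry. A
    ball and its translate by [d] differ inside a shell of volume O(|d|), and there replacing the
    function by its value at the radial projection costs O(|d|). What remains depends on the
    direction alone, and only the boundary radius, a smooth function of [d], is expanded. Reflecting
    the sphere then turns the linear term into a two-point difference, so the gradient is exactly
    the mean of the idealised estimator.

    The maps [y i] are not known to be measurable. Only the Lipschitz functions [f2 x (y i x)] serve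
    as random variables, and the accuracy hypotheses are read as bounds on lower integrals. No
    conditional expectation is formed: the noises are integrated against functions of the past. The
    integrability needed for that is E|x_r|^2 < oo, which passes from round to round because the
    gradient grows at most linearly. *)

Notation rvB R n := (g_sigma_algebraType [set U : set 'rV[R]_n | open U]).

Section Euclid.
Context {R : realType} {n : nat}.
Implicit Types (a b c : 'rV[R]_n) (t : R).

Definition dot a b : R := \sum_(j < n) a 0 j * b 0 j.

Lemma dotC a b : dot a b = dot b a.
Proof. by apply: eq_bigr => j _; rewrite mulrC. Qed.

Lemma dotDl a b c : dot (a + b) c = dot a c + dot b c.
Proof. by rewrite -big_split; apply: eq_bigr => j _; rewrite mxE mulrDl. Qed.

Lemma dotZl t a b : dot (t *: a) b = t * dot a b.
Proof. by rewrite mulr_sumr; apply: eq_bigr => j _; rewrite mxE mulrA. Qed.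

Lemma dotNl a b : dot (- a) b = - dot a b.
Proof. by rewrite -scaleN1r dotZl mulN1r. Qed.

Lemma dotDr a b c : dot c (a + b) = dot c a + dot c b.
Proof. by rewrite dotC dotDl !(dotC c). Qed.

Lemma dotZr t a b : dot a (t *: b) = t * dot a b.
Proof. by rewrite dotC dotZl dotC. Qed.

Lemma dotNr a b : dot a (- b) = - dot a b.
Proof. by rewrite dotC dotNl dotC. Qed.

Lemma enorm_sq a : enorm a ^+ 2 = dot a a.
Proof.
rewrite /enorm sqr_sqrtr; first by apply: eq_bigr => j _; rewrite expr2.
by apply: sumr_ge0 => j _; exact: sqr_ge0.
Qed.

Lemma enorm_ge0 a : 0 <= enorm a.
Proof. exact: sqrtr_ge0. Qed.

Lemma enormZ t a : enorm (t *: a) = `|t| * enorm a.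
Proof.
apply/eqP; rewrite -(@eqrXn2 _ 2) ?mulr_ge0 ?enorm_ge0//.
by rewrite exprMn !enorm_sq dotZl dotZr mulrA -expr2 real_normK ?num_real.
Qed.

Lemma enormN a : enorm (- a) = enorm a.
Proof. by rewrite -scaleN1r enormZ normrN1 mul1r. Qed.

Lemma enorm0 : enorm (0 : 'rV[R]_n) = 0.
Proof. by rewrite -(scale0r (0 : 'rV[R]_n)) enormZ normr0 mul0r. Qed.

Lemma enorm_eq0 a : enorm a = 0 -> a = 0.
Proof.
move=> a0; have : dot a a = 0 by rewrite -enorm_sq a0 expr0n.
rewrite /dot => /eqP; rewrite psumr_eq0; last first.
  by move=> j _; rewrite -expr2 sqr_ge0.
move=> /allP h; apply/rowP => j; rewrite mxE.
have := h j; rewrite mem_index_enum => /(_ isT) /=.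
by rewrite -expr2 sqrf_eq0 => /eqP.
Qed.

Lemma enorm_gt0 a : a != 0 -> 0 < enorm a.
Proof.
move=> a0; rewrite lt_def enorm_ge0 andbT.
by apply: contra_neq a0; exact: enorm_eq0.
Qed.

(** Cauchy-Schwarz: the squared norm of [|b|^2 a - <a,b> b] is nonnegative and equals [|b|^2] times
    the difference of the two squared sides. *)
Lemma dot_le_enorm a b : `|dot a b| <= enorm a * enorm b.
Proof.
have [->|/eqP b0] := eqVneq b 0.
  by rewrite -(scale0r (0 : 'rV[R]_n)) dotZr mul0r normr0 mulr_ge0 ?enorm_ge0.
have bp : 0 < enorm b by apply: enorm_gt0; apply/eqP.
rewrite -(@ler_pXn2r _ 2) ?nnegrE ?mulr_ge0 ?enorm_ge0//.
rewrite exprMn real_normK ?num_real//.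
have := sqr_ge0 (enorm ((enorm b ^+ 2) *: a - dot a b *: b)).
rewrite (enorm_sq (_ - _)) !(dotDl, dotDr, dotNl, dotNr, dotZl, dotZr) (dotC b a).
rewrite -!enorm_sq => h.
rewrite -subr_ge0 -(@pmulr_rge0 _ (enorm b ^+ 2)) ?exprn_gt0//.
by apply: le_trans h _; rewrite le_eqVlt; apply/orP; left; apply/eqP; ring.
Qed.

Lemma ler_enormD a b : enorm (a + b) <= enorm a + enorm b.
Proof.
rewrite -(@ler_pXn2r _ 2) ?nnegrE ?addr_ge0 ?enorm_ge0//.
rewrite (enorm_sq (_ + _)) dotDl !dotDr (dotC b a) -!enorm_sq.
have := le_trans (ler_norm _) (dot_le_enorm a b); lra.
Qed.

Lemma ler_enormB a b : enorm (a - b) <= enorm a + enorm b.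
Proof. by rewrite -(enormN b); exact: ler_enormD. Qed.

Lemma ler_dist_enorm a b : `|enorm a - enorm b| <= enorm (a - b).
Proof.
have := ler_enormD (a - b) b; rewrite subrK.
have := ler_enormD (b - a) a; rewrite subrK -(enormN (b - a)) opprB.
by rewrite ler_norml => *; apply/andP; split; lra.
Qed.

Lemma enorm_sum m (f : 'I_m -> 'rV[R]_n) :
  enorm (\sum_(i < m) f i) <= \sum_(i < m) enorm (f i).
Proof.
elim/big_ind2: _ => //; first by rewrite enorm0.
by move=> x p y q xp yq; apply: le_trans (ler_enormD _ _) _; exact: lerD.
Qed.

Lemma coord_le_enorm a j : `|a 0 j| <= enorm a.
Proof.
rewrite -(@ler_pXn2r _ 2) ?nnegrE ?enorm_ge0// real_normK ?num_real//.
rewrite (enorm_sq a) /dot (bigD1 j)//= expr2 lerDl.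
by apply: sumr_ge0 => k _; rewrite -expr2 sqr_ge0.
Qed.

Lemma coord_le_norm a j : `|a 0 j| <= `|a|.
Proof. 
rewrite [leRHS]/Num.Def.normr/= mx_normrE; exact: (@le_bigmax _ _ _ _ (fun p => `|a p.1 p.2|) (ord0, j)).
Qed.

(** The norm on the right is the maximum norm of matrices, which carries the topology. The crude
    factor [n] suffices for continuity and differentiability. *)
Lemma enorm_le_norm a : enorm a <= n%:R * `|a|.
Proof.
have h : enorm a ^+ 2 <= (n%:R * `|a|) ^+ 2.
  rewrite enorm_sq /dot.
  apply: (@le_trans _ _ (\sum_(j < n) `|a| ^+ 2)).
    apply: ler_sum => j _; rewrite -expr2 -real_normK ?num_real//.
    by rewrite ler_pXn2r ?nnegrE//; exact: coord_le_norm.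
  rewrite sumr_const card_ord -[leLHS]mulr_natl exprMn ler_wpM2r ?sqr_ge0//.
  by rewrite -natrX ler_nat; case: (n) => // k; rewrite -mulnn leq_pmulr.
by rewrite -(@ler_pXn2r _ 2) ?nnegrE ?enorm_ge0// mulr_ge0.
Qed.

Lemma enorm_delta (j : 'I_n) : enorm (delta_mx 0 j : 'rV[R]_n) = 1.
Proof.
rewrite /enorm (bigD1 j)//= big1 ?addr0; first by rewrite mxE !eqxx expr1n sqrtr1.
by move=> k kj; rewrite mxE eqxx (negbTE kj) expr0n.
Qed.

Lemma dot_delta a (j : 'I_n) : dot a (delta_mx 0 j) = a 0 j.
Proof.
rewrite /dot (bigD1 j)//= big1 ?addr0; first by rewrite mxE !eqxx mulr1.
by move=> k kj; rewrite mxE eqxx (negbTE kj) mulr0.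
Qed.

End Euclid.

(** * Borel measurability of vector-valued maps *)

Section Measurability.
Context {R : realType}.

Lemma lipschitz_continuous n (L : R) (g : 'rV[R]_n -> R) :
  e_lipschitzR L g -> continuous g.
Proof.
move=> gL x; apply/(@cvgrPdist_le _ R^o _ _ (nbhs_filter x)) => e e0.
have K0 : 0 < `|L| * n%:R + 1 by rewrite ltr_wpDl// mulr_ge0.
near=> z; rewrite (le_trans (gL _ _))//.
apply: (@le_trans _ _ ((`|L| * n%:R + 1) * `|x - z|)).
  apply: (@le_trans _ _ (`|L| * enorm (x - z))).
    by rewrite ler_wpM2r ?enorm_ge0// ler_norm.
  apply: (@le_trans _ _ (`|L| * (n%:R * `|x - z|))).
    by rewrite ler_wpM2l// enorm_le_norm.
  by rewrite mulrA ler_wpM2r// lerDl.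
rewrite -ler_pdivlMl//.
near: z; apply/nbhs_ballP; exists ((`|L| * n%:R + 1)^-1 * e) => /=; first by rewrite mulr_gt0 ?invr_gt0.
by move=> z; rewrite -ball_normE /= => /ltW.
Unshelve. all: by end_near. Qed.

Lemma continuous_enorm n : continuous (@enorm R n).
Proof. by apply: (@lipschitz_continuous _ 1) => x z; rewrite mul1r ler_dist_enorm. Qed.

(** Balls of the maximum norm are boxes. A countable union of them reduces the Borel structure of
    row vectors to single coordinates, as [measurable_rvP] needs. *)
Lemma open_rat_boxes n (U : set 'rV[R]_n) : open U ->
  U = \bigcup_(p in [set p : 'rV[rat]_n * nat |
        ball (map_mx ratr p.1 : 'rV[R]_n) (p.2.+1%:R^-1) `<=` U])
      ball (map_mx ratr p.1 : 'rV[R]_n) (p.2.+1%:R^-1).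
Proof.
move=> oU; apply/seteqP; split; last by move=> x [p /= sub /sub].
move=> x Ux; have /nbhs_ballP[e /= e0 xe] : nbhs x U by exact: open_nbhs_nbhs.
have [k ke] : exists k : nat, k.+1%:R^-1 < e / 2.
  have e20 : 0 < e / 2 by rewrite divr_gt0.
  have [k _ hk] := near_infty_natSinv_lt (PosNum e20).
  by exists k; exact: (hk k (leqnn k)).
have kp : 0 < k.+1%:R^-1 :> R by rewrite invr_gt0.
have /choice[q qP] (j : 'I_n) : exists q : rat, `|x 0 j - ratr q| < k.+1%:R^-1.
  have /rat_in_itvoo[q] : x 0 j - k.+1%:R^-1 < x 0 j + k.+1%:R^-1.
    by move: kp; move: (k.+1%:R^-1) => t t0; lra.
  rewrite in_itv /= => /andP[q1 q2]; exists q.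
  by rewrite ltr_norml; move: q1 q2; move: (k.+1%:R^-1) => t q1 q2; apply/andP; split; lra.
have xb : ball (map_mx ratr (\row_j q j) : 'rV[R]_n) k.+1%:R^-1 x.
  by split=> // i j; rewrite !mxE (ord1 i) /ball /= distrC.
exists (\row_j q j, k) => //= z zb.
apply: xe; rewrite (splitr e).
apply: (@ball_triangle _ _ (map_mx ratr (\row_j q j) : 'rV[R]_n)).
  by apply: ball_sym; apply: le_ball xb; exact: ltW.
by apply: le_ball zb; exact: ltW.
Qed.

Lemma measurable_open n (U : set 'rV[R]_n) : open U -> measurable (U : set (rvB R n)).
Proof. exact: sub_sigma_algebra. Qed.

Lemma continuous_measurable_rv n (g : 'rV[R]_n -> R) :
  continuous g -> measurable_fun (setT : set (rvB R n)) g.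
Proof.
move=> gc; apply: (@measurability _ _ (rvB R n) _ setT g _ (RGenOpens.measurableE R)).
move=> _ [_ [a [b ->]] <-]; rewrite setTI.
by apply: measurable_open; move/continuousP: gc; apply; exact: interval_open.
Qed.

Lemma measurable_coord n (j : 'I_n) : measurable_fun (setT : set (rvB R n)) (fun x : 'rV[R]_n => x 0 j).
Proof. by apply: continuous_measurable_rv; exact: coord_continuous. Qed.

Lemma measurable_enorm n : measurable_fun (setT : set (rvB R n)) (@enorm R n).
Proof. by apply: continuous_measurable_rv; exact: continuous_enorm. Qed.

Lemma measurable_rvP d (T : measurableType d) n (f : T -> 'rV[R]_n) :
  measurable_fun setT (f : T -> rvB R n) <->
  forall j, measurable_fun setT (fun w => f w 0 j).
Proof.
split=> [mf j|mf].
  exact: (measurableT_comp (measurable_coord j) mf).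
apply: (@measurability _ _ T (rvB R n) setT f [set U : set 'rV[R]_n | open U]) => //.
move=> _ [U oU <-]; rewrite setTI (open_rat_boxes oU) preimage_bigcup.
rewrite bigcup_mkcond; apply: countable_bigcupT_measurable => [|p].
  exact: countableP.
case: ifPn => // _.
have -> : f @^-1` ball (map_mx ratr p.1 : 'rV[R]_n) p.2.+1%:R^-1 =
    \bigcap_(j in [set: 'I_n]) ((fun w => f w 0 j) @^-1` ball (ratr (p.1 0 j) : R) p.2.+1%:R^-1).
  apply/seteqP; split=> w /=.
    by move=> [_ h] j _ /=; have := h 0 j; rewrite mxE.
  move=> h; split=> [|i j]; first by rewrite invr_gt0.
  by rewrite (ord1 i) mxE; exact: h.
apply: fin_bigcap_measurable => // j _.
rewrite -[X in measurable X]setTI; apply: mf => //; by apply: open_measurable; apply: ball_open; rewrite invr_gt0.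
Qed.

End Measurability.

(** * Lebesgue measure on row vectors *)

Section Push.
Context d1 d2 (T1 : measurableType d1) (T2 : measurableType d2) (R : realType).
Local Open Scope ereal_scope.

(** The proof of measurability is an argument, so that the measure structure of the image can be
    inferred from the term itself. *)
Definition push (m : {measure set T1 -> \bar R}) (f : T1 -> T2)
  (mf : measurable_fun setT f) : set T2 -> \bar R := pushforward m f.

Section measure.
Variables (m : {measure set T1 -> \bar R}) (f : T1 -> T2).
Hypothesis mf : measurable_fun setT f.

Let push0 : push m mf set0 = 0.
Proof. by rewrite /push /pushforward preimage_set0 measure0. Qed.

Let push_ge0 A : 0 <= push m mf A. Proof. exact: measure_ge0. Qed.

Let push_sigma_additive : semi_sigma_additive (push m mf).
Proof. by rewrite /push; apply: measure_semi_sigma_additive. Qed.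

HB.instance Definition _ := isMeasure.Build _ _ _ (push m mf)
  push0 push_ge0 push_sigma_additive.
End measure.

Section finite.
Variables (m : {finite_measure set T1 -> \bar R}) (f : T1 -> T2).
Hypothesis mf : measurable_fun setT f.

Let push_fin : fin_num_fun (push m mf).
Proof.
move=> A mA; apply: fin_num_measure.
by rewrite -[X in measurable X]setTI; exact: mf.
Qed.

HB.instance Definition _ := Measure_isFinite.Build _ _ _ (push m mf) push_fin.
End finite.

Lemma ge0_integral_push (m : {measure set T1 -> \bar R}) (f : T1 -> T2)
    (mf : measurable_fun setT f) (g : T2 -> \bar R) :
  measurable_fun setT g -> (forall y, 0 <= g y) ->
  \int[push m mf]_y g y = \int[m]_x g (f x).
Proof.
by move=> mg g0; rewrite /push ge0_integral_pushforward// preimage_setT.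
Qed.

End Push.

Section LebesgueRn.
Context {R : realType}.
Notation mu := (@lebesgue_measure R).
Local Open Scope ereal_scope.

Lemma measurable_affine (s b : R) : measurable_fun setT (fun t : R => s * t + b)%R.
Proof. by apply: measurable_funD => //; exact: measurable_funM. Qed.

(** Uniqueness of Lebesgue measure leaves only the intervals []x, y]] to check. For negative [s] the
    preimage is half-open at the other end, with the same length. *)
Lemma lebesgue_measure_affine (s b : R) (A : set R) : s != 0%R -> measurable A ->
  mu A = `|s|%:E * mu ((fun t => s * t + b)%R @^-1` A).
Proof.
move=> s0 mA.
pose f := (fun t : R => s * t + b)%R : measurableTypeR R -> measurableTypeR R.
have mf : measurable_fun setT f by exact: measurable_affine.
pose nu := mscale (NngNum (normr_ge0 s)) (push mu mf).
rewrite (@lebesgue_measure_unique _ nu _ A mA)//= => _ [[x y] _ <-].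
rewrite /nu /mscale/= /push /pushforward.
have sp : (0 < `|s|)%R by rewrite normr_gt0.
have [sneg|spos|s00] := ltgtP s 0%R; last by rewrite s00 eqxx in s0.
- have -> : f @^-1` `]x, y] = `[((y - b) / s)%R, ((x - b) / s)%R[%classic.
    apply/seteqP; split => t; rewrite /f/= !in_itv/=.
      move=> /andP[h1 h2]; rewrite ler_ndivrMr// ltr_ndivlMr//.
      by apply/andP; split; lra.
    rewrite ler_ndivrMr// ltr_ndivlMr// => /andP[h1 h2].
    by apply/andP; split; lra.
  rewrite !lebesgue_measure_itv/= !lte_fin ltr_ndivlMr// divfK ?lt_eqF//.
  rewrite ltrD2r; case: ifPn => _; last by rewrite mule0.
  rewrite -!EFinD -EFinM; congr _%:E; rewrite ltr0_norm//; field.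
  by rewrite lt_eqF.
- have -> : f @^-1` `]x, y] = `]((x - b) / s)%R, ((y - b) / s)%R]%classic.
    apply/seteqP; split => t; rewrite /f/= !in_itv/=.
      move=> /andP[h1 h2]; rewrite ler_pdivlMr// ltr_pdivrMr//.
      by apply/andP; split; lra.
    rewrite ler_pdivlMr// ltr_pdivrMr// => /andP[h1 h2].
    by apply/andP; split; lra.
  rewrite !lebesgue_measure_itv/= !lte_fin ltr_pdivrMr// divfK ?gt_eqF//.
  rewrite ltrD2r; case: ifPn => _; last by rewrite mule0.
  rewrite -!EFinD -EFinM; congr _%:E; rewrite gtr0_norm//; field.
  by rewrite gt_eqF.
Qed.

Lemma ge0_integral_affine (s b : R) (f : R -> \bar R) : s != 0%R ->
  measurable_fun setT f -> (forall t, 0 <= f t) ->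
  \int[mu]_t f (s * t + b)%R = (`|s|^-1)%:E * \int[mu]_t f t.
Proof.
move=> s0 mf f0.
pose g := (fun t : R => s * t + b)%R : measurableTypeR R -> measurableTypeR R.
have mg : measurable_fun setT g by exact: measurable_affine.
have -> : \int[mu]_t f t = \int[mscale (NngNum (normr_ge0 s)) (push mu mg)]_t f t.
  apply: eq_measure_integral => A mA _ /=.
  by rewrite /mscale/= (lebesgue_measure_affine b s0 mA).
rewrite ge0_integral_mscale//= ge0_integral_push//=.
rewrite muleA -EFinM mulVf ?normr_eq0// mul1e.
by [].
Qed.

(** The splitting of a vector on which [iter_int] recurses, as a map on pairs. *)
Definition row_cons k (p : R * 'rV[R]_k) : 'rV[R]_k.+1 :=
  row_mx (const_mx p.1 : 'rV[R]_1) p.2.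

Definition row_uncons k (x : 'rV[R]_k.+1) : R * 'rV[R]_k :=
  ((lsubmx (x : 'rV[R]_(1 + k))) 0%R 0%R, rsubmx (x : 'rV[R]_(1 + k))).

Lemma row_consK k : cancel (@row_cons k) (@row_uncons k).
Proof.
move=> [t x]; rewrite /row_cons /row_uncons row_mxKl row_mxKr/=; congr pair.
by rewrite mxE.
Qed.

Lemma row_unconsK k : cancel (@row_uncons k) (@row_cons k).
Proof.
move=> x; rewrite /row_cons /row_uncons/=.
have -> : const_mx (lsubmx (x : 'rV[R]_(1 + k)) 0%R 0%R) =
    lsubmx (x : 'rV[R]_(1 + k)) :> 'rV[R]_1.
  by apply/matrixP => i j; rewrite !mxE !ord1.
exact: (@hsubmxK _ 1 1 k x).
Qed.

Lemma row_consEl k p (i : 'I_1) : @row_cons k p 0%R (lshift k i) = p.1.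
Proof. by apply: etrans (row_mxEl _ _ _ _) _; rewrite mxE. Qed.

Lemma row_consEr k p (i : 'I_k) : @row_cons k p 0%R (rshift 1 i) = p.2 0%R i.
Proof. exact: row_mxEr. Qed.

Lemma measurable_row_cons k :
  measurable_fun setT (@row_cons k : R * rvB R k -> rvB R k.+1).
Proof.
apply/(@measurable_rvP R _ (R * rvB R k)%type k.+1 (@row_cons k)) => j.
have [i|i] := split_ordP (j : 'I_(1 + k)).
- move=> ->; apply: (eq_measurable_fun fst) => [p _|]; first by rewrite row_consEl.
  exact: measurable_fst.
- move=> ->; apply: (eq_measurable_fun (fun p : R * rvB R k => (p.2 : 'rV[R]_k) 0%R i)) => [p _|].
    by rewrite row_consEr.
  exact: (measurableT_comp (measurable_coord i) measurable_snd).
Qed.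

Lemma measurable_row_uncons k :
  measurable_fun setT (@row_uncons k : rvB R k.+1 -> R * rvB R k).
Proof.
have m1 : measurable_fun setT (fun x : rvB R k.+1 => (row_uncons x).1).
  apply: (@eq_measurable_fun _ _ _ _ _ (fun x : rvB R k.+1 =>
      (x : 'rV[R]_k.+1) 0%R (lshift k (ord0 : 'I_1)))) => [x _|]; first by rewrite /= mxE.
  exact: measurable_coord.
have m2 : measurable_fun setT ((fun x => (row_uncons x).2) : rvB R k.+1 -> rvB R k).
  apply/(@measurable_rvP R _ (rvB R k.+1) k) => j.
  apply: (@eq_measurable_fun _ _ _ _ _ (fun x : rvB R k.+1 =>
      (x : 'rV[R]_k.+1) 0%R (rshift 1 j))) => [x _|]; first by rewrite mxE.
  exact: measurable_coord.
exact: measurable_fun_pair m1 m2.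
Qed.

Lemma measurable_row_cons_r k (t : R) :
  measurable_fun setT ((fun x => row_cons (t, x)) : rvB R k -> rvB R k.+1).
Proof.
have : measurable_fun setT ((fun x => (t, x)) : rvB R k -> R * rvB R k).
  by apply: measurable_fun_pair.
exact: measurableT_comp (@measurable_row_cons k).
Qed.

Section succ.
Variables (k : nat) (nu : {sigma_finite_measure set (rvB R k) -> \bar R}).

Definition leb_succ : set (rvB R k.+1) -> \bar R :=
  push (mu \x nu) (@measurable_row_cons k).

HB.instance Definition _ := Measure.on leb_succ.

(** Sigma-finiteness is carried along because the product and Tonelli's theorem in the next
    dimension require it. *)
Let leb_succ_sigma_finite : sigma_finite setT leb_succ.
Proof.
have /sigma_finiteP[A [UA ndA Aoo]] := sigma_finiteT mu.
have /sigma_finiteP[B [UB ndB Boo]] := sigma_finiteT nu.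
pose F i := A i `*` B i.
have UF : setT = \bigcup_i F i.
  apply/seteqP; split => // -[x y] _.
  have [i _ Ai] : (\bigcup_i A i) x by rewrite -UA.
  have [j _ Bj] : (\bigcup_i B i) y by rewrite -UB.
  exists (maxn i j) => //; split.
  - by move: x Ai; exact/subsetPset/ndA/leq_maxl.
  - by move: y Bj; exact/subsetPset/ndB/leq_maxr.
have Foo i : measurable (F i) /\ (mu \x nu) (F i) < +oo.
  have [mA Afin] := Aoo i; have [mB Bfin] := Boo i.
  split; first exact: measurableX.
  by rewrite product_measure1E// lte_mul_pinfty// ge0_fin_numE.
exists (fun i => @row_uncons k @^-1` F i).
  by rewrite -preimage_bigcup -UF preimage_setT.
move=> i; split.
  rewrite -[X in measurable X]setTI; apply: measurable_row_uncons => //.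
  exact: (Foo i).1.
have -> : leb_succ (@row_uncons k @^-1` F i) = (mu \x nu) (F i).
  rewrite /leb_succ /push /pushforward -comp_preimage; congr ((mu \x nu) _).
  by apply/seteqP; split => p /=; rewrite row_consK.
exact: (Foo i).2.
Qed.

HB.instance Definition _ := Measure_isSigmaFinite.Build _ _ _ leb_succ
  leb_succ_sigma_finite.

End succ.

(** Dimension zero carries the Dirac mass at its only vector, in agreement with the value [f 0] of
    [iter_int]. *)
Fixpoint leb n : {sigma_finite_measure set (rvB R n) -> \bar R} :=
  match n with
  | 0 => \d_(0%R : rvB R 0)
  | k.+1 => leb_succ (leb k)
  end.

Lemma ge0_integral_leb_succ k (f : 'rV[R]_k.+1 -> \bar R) :
  measurable_fun (setT : set (rvB R k.+1)) f -> (forall x, 0 <= f x) ->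
  \int[leb k.+1]_x f x = \int[mu]_t \int[leb k]_x f (row_cons (t, x)).
Proof.
move=> mf f0.
rewrite /= /leb_succ ge0_integral_push//=.
rewrite fubini_tonelli1//.
apply: measurableT_comp mf _; exact: measurable_row_cons.
Qed.

Lemma measurable_rv_affine n (s : R) (b : 'rV[R]_n) :
  measurable_fun setT ((fun x : 'rV[R]_n => s *: x + b)%R : rvB R n -> rvB R n).
Proof.
apply/(@measurable_rvP R _ (rvB R n)) => j.
apply: (eq_measurable_fun (fun x : rvB R n =>
    (s * (x : 'rV[R]_n) 0 j + b 0 j)%R)) => [x _|]; first by rewrite !mxE.
by apply: measurable_funD => //; apply: measurable_funM => //; exact: measurable_coord.
Qed.

Lemma row_cons_affine k (s : R) (b : 'rV[R]_k.+1) t x :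
  (s *: row_cons (t, x) + b)%R =
  row_cons ((s * t + (row_uncons b).1)%R, (s *: x + (row_uncons b).2)%R).
Proof.
apply: (can_inj (@row_unconsK k)); rewrite row_consK.
have -> a : row_uncons (s *: a + b) = ((s * (row_uncons a).1 + (row_uncons b).1)%R,
    (s *: (row_uncons a).2 + (row_uncons b).2)%R).
  by rewrite /row_uncons/=; congr pair; [rewrite !mxE|apply/rowP => j; rewrite !mxE].
by rewrite row_consK.
Qed.

(** Scalings give the volume of cones, translations move the ball, and [s = -1] reflects the sphere.
    These maps act coordinate by coordinate, so each step of the induction contributes one factor
    [|s|^-1]. *)
Lemma ge0_integral_leb_affine n (s : R) (b : 'rV[R]_n) (f : 'rV[R]_n -> \bar R) :
  s != 0%R -> measurable_fun (setT : set (rvB R n)) f -> (forall x, 0 <= f x) ->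
  \int[leb n]_x f (s *: x + b)%R = ((`|s| ^+ n)^-1)%:E * \int[leb n]_x f x.
Proof.
move=> s0; elim: n b f => [|k IH] b f mf f0.
  rewrite expr0 invr1 mul1e; apply: eq_integral => x _; congr f.
  by apply/rowP => -[].
have mint : measurable_fun setT (fun t : R => \int[leb k]_x f (row_cons (t, x))).
  have mf' : measurable_fun setT (f \o (@row_cons k) : R * rvB R k -> \bar R).
    by apply: measurableT_comp mf _; exact: measurable_row_cons.
  by apply: (@measurable_fun_fubini_tonelli_F _ _ _ _ _ (leb k) _ mf') => x; exact: f0.
rewrite !ge0_integral_leb_succ//; last first.
  apply: measurableT_comp mf _; exact: measurable_rv_affine.
transitivity (\int[mu]_t ((`|s| ^+ k)^-1%:E *
    \int[leb k]_x f (row_cons ((s * t + (row_uncons b).1)%R, x)))).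
  apply: eq_integral => t _.
  rewrite -(IH (row_uncons b).2 (fun x => f (row_cons ((s * t + (row_uncons b).1)%R, x))))//; last first.
    by apply: measurableT_comp mf _; exact: measurable_row_cons_r.
  by apply: eq_integral => x _; rewrite row_cons_affine.
have g0 t : 0 <= \int[leb k]_x f (row_cons (t, x)) by exact: integral_ge0.
have mint' := measurableT_comp mint (measurable_affine s (row_uncons b).1).
rewrite ge0_integralZl//.
rewrite /= (ge0_integral_affine _ s0 mint g0).
by rewrite muleA -EFinM exprSr invfM mulrC.
Qed.

End LebesgueRn.

(** * Iterated integrals as Lebesgue integrals *)

Section IterInt.
Context {R : realType}.
Notation mu := (@lebesgue_measure R).
Local Open Scope ereal_scope.

Definition box n (M : R) : set 'rV[R]_n := [set x | forall j, (`|x 0 j| <= M)%R].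

Lemma measurable_box n M : measurable (box M : set (rvB R n)).
Proof.
have -> : box M = \bigcap_(j in [set: 'I_n]) ((fun x : 'rV[R]_n => `|x 0 j|%R) @^-1` `]-oo, M]%classic).
  by apply/seteqP; split => x /= h j; [move=> _|]; rewrite ?in_itv/=; [exact: h|have := h j I; rewrite /= in_itv].
apply: fin_bigcap_measurable => // j _; rewrite -[X in measurable X]setTI.
have : measurable_fun (setT : set (rvB R n)) (fun x : 'rV[R]_n => `|x 0 j|%R).
  exact: (measurableT_comp (@normr_measurable _ _) (measurable_coord j)).
by apply.
Qed.

Lemma leb_box_lty n M : leb n (box M) < +oo :> \bar R.
Proof.
elim: n => [|k IH].
  by rewrite /= diracE; case: (_ \in _); rewrite ltry.
rewrite /= /leb_succ /push /pushforward.
have -> : @row_cons R k @^-1` box M = `[(-M)%R, M]%classic `*` box M.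
  apply/seteqP; split => -[t x]/=.
    move=> h; split.
      by have := h (lshift k (ord0 : 'I_1)); rewrite row_consEl/= in_itv/= ler_norml.
    by move=> j; have := h (rshift 1 j); rewrite row_consEr.
  rewrite in_itv/= -ler_norml => -[ht hx] j.
  have [i|i] := split_ordP (j : 'I_(1 + k)) => ->.
    by rewrite row_consEl.
  by rewrite row_consEr; exact: hx.
have mI : measurable (`[(-M)%R, M]%classic : set (measurableTypeR R)) by [].
rewrite [ltLHS](@product_measure1E _ _ _ _ R mu (leb k) _ _ mI (@measurable_box k M)).
apply: lte_mul_pinfty; first exact: measure_ge0.
- rewrite ge0_fin_numE; last exact: measure_ge0.
  suff : lebesgue_measure (`[(-M)%R, M]%classic : set R) < +oo by [].
  by rewrite lebesgue_measure_itv/=; case: ifP => // _; rewrite -EFinD ltry.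
- exact: IH.
Qed.

Lemma bounded_box_integrable n (f : 'rV[R]_n -> R) (M : R) :
  measurable_fun (setT : set (rvB R n)) f -> (forall x, `|f x| <= M)%R ->
  (forall x, ~ box M x -> f x = 0%R) -> (leb n).-integrable setT (EFin \o f).
Proof.
move=> mf fM f0.
have -> : f = f \_ (box M).
  apply/funext => x; rewrite patchE; case: ifPn => // /negP h.
  by apply: f0 => xB; apply: h; rewrite inE.
rewrite -restrict_EFin; apply/(integrable_mkcond _ (@measurable_box n M)).
apply: measurable_bounded_integrable.
- exact: measurable_box.
- exact: leb_box_lty.
- exact: measurable_funTS.
- exists M; split; first by rewrite num_real.
  by move=> K MK x _ /=; rewrite (le_trans (fM x))// ltW.
Qed.

(** Fubini is applied at every coordinate and needs integrability of all sections. Boundedness and a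
    support in a box pass to the sections, which integrability alone would do only almost
    everywhere. *)
Lemma iter_intE n (f : 'rV[R]_n -> R) (M : R) :
  measurable_fun (setT : set (rvB R n)) f -> (forall x, `|f x| <= M)%R ->
  (forall x, ~ box M x -> f x = 0%R) ->
  iter_int f = Rintegral (leb n) setT f.
Proof.
elim: n f => [|k IH] f mf fM f0.
  rewrite /= /Rintegral integral_dirac//; last exact/measurable_EFinP.
  rewrite diracT mul1e/=; by [].
have mfr t : measurable_fun (setT : set (rvB R k)) (fun x => f (row_cons (t, x))).
  by apply: measurableT_comp mf _; exact: measurable_row_cons_r.
have f0r t x : ~ box M x -> f (row_cons (t, x)) = 0%R.
  move=> h; apply: f0 => h'; apply: h => j.
  by have := h' (rshift 1 j); rewrite row_consEr.
have int_r t : (leb k).-integrable setT (EFin \o (fun x => f (row_cons (t, x)))).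
  by apply: (@bounded_box_integrable _ _ M) => // x; exact: f0r.
rewrite /Rintegral /= /Rintegral; congr fine.
have intf := bounded_box_integrable mf fM f0.
pose g := EFin \o f \o @row_cons R k.
have mg : measurable_fun setT (g : R * rvB R k -> \bar R).
  by apply: (measurableT_comp _ (@measurable_row_cons R k)); exact/measurable_EFinP.
have intg : (mu \x leb k).-integrable setT g.
  move/integrableP : intf => [_ fin]; apply/integrableP; split => //.
  move: fin; rewrite /= /leb_succ ge0_integral_push//.
  by apply/measurable_EFinP; exact: (measurableT_comp (@normr_measurable _ _) mf).
rewrite /leb_succ /push integral_pushforward//; last 2 first.
- exact: measurable_row_cons.
- exact/measurable_EFinP.
rewrite preimage_setT -(integral12_prod_meas1 intg).
apply: eq_integral => t _.
rewrite /fubini_F /g/=.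
rewrite (IH (fun x => f (row_cons (t, x))))//; last exact: f0r.
rewrite /Rintegral fineK//.
exact: integrable_fin_num (int_r t).
Qed.
End IterInt.

(** * Polar coordinates *)

Lemma ge0_integral_mfrestr d (T : measurableType d) (R : realType)
    (m : {measure set T -> \bar R}) (D : set T) (mD : measurable D)
    (mDoo : (m D < +oo)%E) (f : T -> \bar R) :
  measurable_fun setT f -> (forall x, 0 <= f x)%E ->
  (\int[mfrestr mD mDoo]_x f x = \int[m]_(x in D) f x)%E.
Proof.
move=> mf f0; rewrite -(setUv D) ge0_integral_setU//=.
- rewrite [X in (_ + X)%E]null_set_integral ?adde0.
  + by apply: eq_measure_integral => A mA AD; rewrite /= /mfrestr /mrestr setIidl.
  + exact: measurableC.
  + exact: measurable_funTS.
  + by rewrite /= /mfrestr /mrestr setICl measure0.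
- exact: measurableC.
- by rewrite setUv.
- exact/disj_setPCl.
Qed.

Section Polar.
Context {R : realType}.
Variable k : nat.
Local Notation n := k.+1.
Local Notation lam := (@leb R n).
Local Open Scope ereal_scope.

(** Radial projection to the sphere. Since the inverse of 0 is 0, the origin is sent to itself; it
    is a null set. *)
Definition hat (z : 'rV[R]_n) : 'rV[R]_n := ((enorm z)^-1 *: z)%R.

Lemma hatZ (s : R) z : (0 < s)%R -> hat (s *: z) = hat z.
Proof.
move=> s0; rewrite /hat enormZ gtr0_norm// scalerA invfM mulrAC mulVf ?gt_eqF//.
by rewrite mul1r.
Qed.

Lemma hatN z : hat (- z) = (- hat z)%R.
Proof. by rewrite /hat enormN scalerN. Qed.

Lemma hat0 : hat 0 = 0%R.
Proof. by rewrite /hat scaler0. Qed.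

Lemma enorm_hat z : z != 0%R -> enorm (hat z) = 1%R.
Proof.
move=> z0; have zp := enorm_gt0 z0.
by rewrite /hat enormZ gtr0_norm ?invr_gt0// mulVf ?gt_eqF.
Qed.

Lemma enorm_hat_le1 z : (enorm (hat z) <= 1)%R.
Proof.
by have [->|/enorm_hat->//] := eqVneq z 0%R; rewrite hat0 enorm0.
Qed.

Lemma hatE z : z = (enorm z *: hat z)%R.
Proof.
have [->|z0] := eqVneq z 0%R; first by rewrite hat0 scaler0.
by rewrite /hat scalerA divff ?scale1r// gt_eqF// enorm_gt0.
Qed.

Lemma measurable_hat : measurable_fun setT (hat : rvB R n -> rvB R n).
Proof.
apply/(@measurable_rvP R _ (rvB R n)) => j.
apply: (@eq_measurable_fun _ _ _ _ _ (fun z : rvB R n =>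
   ((enorm (z : 'rV[R]_n))^-1 * (z : 'rV[R]_n) 0 j)%R)) => [z _|].
  by rewrite mxE.
apply: measurable_funM; last exact: measurable_coord.
apply: (@eq_measurable_fun _ _ _ _ _ (fun z : rvB R n =>
   powR (enorm (z : 'rV[R]_n)) (-1))) => [z _|].
  by rewrite powR_inv1// enorm_ge0.
by have := measurableT_comp (@measurable_powR R (-1)) (@measurable_enorm R n).
Qed.

Definition eball (r : R) : set 'rV[R]_n := [set z | enorm z <= r]%R.

Lemma in_eball r z : (z \in eball r) = (enorm z <= r)%R.
Proof. by apply/idP/idP; rewrite inE. Qed.

Lemma measurable_eball r : measurable (eball r : set (rvB R n)).
Proof.
rewrite [X in measurable X](_ : _ = setT `&` @enorm R n @^-1` `]-oo, r]%classic).
  by apply: measurable_enorm.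
by rewrite setTI; apply/seteqP; split => z /=; rewrite in_itv.
Qed.

Lemma eball_box r : eball r `<=` box r.
Proof. by move=> z zr j; rewrite (le_trans (coord_le_enorm _ _)). Qed.

Lemma leb_eball_lty r : lam (eball r) < +oo.
Proof.
apply: le_lt_trans (leb_box_lty n r); apply: le_measure.
- by rewrite inE; exact: measurable_eball.
- by rewrite inE; exact: measurable_box.
- exact: eball_box.
Qed.

Lemma leb_scale (s : R) (A : set 'rV[R]_n) : (0 < s)%R ->
  measurable (A : set (rvB R n)) ->
  lam [set z | A (s *: z)%R] = ((s ^+ n)^-1)%:E * lam A.
Proof.
move=> s0 mA.
have mB : measurable ([set z | A (s *: z)%R] : set (rvB R n)).
  have := @measurable_rv_affine R n s 0%R measurableT _ mA; rewrite setTI.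
  by congr measurable; apply/seteqP; split => z /=; rewrite addr0.
have I_lam (C : set 'rV[R]_n) : measurable (C : set (rvB R n)) ->
    lam C = \int[lam]_z (\1_C z)%:E.
  by move=> mC; rewrite integral_indic// setIT.
have := @ge0_integral_leb_affine R n s 0%R (fun z => (\1_A z)%:E).
rewrite gtr0_norm// (I_lam _ mA) (I_lam _ mB) => <-.
- by apply: eq_integral => z _ /=; rewrite addr0.
- by rewrite gt_eqF.
- by apply/measurable_EFinP; exact: measurable_indic.
- by move=> z /=; rewrite lee_fin.
Qed.

(** [hat] is invariant under positive scaling, so the part of a cone in the ball of radius [x] is a
    dilate of its part in the unit ball. The polar coordinates below rest on this homogeneity. *)
Lemma leb_cone (x : R) (B : set 'rV[R]_n) : (0 < x)%R ->
  measurable (B : set (rvB R n)) ->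
  lam (eball x `&` hat @^-1` B) = (x ^+ n)%:E * lam (eball 1 `&` hat @^-1` B).
Proof.
move=> x0 mB.
have mhB : measurable (hat @^-1` B : set (rvB R n)).
  by rewrite -[X in measurable X]setTI; exact: measurable_hat.
have -> : eball x `&` hat @^-1` B = [set z | (eball 1 `&` hat @^-1` B) (x^-1 *: z)%R].
  apply/seteqP; split => z /=; rewrite /eball/= hatZ ?invr_gt0// enormZ gtr0_norm ?invr_gt0//.
    by rewrite ler_pdivrMl// mulr1.
  by rewrite ler_pdivrMl// mulr1.
rewrite leb_scale ?invr_gt0//; first by rewrite exprVn invrK.
by apply: measurableI => //; exact: measurable_eball.
Qed.

Lemma leb_eballE (x : R) : (0 < x)%R -> lam (eball x) = (x ^+ n)%:E * lam (eball 1).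
Proof. by move=> x0; have := @leb_cone x setT x0 measurableT; rewrite preimage_setT !setIT. Qed.

Lemma eball0 : eball 0 = [set 0%R].
Proof.
apply/seteqP; split => z /=; rewrite /eball/=; last by move=> ->; rewrite enorm0.
by move=> z0; apply: enorm_eq0; apply/eqP; rewrite eq_le z0 enorm_ge0.
Qed.

(** Scaling by 2 fixes the origin, yet divides its finite measure by [2 ^+ n] with [n] positive. *)
Lemma leb0 : lam [set 0%R] = 0.
Proof.
rewrite -eball0.
have : lam (eball 0) \is a fin_num.
  by rewrite ge0_fin_numE ?leb_eball_lty//; exact: measure_ge0.
have := @leb_scale 2%R (eball 0) (@ltr0Sn R 1) (measurable_eball 0).
have -> : [set z | eball 0 (2 *: z)%R] = eball 0.
  by apply/seteqP; split => z /=; rewrite /eball/= enormZ gtr0_norm// pmulr_rle0.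
move=> + /fineK a0; rewrite -a0; move: (fine _) => a.
rewrite -EFinM; case => ha; suff -> : (a = 0)%R by [].
apply/eqP.
have p1 : (1 < 2 ^+ n :> R)%R by rewrite exprn_egt1// ltr1n.
have : (a * (2 ^+ n - 1) = 0)%R.
  by rewrite mulrBr mulr1 {1}ha mulrAC mulVf ?mul1r ?subrr// gt_eqF// (lt_trans _ p1).
by move/eqP; rewrite mulf_eq0 subr_eq0 (gt_eqF p1) orbF.
Qed.

Lemma measurable_hat_preimage (B : set 'rV[R]_n) :
  measurable (B : set (rvB R n)) -> measurable (hat @^-1` B : set (rvB R n)).
Proof. by move=> mB; rewrite -[X in measurable X]setTI; exact: measurable_hat. Qed.

(** The point is that [r] depends on [x] but not on [B]: radius and direction are independent under
    Lebesgue measure on the ball of radius 2. *)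
Lemma leb_shell (x : R) : exists r : R, forall B : set 'rV[R]_n,
  measurable (B : set (rvB R n)) ->
  lam ((@enorm R n @^-1` `]x, +oo[ `&` hat @^-1` B) `&` eball 2) =
  r%:E * lam (eball 1 `&` hat @^-1` B).
Proof.
have [x0|x0] := ltP x 0%R.
  exists (2 ^+ n)%R => B mB; rewrite -leb_cone//; congr (lam _).
  apply/seteqP; split => z /=; first by move=> [[_ ?] ?].
  move=> [h1 h2]; split => //; split => //; rewrite in_itv/= andbT.
  by rewrite (lt_le_trans x0)// enorm_ge0.
have [x2|x2] := leP 2%R x.
  exists 0%R => B mB; rewrite mul0e -[RHS](measure0 lam); congr (lam _).
  apply/seteqP; split => z //= -[[]]; rewrite in_itv/= andbT /eball/= => h _ h'.
  by have := lt_le_trans h (le_trans h' x2); rewrite ltxx.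
exists (2 ^+ n - x ^+ n)%R => B mB.
have mhB := measurable_hat_preimage mB.
have mE r : measurable (eball r `&` hat @^-1` B : set (rvB R n)).
  by apply: measurableI => //; exact: measurable_eball.
have -> : (@enorm R n @^-1` `]x, +oo[ `&` hat @^-1` B) `&` eball 2 =
    (eball 2 `&` hat @^-1` B) `\` (eball x `&` hat @^-1` B).
  apply/seteqP; split => z /=; rewrite in_itv/= andbT /eball/=.
    move=> [[h1 h2] h3]; split => // -[h4 _].
    by have := lt_le_trans h1 h4; rewrite ltxx.
  move=> [[h1 h2] h3]; split => //; split => //; rewrite ltNge; apply/negP => h4.
  exact: h3.
have fin r : lam (eball r `&` hat @^-1` B) < +oo.
  apply: le_lt_trans (leb_eball_lty r); apply: le_measure; rewrite ?inE//.
    exact: measurable_eball.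
rewrite measureD//; last exact: fin.
have sub : eball x `&` hat @^-1` B `<=` eball 2 `&` hat @^-1` B.
  by move=> z [h1 h2]; split => //; exact: le_trans h1 (ltW x2).
rewrite (setIidr sub).
(* [leb_cone] asks for a positive radius; radius 0 leaves at most the origin, a null set. *)
have Ex : lam (eball x `&` hat @^-1` B) = (x ^+ n)%:E * lam (eball 1 `&` hat @^-1` B).
  have [xp|xn] := ltP 0%R x; first exact: leb_cone.
  have -> : x = 0%R by apply/eqP; rewrite eq_le x0 xn.
  rewrite expr0n mul0e; apply/eqP; rewrite -measure_le0 -leb0 -eball0.
  apply: le_measure; rewrite ?inE//; first exact: measurable_eball.
transitivity (lam (eball 2 `&` hat @^-1` B) -
    (x ^+ n)%:E * lam (eball 1 `&` hat @^-1` B)); first by congr (_ - _).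
rewrite leb_cone//.
have : lam (eball 1 `&` hat @^-1` B) \is a fin_num.
  by rewrite ge0_fin_numE ?fin//; exact: measure_ge0.
move=> /fineK <-.
by rewrite -!EFinM -EFinB mulrBl.
Qed.

Definition pol (z : 'rV[R]_n) : R * 'rV[R]_n := (enorm z, hat z).

Lemma measurable_pol : measurable_fun setT (pol : rvB R n -> R * rvB R n).
Proof.
by apply: measurable_fun_pair; [exact: measurable_enorm|exact: measurable_hat].
Qed.

Local Notation m2 := (mfrestr (measurable_eball 2) (leb_eball_lty 2)).

(** For fixed [B] both sides are finite measures in [A], so they are compared on half-lines []x,
    +oo[], where [leb_shell] gives both the same radial factor. Multiplying by [m2 setT] avoids
    dividing by a volume that may still be zero. The ball of radius 2 is large enough for all
    star-shaped sets below. *)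
Lemma polar_rect (A : set R) (B : set 'rV[R]_n) :
  measurable A -> measurable (B : set (rvB R n)) ->
  m2 setT * m2 (@enorm R n @^-1` A `&` hat @^-1` B) =
  m2 (@enorm R n @^-1` A) * m2 (hat @^-1` B).
Proof.
move=> mA mB; have mhB := measurable_hat_preimage mB.
have m2fin C : measurable (C : set (rvB R n)) -> m2 C \is a fin_num.
  exact: fin_num_measure.
have V0 : (0 <= fine (m2 setT))%R by exact: fine_ge0.
have c0 : (0 <= fine (m2 (hat @^-1` B)))%R by exact: fine_ge0.
have m2Boo : m2 (hat @^-1` B) < +oo by rewrite ltey_eq m2fin.
pose mu1 := mscale (NngNum V0) (push (mfrestr mhB m2Boo) (@measurable_enorm R n)).
pose mu2 := mscale (NngNum c0) (push m2 (@measurable_enorm R n)).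
have mu1E C : mu1 C = m2 setT * m2 (@enorm R n @^-1` C `&` hat @^-1` B).
  transitivity ((fine (m2 setT))%:E * m2 (@enorm R n @^-1` C `&` hat @^-1` B)) => //.
  by rewrite fineK// m2fin.
have mu2E C : mu2 C = m2 (hat @^-1` B) * m2 (@enorm R n @^-1` C).
  transitivity ((fine (m2 (hat @^-1` B)))%:E * m2 (@enorm R n @^-1` C)) => //.
  by rewrite fineK// m2fin.
suff /(_ A mA) : forall A, measurable A -> mu1 A = mu2 A.
  by rewrite mu1E mu2E => ->; rewrite muleC.
apply: (@measure_unique _ R R (@RGenOInfty.G R) (fun i : nat => `](- (i%:R : R))%R, +oo[%classic) (RGenOInfty.measurableE R)).
- move=> _ _ [x ->] [y ->]; exists (Num.max x y).
  by apply/seteqP; split => z /=; rewrite !in_itv/= !andbT gt_max => /andP.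
- by move=> i; exists (- i%:R)%R.
- apply/seteqP; split => // x _; exists (Num.trunc `|x|).+1 => //=.
  rewrite in_itv/= andbT ltrNl; apply: le_lt_trans (truncnS_gt _).
  by rewrite -normrN ler_norm.
- move=> _ [x ->]; apply: etrans (mu1E _) _; apply: etrans _ (esym (mu2E _)).
  have [r hr] := leb_shell x.
  have -> : m2 setT = (2 ^+ n)%:E * lam (eball 1).
    by rewrite -leb_eballE// /m2 /= /mfrestr /mrestr setTI.
  have -> : m2 (hat @^-1` B) = (2 ^+ n)%:E * lam (eball 1 `&` hat @^-1` B).
    by rewrite -leb_cone// /m2 /= /mfrestr /mrestr setIC.
  have -> : m2 (@enorm R n @^-1` `]x, +oo[ `&` hat @^-1` B) =
      r%:E * lam (eball 1 `&` hat @^-1` B) by rewrite -hr.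
  have -> : m2 (@enorm R n @^-1` `]x, +oo[) = r%:E * lam (eball 1).
    have := hr setT measurableT; rewrite preimage_setT !setIT => <-; by [].
  by rewrite -!muleA; congr (_ * _); rewrite muleCA [RHS]muleCA; congr (_ * _); rewrite muleC.
- move=> i; change (mu1 `](- (i%:R : R))%R, +oo[%classic < +oo); rewrite mu1E ltey_eq fin_numM// m2fin//.
  apply: measurableI => //; rewrite -[X in measurable X]setTI.
  by apply: measurable_enorm.
Qed.

(** By [polar_rect] the joint law of radius and direction is, up to the factor [m2 setT], the
    product of its marginals. Tonelli then integrates over the radius at a fixed direction. *)
Lemma ge0_integral_polar (g : R * 'rV[R]_n -> \bar R) :
  measurable_fun (setT : set (R * rvB R n)) g -> (forall p, 0 <= g p) ->
  m2 setT * \int[m2]_z g (enorm z, hat z) = \int[m2]_u \int[m2]_z g (enorm z, hat u).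
Proof.
move=> mg g0.
have V0 : (0 <= fine (m2 setT))%R by exact: fine_ge0.
pose kappa := push m2 (@measurable_enorm R n).
pose c := push m2 measurable_hat.
pose M := mscale (NngNum V0) (push m2 measurable_pol).
have ME A B : measurable A -> measurable B -> M (A `*` B) = kappa A * c B.
  move=> mA mB; rewrite -[RHS]polar_rect//.
  transitivity ((fine (m2 setT))%:E * m2 (@enorm R n @^-1` A `&` hat @^-1` B)) => //.
  by rewrite fineK// fin_num_measure.
have := @fubini_tonelli2 _ _ _ _ R kappa c g mg g0.
have -> : \int[kappa \x c]_z g z = \int[M]_z g z.
  apply: eq_measure_integral => C mC _.
  exact: (product_measure_unique ME).
have -> : \int[M]_p g p = m2 setT * \int[m2]_z g (enorm z, hat z).
  rewrite -(fineK (fin_num_measure m2 setT measurableT)).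
  rewrite -(ge0_integral_push m2 measurable_pol mg g0).
  by rewrite -(ge0_integral_mscale _ measurableT (NngNum V0) mg).
move=> ->.
rewrite /fubini_G ge0_integral_push//.
- apply: eq_integral => u _; rewrite ge0_integral_push//.
  exact: measurableT_comp mg _.
- exact: measurable_fun_fubini_tonelli_G.
- by move=> y; exact: integral_ge0.
Qed.

End Polar.

Lemma measurable_le_set d (T : measurableType d) (R : realType) (f g : T -> R) :
  measurable_fun setT f -> measurable_fun setT g ->
  measurable [set x | (f x <= g x)%R].
Proof.
move=> mf mg; have := measurable_fun_ler mf mg.
move=> /(_ measurableT [set true] I); by rewrite setTI.
Qed.

Lemma integral_indicl d (T : measurableType d) (R : realType)
    (m : {measure set T -> \bar R}) (D : set T) (f : T -> R) :
  (\int[m]_(x in D) (f x)%:E = \int[m]_x (\1_D x * f x)%:E)%E.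
Proof.
rewrite integral_mkcond; apply: eq_integral => x _.
by rewrite patchE indicE; case: (x \in D); rewrite ?mul1r ?mul0r.
Qed.

(** * Integrals over star-shaped sets *)

Section Star.
Context {R : realType}.
Variable k : nat.
Local Notation n := k.+1.
Local Notation lam := (@leb R n).
Local Notation hat := (@hat R k).
Local Notation eball := (@eball R k).
Implicit Types (f g : 'rV[R]_n -> R).

Lemma measurable_comp_hat (f : 'rV[R]_n -> R) :
  measurable_fun (setT : set (rvB R n)) f ->
  measurable_fun (setT : set (rvB R n)) (fun z => f (hat z)).
Proof. by move=> mf; exact: (measurableT_comp mf (@measurable_hat R k)). Qed.

Lemma measurable_indicM (A : set 'rV[R]_n) f : measurable (A : set (rvB R n)) ->
  measurable_fun (setT : set (rvB R n)) f ->
  measurable_fun (setT : set (rvB R n)) (fun z => \1_A z * f z).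
Proof. by move=> mA mf; apply: measurable_funM => //; exact: measurable_indic. Qed.

Lemma ge0_integral_cone f (x : R) : 0 < x ->
  measurable_fun (setT : set (rvB R n)) f -> (forall z, 0 <= f (hat z)) ->
  (\int[lam]_(z in eball x) (f (hat z))%:E =
   (x ^+ n)%:E * \int[lam]_(z in eball 1%R) (f (hat z))%:E)%E.
Proof.
move=> x0 mf f0; rewrite (@integral_indicl _ (rvB R n) _ _ (eball x)) (@integral_indicl _ (rvB R n) _ _ (eball 1)).
have xV : 0 < x^-1 by rewrite invr_gt0.
have := @ge0_integral_leb_affine R n x^-1 0 (fun z => (\1_(eball 1) z * f (hat z))%:E).
rewrite gtr0_norm// exprVn invrK => <-.
- apply: eq_integral => z _; rewrite addr0 hatZ// !indicE.
  suff -> : (x^-1 *: z \in eball 1) = (z \in eball x) by [].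
  by rewrite !in_eball enormZ gtr0_norm// ler_pdivrMl// mulr1.
- by rewrite gt_eqF.
- apply/measurable_EFinP; apply: measurable_indicM; first exact: measurable_eball.
  exact: measurable_comp_hat.
- by move=> z; rewrite lee_fin mulr_ge0.
Qed.

Hypothesis V0 : (0 < lam (eball 1))%E.

Definition star (rho : 'rV[R]_n -> R) : set 'rV[R]_n :=
  [set z | enorm z <= rho (hat z)].

Lemma measurable_star (rho : 'rV[R]_n -> R) : measurable_fun (setT : set (rvB R n)) rho ->
  measurable (star rho : set (rvB R n)).
Proof.
move=> mrho; apply: (@measurable_le_set _ (rvB R n)).
  exact: measurable_enorm.
exact: measurable_comp_hat.
Qed.

(** At a fixed direction the polar integral sees the ball of radius [rho], whose volume is
    [rho ^+ n] times that of the unit ball. *)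
Lemma ge0_integral_star (rho f : 'rV[R]_n -> R) :
  measurable_fun (setT : set (rvB R n)) rho -> (forall z, 0 < rho (hat z) <= 2) ->
  measurable_fun (setT : set (rvB R n)) f -> (forall z, 0 <= f z) ->
  (\int[lam]_(z in star rho) (f (hat z))%:E =
   \int[lam]_(z in eball 1%R) (f (hat z) * rho (hat z) ^+ n)%:E)%E.
Proof.
move=> mrho rho2 mf f0.
have fin1 : lam (eball 1) \is a fin_num.
  by rewrite ge0_fin_numE ?leb_eball_lty//; exact: measure_ge0.
pose m2 := mfrestr (@measurable_eball R k 2) (@leb_eball_lty R k 2).
have m2T : m2 setT = ((2 ^+ n)%:E * lam (eball 1))%E.
  by rewrite -leb_eballE// /m2 /= /mfrestr /mrestr setTI.
pose S := [set p : R * 'rV[R]_n | p.1 <= rho p.2].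
have mS : measurable (S : set (R * rvB R n)).
  apply: (@measurable_le_set _ (R * rvB R n)%type).
    exact: measurable_fst.
  exact: (measurableT_comp mrho measurable_snd).
pose g (p : R * 'rV[R]_n) := (\1_S p * f p.2)%:E.
have mg : measurable_fun (setT : set (R * rvB R n)) g.
  apply/measurable_EFinP; apply: measurable_funM; first exact: measurable_indic.
  exact: (measurableT_comp mf measurable_snd).
have g0 p : (0 <= g p)%E by rewrite lee_fin mulr_ge0.
have := ge0_integral_polar mg g0; rewrite -/m2.
have mgp : measurable_fun (setT : set (rvB R n)) (fun z => g (enorm z, hat z)).
  exact: (measurableT_comp mg (@measurable_pol R k)).
have -> := ge0_integral_mfrestr (@measurable_eball R k 2) (@leb_eball_lty R k 2) mgp (fun z => g0 _).
have -> : (\int[lam]_(z in eball 2) g (enorm z, hat z) =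
    \int[lam]_(z in star rho) (f (hat z))%:E)%E.
  rewrite integral_mkcond [RHS]integral_mkcond; apply: eq_integral => z _.
  rewrite !patchE /g indicE; case: ifPn => [/set_mem z2|/negP z2].
    by case: ifPn => [/set_mem zs|/negP zs]; [rewrite mem_set ?mul1r//|
       rewrite memNset ?mul0r// => h; apply: zs; rewrite inE].
  case: ifPn => // /set_mem zs; exfalso; apply: z2; rewrite in_eball.
  by rewrite (le_trans zs)//; case/andP: (rho2 z).
have -> : (\int[m2]_u \int[m2]_z g (enorm z, hat u) =
    \int[m2]_u ((f (hat u) * rho (hat u) ^+ n)%:E * lam (eball 1)))%E.
  apply: eq_integral => u _.
  have /andP[r0 r2] := rho2 u.
  transitivity (\int[m2]_z ((f (hat u))%:E * (\1_(eball (rho (hat u))) z)%:E))%E.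
    apply: eq_integral => z _; rewrite /g -EFinM mulrC !indicE.
    suff -> : (z \in eball (rho (hat u))) = ((enorm z, hat u) \in S) by [].
    by rewrite in_eball; apply/idP/idP; rewrite !inE.
  have mE := @measurable_eball R k (rho (hat u)).
  have mI : measurable_fun (setT : set (rvB R n))
      (fun z : 'rV[R]_n => (\1_(eball (rho (hat u))) z : R)%:E).
    by apply/measurable_EFinP; exact: measurable_indic.
  rewrite ge0_integralZl ?lee_fin//.
  rewrite integral_indic// setIT EFinM -muleA; congr (_ * _)%E.
  rewrite -leb_eballE// /m2 /= /mfrestr /mrestr setIidl// => z zr.
  exact: le_trans zr r2.
rewrite m2T.
have mfr : measurable_fun (setT : set (rvB R n)) (fun z => f z * rho z ^+ n).
  by apply: measurable_funM => //; exact: measurable_funX.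
have fr0 z : 0 <= f (hat z) * rho (hat z) ^+ n.
  by rewrite mulr_ge0// exprn_ge0//; case/andP: (rho2 z) => /ltW.
have mfr' : measurable_fun (setT : set (rvB R n))
    (fun z => (f (hat z) * rho (hat z) ^+ n)%:E).
  by apply/measurable_EFinP; exact: (measurable_comp_hat mfr).
rewrite ge0_integralZr ?measure_ge0//; last by move=> z _; rewrite lee_fin.
have -> := ge0_integral_mfrestr (@measurable_eball R k 2) (@leb_eball_lty R k 2) mfr' (fun z => fr0 z).
have -> : (\int[lam]_(u in eball 2) (f (hat u) * rho (hat u) ^+ n)%:E =
  (2 ^+ n)%:E * \int[lam]_(u in eball 1) (f (hat u) * rho (hat u) ^+ n)%:E)%E.
  exact: (ge0_integral_cone _ mfr).
set A := (\int[lam]_(z in star rho) _)%E; set B := (\int[lam]_(u in eball 1) _)%E.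
(* Both sides carry the factor [2 ^+ n] and the volume of the unit ball. Cancelling them uses
   [V0]. *)
have p2 : (2 ^+ n : R) != 0 by rewrite gt_eqF// exprn_gt0.
rewrite -muleA -muleA; move=> /(congr1 (fun e => ((2 ^+ n)^-1)%:E * e)%E).
rewrite !muleA -!EFinM mulVf// !mul1e muleC.
have v0 : fine (lam (eball 1)) != 0.
  by rewrite fine_eq0// gt_eqF.
move=> /(congr1 (fun e => e * ((fine (lam (eball 1)))^-1)%:E)%E).
by rewrite -(fineK fin1) -!muleA -!EFinM divff// !mule1.
Qed.

End Star.

(** * Signed integrals and their symmetries *)

Section SignedIntegrals.
Context {R : realType}.
Variable k : nat.
Local Notation n := k.+1.
Local Notation lam := (@leb R n).
Local Notation hat := (@hat R k).
Local Notation eball := (@eball R k).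
Local Notation meas f := (measurable_fun (setT : set (rvB R n)) f).
Implicit Types (f g : 'rV[R]_n -> R).

Definition Rint f : R := Rintegral lam setT f.

Local Notation integ f := (lam.-integrable setT (EFin \o f)).

Lemma integ_supp (A : set 'rV[R]_n) f (r C : R) :
  measurable (A : set (rvB R n)) -> A `<=` eball r -> meas f ->
  (forall z, A z -> `|f z| <= C) -> integ (fun z => \1_A z * f z).
Proof.
move=> mA Ar mf fC; pose M := Num.max `|C| r.
apply: (@bounded_box_integrable R n _ M).
- exact: measurable_indicM.
- move=> z; rewrite indicE; have [/set_mem zA|_] := boolP (z \in A).
    by rewrite mul1r le_max (le_trans (fC z zA) (ler_norm _)).
  by rewrite mul0r normr0 le_max normr_ge0.
- move=> z zM; rewrite indicE memNset ?mul0r// => zA; apply: zM => j.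
  by rewrite le_max orbC (eball_box (Ar _ zA)).
Qed.

Lemma integB f g : integ f -> integ g -> integ (fun z => f z - g z).
Proof. by move=> hf hg; exact: (integrableB measurableT hf hg). Qed.

Lemma integZ c f : integ f -> integ (fun z => c * f z).
Proof. by move=> hf; exact: (integrableZl measurableT c hf). Qed.

Lemma RintD f g : integ f -> integ g -> Rint (fun z => f z + g z) = Rint f + Rint g.
Proof. by move=> hf hg; rewrite /Rint RintegralD. Qed.

Lemma RintB f g : integ f -> integ g -> Rint (fun z => f z - g z) = Rint f - Rint g.
Proof. by move=> hf hg; rewrite /Rint RintegralB. Qed.

Lemma RintZ f c : integ f -> Rint (fun z => c * f z) = c * Rint f.
Proof. by move=> hf; rewrite /Rint RintegralZl. Qed.

Lemma le_Rint f g : integ f -> integ g -> (forall z, f z <= g z) -> Rint f <= Rint g.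
Proof. by move=> hf hg fg; rewrite /Rint le_Rintegral. Qed.

Lemma le_norm_Rint f g : integ f -> integ g -> (forall z, `|f z| <= g z) ->
  `|Rint f| <= Rint g.
Proof.
move=> hf hg fg; apply: le_trans (le_normr_Rintegral _ hf) _ => //.
by apply: le_Rint => //; exact: (integrable_norm hf).
Qed.

Lemma eq_Rint f g : f =1 g -> Rint f = Rint g.
Proof. by move=> fg; apply: eq_Rintegral => z _; exact: fg. Qed.

Lemma Rint_affine (s : R) b f : `|s| = 1 -> meas f ->
  Rint (fun z => f (s *: z + b)) = Rint f.
Proof.
move=> s1 mf; have s0 : s != 0 by rewrite -normr_gt0 s1.
have h (g : 'rV[R]_n -> \bar R) : measurable_fun (setT : set (rvB R n)) g ->
    (forall z, 0 <= g z)%E -> (\int[lam]_z g (s *: z + b)%R = \int[lam]_z g z)%E.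
  by move=> mg g0; rewrite ge0_integral_leb_affine// s1 expr1n invr1 mul1e.
have mEf : measurable_fun (setT : set (rvB R n)) (EFin \o f).
  exact/measurable_EFinP.
rewrite /Rint /Rintegral integralE [in RHS]integralE.
congr (fine (_ - _)).
- rewrite -(h _ (measurable_funepos mEf)) => [|z]; last exact: funepos_ge0.
  by apply: eq_integral => z _; rewrite !funeposE.
- rewrite -(h _ (measurable_funeneg mEf)) => [|z]; last exact: funeneg_ge0.
  by apply: eq_integral => z _; rewrite !funenegE.
Qed.

Lemma Rint_eball (x : R) : 0 < x ->
  Rint (\1_(eball x)) = x ^+ n * Rint (\1_(eball 1)).
Proof.
have E r : Rint (\1_(eball r)) = fine (lam (eball r)).
  by rewrite /Rint /Rintegral integral_indic ?setIT//; exact: measurable_eball.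
move=> x0; rewrite !E leb_eballE// fineM//.
by rewrite ge0_fin_numE ?leb_eball_lty//; exact: measure_ge0.
Qed.

Lemma Rint_eball_ge0 (x : R) : 0 <= Rint (\1_(eball x)).
Proof. by apply: Rintegral_ge0. Qed.

Lemma integ_eball (x : R) : integ (\1_(eball x)).
Proof.
apply: eq_integrable (integ_supp (f := cst 1) (r := x) (C := 1) (@measurable_eball R k x) _ _ _) => //.
- by move=> z _ /=; rewrite mulr1.
- by move=> z _; rewrite normr1.
Qed.

Hypothesis V0 : (0 < lam (eball 1))%E.

Lemma Rint_star (rho f : 'rV[R]_n -> R) (C : R) :
  meas rho -> (forall z, 0 < rho (hat z) <= 2) -> meas f ->
  (forall z, `|f (hat z)| <= C) ->
  Rint (fun z => \1_(star rho) z * f (hat z)) =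
  Rint (fun z => \1_(eball 1) z * (f (hat z) * rho (hat z) ^+ n)).
Proof.
move=> mrho rho2 mf fC.
have star2 : star rho `<=` eball 2.
  by move=> z zs; apply: le_trans zs _; case/andP: (rho2 z).
have C0 : 0 <= C by exact: le_trans (fC 0).
have pos g : meas g -> (forall z, 0 <= g z) ->
    Rint (fun z => \1_(star rho) z * g (hat z)) =
    Rint (fun z => \1_(eball 1) z * (g (hat z) * rho (hat z) ^+ n)).
  move=> mg g0; rewrite /Rint /Rintegral -!integral_indicl.
  by rewrite ge0_integral_star.
(* [f] is bounded only at the vectors [hat z], while [pos] wants a function that is nonnegative
   everywhere. Clamping to [[-C, C]] changes no value at [hat z], and adding [C] then gives the
   sign. *)
pose g z := Num.max (- C) (Num.min C (f z)).
have mg : meas g by apply: measurable_maxr => //; exact: measurable_minr.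
have gC z : - C <= g z <= C.
  by rewrite le_max lexx/= ge_max ge_min lexx (le_trans _ C0)// oppr_le0.
have gf z : g (hat z) = f (hat z).
  have := fC z; rewrite ler_norml => /andP[h1 h2].
  by rewrite /g min_r// max_r.
have iS (h : 'rV[R]_n -> R) : meas h -> (forall z, `|h z| <= C + C) ->
    integ (fun z => \1_(star rho) z * h (hat z)).
  move=> mh hC; apply: (integ_supp (r := 2) (C := C + C)) => //.
  - exact: measurable_star.
  - exact: measurable_comp_hat.
have iB (h : 'rV[R]_n -> R) : meas h -> (forall z, `|h z| <= C + C) ->
    integ (fun z => \1_(eball 1) z * (h (hat z) * rho (hat z) ^+ n)).
  move=> mh hC; apply: (integ_supp (r := 1) (C := (C + C) * 2 ^+ n)) => //.
  - exact: measurable_eball.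
  - apply: (@measurable_comp_hat R k (fun z => h z * rho z ^+ n)).
    by apply: measurable_funM => //; exact: measurable_funX.
  - move=> z _; have /andP[r0 r2] := rho2 z.
    rewrite normrM normrX (gtr0_norm r0) ler_pM//; first by rewrite exprn_ge0// ltW.
    by rewrite ler_pXn2r// ?nnegrE ltW.
have gCC z : `|g z + C| <= C + C.
  have /andP[h1 h2] := gC z; rewrite ler_norml; apply/andP; split; lra.
have mgC : meas (fun z => g z + C) by exact: measurable_funD.
have cCC z : `|cst C z| <= C + C by rewrite /cst/= ger0_norm// lerDl.
have iSC : integ (fun z => \1_(star rho) z * C).
  apply: (iS (cst C)) => //; exact: measurable_cst.
have iBC : integ (fun z => \1_(eball 1) z * (C * rho (hat z) ^+ n)).
  apply: (iB (cst C)) => //; exact: measurable_cst.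
have -> : Rint (fun z => \1_(star rho) z * f (hat z)) =
    Rint (fun z => \1_(star rho) z * (g (hat z) + C)) -
    Rint (fun z => \1_(star rho) z * C).
  rewrite -RintB; [|exact: (iS _ mgC gCC)|exact: iSC].
  by apply: eq_Rint => z; rewrite gf -mulrBr addrK.
have -> : Rint (fun z => \1_(eball 1) z * (f (hat z) * rho (hat z) ^+ n)) =
    Rint (fun z => \1_(eball 1) z * ((g (hat z) + C) * rho (hat z) ^+ n)) -
    Rint (fun z => \1_(eball 1) z * (C * rho (hat z) ^+ n)).
  rewrite -RintB; [|exact: (iB _ mgC gCC)|exact: iBC].
  by apply: eq_Rint => z; rewrite gf -mulrBr mulrDl addrK.
congr (_ - _).
- by apply: (pos _ mgC) => z; have /andP[h1 h2] := gC z; lra.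
- exact: (pos (cst C)).
Qed.

End SignedIntegrals.

(** * Averages over a translated ball *)

(** Each step multiplies the remainder by [|1 + b| <= 2] and adds [n * b ^+ 2]. The constant
    [4 ^+ n] absorbs both because [n <= 4 ^+ n]. *)
Lemma exprD1_taylor (R : realType) n (b : R) : `|b| <= 1 ->
  `|(1 + b) ^+ n - 1 - n%:R * b| <= 4 ^+ n * b ^+ 2.
Proof.
move=> b1; elim: n => [|n IH]; first by rewrite !expr0 subrr mul0r subrr normr0 mul1r sqr_ge0.
have -> : (1 + b) ^+ n.+1 - 1 - n.+1%:R * b =
    (1 + b) * ((1 + b) ^+ n - 1 - n%:R * b) + n%:R * b ^+ 2.
  by rewrite exprS -natr1; ring.
have n4 : (n%:R : R) <= 4 ^+ n by rewrite -natrX ler_nat ltnW// ltn_expl.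
apply: le_trans (ler_normD _ _) _; rewrite normrM [X in _ + X]normrM.
rewrite (ger0_norm (ler0n _ n)) (ger0_norm (sqr_ge0 b)) (exprS 4 n).
have b2 : `|1 + b| <= 2 by apply: le_trans (ler_normD _ _) _; rewrite normr1; lra.
have h1 : `|1 + b| * `|(1 + b) ^+ n - 1 - n%:R * b| <= 2 * (4 ^+ n * b ^+ 2).
  by apply: ler_pM.
have h2 : n%:R * b ^+ 2 <= 4 ^+ n * b ^+ 2 by rewrite ler_wpM2r ?sqr_ge0.
have h3 : 0 <= 4 ^+ n * b ^+ 2 by rewrite mulr_ge0 ?sqr_ge0// exprn_ge0.
rewrite -[leRHS]mulrA; move: h1 h2 h3; move: (4 ^+ n * b ^+ 2) => q; lra.
Qed.

Section Shift.
Context {R : realType}.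
Variable k : nat.
Local Notation n := k.+1.
Local Notation lam := (@leb R n).
Local Notation hat := (@hat R k).
Local Notation eball := (@eball R k).
Local Notation Rint := (@Rint R k).
Local Notation meas f := (measurable_fun (setT : set (rvB R n)) f).
Local Notation integ f := (lam.-integrable setT (EFin \o f)).
Implicit Types (f g H : 'rV[R]_n -> R).

Hypothesis V0 : (0 < lam (eball 1))%E.

Lemma lipschitz_dot (d : 'rV[R]_n) : e_lipschitzR (enorm d) (fun s => dot s d).
Proof.
move=> x x'; rewrite -dotNl -dotDl mulrC; exact: dot_le_enorm.
Qed.

Lemma measurable_dotr (d : 'rV[R]_n) : meas (fun s : 'rV[R]_n => dot s d).
Proof.
exact: (continuous_measurable_rv (lipschitz_continuous (@lipschitz_dot d))).
Qed.

Section fixed_shift.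
Variable d : 'rV[R]_n.
Hypothesis d2 : enorm d <= 2^-1.
Let del := enorm d.

(* The translated ball is star-shaped: in the direction [s] its boundary lies
   at distance [radius s] from the origin. *)
Definition radius (s : 'rV[R]_n) : R :=
  dot s d + Num.sqrt (1 - del ^+ 2 + dot s d ^+ 2).

Let q s := 1 - del ^+ 2 + dot s d ^+ 2.

Lemma measurable_radius : meas radius.
Proof.
apply: measurable_funD; first exact: measurable_dotr.
have mq : meas q.
  by apply: measurable_funD => //; apply: measurable_funX; exact: measurable_dotr.
have := measurableT_comp (continuous_measurable_fun (@sqrt_continuous R)) mq.
by [].
Qed.

Let del0 : 0 <= del. Proof. exact: enorm_ge0. Qed.

Let dot_hat z : `|dot (hat z) d| <= del.
Proof.
apply: le_trans (dot_le_enorm _ _) _; rewrite -[leRHS]mul1r.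
by rewrite ler_wpM2r ?enorm_ge0// enorm_hat_le1.
Qed.

Let del_sq : del ^+ 2 <= 4^-1.
Proof.
have -> : (4^-1 : R) = 2^-1 ^+ 2 by field.
by rewrite ler_pXn2r// nnegrE.
Qed.

Let dot_sq z : dot (hat z) d ^+ 2 <= del ^+ 2.
Proof.
rewrite -[dot _ _ ^+ 2]real_normK ?num_real// ler_pXn2r ?nnegrE//; exact: dot_hat.
Qed.

(** [q] lies between [1 - del ^+ 2] and 1, and the square root of a number in [[0, 1]] is at least
    that number. Hence the root differs from 1 only at second order. *)
Let sqrt_q z : 1 - del ^+ 2 <= Num.sqrt (q (hat z)) <= 1.
Proof.
have := dot_sq z; have := sqr_ge0 (dot (hat z) d); have := del_sq; have := sqr_ge0 del.
set a2 := _ ^+ 2; set e2 := _ ^+ 2 => h1 h2 h3 h4.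
have q0 : 0 <= q (hat z) by rewrite /q -/a2 -/e2; lra.
have q1 : q (hat z) <= 1 by rewrite /q -/a2 -/e2; lra.
have s1 : Num.sqrt (q (hat z)) <= 1.
  by rewrite -(sqrtr1 R) ler_sqrt.
rewrite s1 andbT; apply: (@le_trans _ _ (q (hat z))); first by rewrite /q -/a2 -/e2; lra.
rewrite -[leLHS](sqr_sqrtr q0) expr2 -[leRHS]mulr1.
by rewrite ler_wpM2l// sqrtr_ge0.
Qed.

Lemma radius_hat_taylor z : `|radius (hat z) - 1 - dot (hat z) d| <= del ^+ 2.
Proof.
have /andP[h1 h2] := sqrt_q z; rewrite /radius -/(q (hat z)).
have := sqr_ge0 del => h3.
by rewrite ler_norml; apply/andP; split; lra.
Qed.

(** The bound 1/2 on [|d|] keeps the origin well inside the translated ball: the radius departs from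
    1 by at most 1/2 + 1/4. *)
Lemma radius_hat_bound z : 0 < radius (hat z) <= 2.
Proof.
have := radius_hat_taylor z; have := dot_hat z; have := del_sq; have := d2.
rewrite !ler_norml -/del => h1 h2 /andP[h3 h4] /andP[h5 h6].
by apply/andP; split; lra.
Qed.

(** With [r = |z|] and [a = <hat z, d>], [|z - d|^2 = (r - a)^2 + del^2 - a^2], so lying in the ball
    means [|r - a| <= sqrt q]. The lower half of this is automatic, since [r >= 0] and
    [a <= sqrt q]. *)
Lemma shifted_ballE z : (z - d \in eball 1) = (z \in star radius).
Proof.
set r := enorm z; set a := dot (hat z) d.
have E : enorm (z - d) ^+ 2 = (r - a) ^+ 2 + del ^+ 2 - a ^+ 2.
  have zd : dot z d = r * a by rewrite {1}(hatE z) dotZl.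
  rewrite enorm_sq dotDl !dotDr !dotNl !dotNr (dotC d z) zd opprK -!enorm_sq.
  by rewrite -/r -/del; ring.
have q0 : 0 <= q (hat z).
  by rewrite /q; have := del_sq; have := sqr_ge0 (dot (hat z) d); lra.
have -> : (z \in star radius) = (r - a <= Num.sqrt (q (hat z))).
  by apply/idP/idP; rewrite inE /star/= /radius lerBlDl.
have r0 : 0 <= r by exact: enorm_ge0.
rewrite in_eball -(@ler_pXn2r _ 2) ?nnegrE ?enorm_ge0// E expr1n.
have -> : ((r - a) ^+ 2 + del ^+ 2 - a ^+ 2 <= 1) = ((r - a) ^+ 2 <= q (hat z)).
  by rewrite /q -/a; apply/idP/idP => ?; lra.
apply/idP/idP => h.
  rewrite (le_trans (ler_norm _))// -sqrtr_sqr ler_sqrt//.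
have a_le : `|a| <= Num.sqrt (q (hat z)).
  rewrite -sqrtr_sqr ler_sqrt// /q -/a; have := del_sq; lra.
rewrite -[leRHS](sqr_sqrtr q0) -[leLHS]real_normK ?num_real//.
rewrite ler_pXn2r ?nnegrE ?sqrtr_ge0// ler_norml h andbT.
by have := ler_norm a; lra.
Qed.

Local Notation v := (Rint (\1_(eball 1))).

Lemma indic01 (A : set 'rV[R]_n) z : 0 <= (\1_A z : R) <= 1.
Proof. by rewrite indicE; case: (_ \in _); rewrite ?ler01 ?lexx. Qed.

Lemma shift_ball_star H : meas H ->
  Rint (fun u => \1_(eball 1) u * H (u + d)) =
  Rint (fun z => \1_(star radius) z * H z).
Proof.
move=> mH.
have mf : meas (fun u => \1_(eball 1) u * H (u + d)).
  apply: measurable_indicM; first exact: measurable_eball.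
  have := measurableT_comp mH (@measurable_rv_affine R n 1 d).
  by congr measurable_fun; apply/funext => u /=; rewrite scale1r.
rewrite -(@Rint_affine R k 1 (- d) _ (normr1 _) mf); apply: eq_Rint => z.
by rewrite scale1r subrK !indicE shifted_ballE.
Qed.

Lemma star_symdiff z :
  `|\1_(star radius) z - \1_(eball 1) z| <=
  \1_(eball (1 + del)) z - \1_(eball (1 - del)) z :> R.
Proof.
rewrite !indicE !in_eball -shifted_ballE in_eball.
have t1 := ler_enormD (z - d) d; rewrite subrK -/del in t1.
have t2 := ler_enormB z d; rewrite -/del in t2.
have d0 := del0.
have [h1|h1] := leP (enorm (z - d)) 1; have [h2|h2] := leP (enorm z) 1;
  have [h3|h3] := leP (enorm z) (1 + del); have [h4|h4] := leP (enorm z) (1 - del);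
  rewrite ?subr0 ?subrr ?sub0r ?normr0 ?normrN ?normr1 ?ler01 ?lexx//; exfalso; lra.
Qed.

(** [exprD1_taylor] at [del] and [- del]: the linear terms add up to [2 * n * del], and each
    remainder is at most [4 ^+ n * del]. *)
Lemma shell_bound :
  Rint (fun z => \1_(eball (1 + del)) z - \1_(eball (1 - del)) z) <=
  (2 * n%:R + 2 * 4 ^+ n) * del * v.
Proof.
have d0 := del0; have h2 := d2.
rewrite RintB; [|exact: integ_eball|exact: integ_eball].
rewrite Rint_eball; last by rewrite ltr_wpDr.
rewrite (@Rint_eball R k (1 - del)); last by move: h2; rewrite -/del; lra.
rewrite -mulrBl ler_wpM2r ?Rint_eball_ge0//.
have d1 : `|del| <= 1 by rewrite ger0_norm//; move: h2; rewrite -/del; lra.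
have := exprD1_taylor n d1.
have := @exprD1_taylor R n (- del); rewrite normrN => /(_ d1).
rewrite !ler_norml sqrrN => /andP[a1 a2] /andP[b1 b2].
have e1 : 4 ^+ n * del ^+ 2 <= 4 ^+ n * del :> R.
  rewrite ler_wpM2l ?exprn_ge0// expr2 -[leRHS]mulr1 ler_wpM2l//.
  by rewrite -(ger0_norm d0).
rewrite mulrDl -!mulrA; move: a1 a2 b1 b2 e1; rewrite mulrN.
move: ((1 + del) ^+ n) ((1 - del) ^+ n) (n%:R * del) (4 ^+ n * del ^+ 2) (4 ^+ n * del).
by move=> p1 p2 p3 p4 p5 *; lra.
Qed.

(** With [b = radius - 1] and [a = <hat z, d>], [|b - a| <= del^2] gives [|b| <= 2 del]. The term
    [4 * 4 ^+ n] comes from [b^2 <= 4 del^2] in the power expansion, the term [n] from replacing [b]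
    by [a]. *)
Lemma radius_pow_taylor z :
  `|radius (hat z) ^+ n - 1 - n%:R * dot (hat z) d| <= (4 * 4 ^+ n + n%:R) * del ^+ 2.
Proof.
have h1 := radius_hat_taylor z; have h2 := dot_hat z; have h3 := d2; have h4 := del0.
set a := dot (hat z) d in h1 h2 *; pose b := radius (hat z) - 1.
have dd : del ^+ 2 <= del by rewrite expr2 -[leRHS]mulr1 ler_wpM2l//; move: h3; rewrite -/del; lra.
have b2 : `|b| <= 2 * del.
  have -> : b = (radius (hat z) - 1 - a) + a by rewrite subrK.
  apply: le_trans (ler_normD _ _) _; move: h1 h2 dd; lra.
have b1 : `|b| <= 1 by move: b2 h3; rewrite -/del; lra.
have := exprD1_taylor n b1.
have -> : 1 + b = radius (hat z) by rewrite addrC subrK.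
have -> : radius (hat z) ^+ n - 1 - n%:R * a =
  (radius (hat z) ^+ n - 1 - n%:R * b) + n%:R * (radius (hat z) - 1 - a).
  by rewrite /b; ring.
move=> h5; apply: le_trans (ler_normD _ _) _.
have h6 : 4 ^+ n * b ^+ 2 <= 4 ^+ n * (4 * del ^+ 2).
  rewrite ler_wpM2l ?exprn_ge0//.
  have -> : 4 * del ^+ 2 = (2 * del) ^+ 2 by ring.
  by rewrite -[leLHS]real_normK ?num_real// ler_pXn2r ?nnegrE// mulr_ge0.
have h7 : `|n%:R * (radius (hat z) - 1 - a)| <= n%:R * del ^+ 2.
  by rewrite normrM normr_nat ler_wpM2l.
rewrite mulrDl (mulrC 4) -mulrA; lra.
Qed.

Section fixed_function.
Variables (H : 'rV[R]_n -> R) (K : R).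
Hypotheses (K0 : 0 <= K) (HK : e_lipschitzR K H) (H0 : H 0 = 0).

Let mH : meas H. Proof. exact: continuous_measurable_rv (lipschitz_continuous HK). Qed.

Let H_le z : `|H z| <= K * enorm z.
Proof. by have := HK z 0; rewrite H0 !subr0. Qed.

Let Hhat_le z : `|H (hat z)| <= K.
Proof.
apply: le_trans (H_le _) _; rewrite -[leRHS]mulr1 ler_wpM2l//; exact: enorm_hat_le1.
Qed.

Let star2 : star radius `<=` eball 2.
Proof.
move=> z zs; apply: le_trans zs _; by case/andP: (radius_hat_bound z).
Qed.

Let mphi : meas (fun z => H (hat z)).
Proof. exact: measurable_comp_hat. Qed.

Let mstar : measurable (star radius : set (rvB R n)).
Proof. exact: measurable_star measurable_radius. Qed.

Let H_le_on (A : set 'rV[R]_n) : A `<=` eball 2 -> forall z, A z -> `|H z| <= K * 2.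
Proof. by move=> A2 z /A2 z2; rewrite (le_trans (H_le z))// ler_wpM2l. Qed.

Let ball2 : eball 1 `<=` eball 2.
Proof. by move=> z z1; apply: le_trans z1 _; lra. Qed.

Let iH A : measurable (A : set (rvB R n)) -> A `<=` eball 2 ->
  integ (fun z => \1_A z * H z).
Proof. by move=> mA A2; apply: (integ_supp mA A2 mH); exact: H_le_on. Qed.

Let iphi A : measurable (A : set (rvB R n)) -> A `<=` eball 2 ->
  integ (fun z => \1_A z * H (hat z)).
Proof. by move=> mA A2; apply: (integ_supp mA A2 mphi) => z _; exact: Hhat_le. Qed.

(** Replacing [H z] by [H (hat z)] matters only on the symmetric difference of ball and translate.
    It lies in a shell of volume O([del]) on which [|z - hat z| <= del], so the Lipschitz bound
    yields a second factor [del]. *)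
Lemma shift_radial_error :
  `|(Rint (fun z => \1_(star radius) z * H z) - Rint (fun z => \1_(eball 1) z * H z)) -
    (Rint (fun z => \1_(star radius) z * H (hat z)) -
     Rint (fun z => \1_(eball 1) z * H (hat z)))| <=
  (2 * n%:R + 2 * 4 ^+ n) * K * del ^+ 2 * v.
Proof.
have mB := @measurable_eball R k 1.
have i1 := iH mstar star2; have i2 := iH mB ball2.
have i3 := iphi mstar star2; have i4 := iphi mB ball2.
pose S z : R := \1_(eball (1 + del)) z - \1_(eball (1 - del)) z.
have iS : integ S by apply: integB => //; exact: integ_eball.
rewrite -!RintB//; try exact: integB.
apply: (@le_trans _ _ (Rint (fun z => (K * del) * S z))).
  apply: le_norm_Rint.
  - by apply: integB => //; apply: integB.
  - exact: integZ.
  move=> z.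
  have -> : \1_(star radius) z * H z - \1_(eball 1) z * H z -
     (\1_(star radius) z * H (hat z) - \1_(eball 1) z * H (hat z)) =
     (\1_(star radius) z - \1_(eball 1) z) * (H z - H (hat z)) :> R by ring.
  rewrite normrM mulrC; have := star_symdiff z; rewrite -/(S z) => hS.
  have [S0|S1] : S z = 0 \/ (S z = 1 /\ `|enorm z - 1| <= del).
    rewrite /S !indicE !in_eball.
    have [h1|h1] := leP (enorm z) (1 + del); have [h2|h2] := leP (enorm z) (1 - del).
    - by left; rewrite subrr.
    - by right; rewrite subr0; split => //; rewrite ler_norml; apply/andP; split; lra.
    - by exfalso; have := del0; lra.
    - by left; rewrite subrr.
  - by move: hS; rewrite S0 normr_le0 => /eqP ->; rewrite normr0 !mulr0.
  - rewrite S1.1 mulr1 -[leRHS]mulr1; apply: ler_pM => //; last by move: hS; rewrite S1.1.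
    apply: le_trans (HK _ _) _; rewrite ler_wpM2l//.
    have -> : z - hat z = (enorm z - 1) *: hat z by rewrite scalerBl scale1r -hatE.
    rewrite enormZ; apply: le_trans S1.2; rewrite -[leRHS]mulr1 ler_wpM2l//.
    exact: enorm_hat_le1.
rewrite RintZ//; apply: le_trans (ler_wpM2l _ shell_bound) _; first by rewrite mulr_ge0.
by rewrite le_eqVlt; apply/orP; left; apply/eqP; ring.
Qed.

(** The remaining integrand depends on the direction only, so [Rint_star] turns the translate into
    the weight [radius ^+ n] on the unit ball, and this weight is expanded to first order. *)
Lemma shift_angular_error :
  `|Rint (fun z => \1_(star radius) z * H (hat z)) -
    Rint (fun z => \1_(eball 1) z * H (hat z)) -
    n%:R * Rint (fun z => \1_(eball 1) z * (H (hat z) * dot (hat z) d))| <=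
  (4 * 4 ^+ n + n%:R) * K * del ^+ 2 * v.
Proof.
have mB := @measurable_eball R k 1.
have i4 := iphi mB ball2.
rewrite (Rint_star V0 measurable_radius radius_hat_bound mH Hhat_le).
have i5 : integ (fun z => \1_(eball 1) z * (H (hat z) * dot (hat z) d)).
  apply: (integ_supp (r := 1) (C := K * del)) => //.
    apply: measurable_funM => //; exact: (measurable_comp_hat (measurable_dotr d)).
  by move=> z _; rewrite normrM ler_pM.
have i6 : integ (fun z => \1_(eball 1) z * (H (hat z) * radius (hat z) ^+ n)).
  apply: (integ_supp (r := 1) (C := K * 2 ^+ n)) => //.
    apply: measurable_funM => //; apply: measurable_funX.
    exact: (measurable_comp_hat measurable_radius).
  move=> z _; have /andP[r0 r2] := radius_hat_bound z.
  by rewrite normrM normrX (gtr0_norm r0) ler_pM// ?exprn_ge0 ?ler_pXn2r ?nnegrE// ltW.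
rewrite -RintZ// -!RintB//; try exact: integB; try exact: integZ.
pose c := (4 * 4 ^+ n + n%:R) * K * del ^+ 2.
rewrite -/c -RintZ; last exact: integ_eball.
apply: le_norm_Rint.
- by apply: integB => //; [exact: integB|exact: integZ].
- by apply: integZ => //; exact: integ_eball.
move=> z.
have -> : \1_(eball 1) z * (H (hat z) * radius (hat z) ^+ n) -
    \1_(eball 1) z * H (hat z) -
    n%:R * (\1_(eball 1) z * (H (hat z) * dot (hat z) d)) =
    \1_(eball 1) z * (H (hat z) * (radius (hat z) ^+ n - 1 - n%:R * dot (hat z) d)) :> R.
  by ring.
have /andP[e0 e1] := indic01 (eball 1) z.
rewrite normrM (ger0_norm e0) mulrC ler_wpM2r// normrM /c (mulrC _ K) -mulrA.
by rewrite ler_pM//; exact: radius_pow_taylor.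
Qed.

(** Averaging with the reflection [z -> - z] changes the sign of [dot (hat z) d], so one evaluation
    per direction becomes the symmetric difference of the method. *)
Lemma sphere_reflect :
  n%:R * Rint (fun z => \1_(eball 1) z * (H (hat z) * dot (hat z) d)) =
  n%:R / 2 * Rint (fun z => \1_(eball 1) z * ((H (hat z) - H (- hat z)) * dot (hat z) d)).
Proof.
have mB := @measurable_eball R k 1.
pose g z := \1_(eball 1) z * (H (hat z) * dot (hat z) d).
have mdot : meas (fun z => dot (hat z) d).
  by exact: (measurable_comp_hat (measurable_dotr d)).
have ig : integ g.
  apply: (integ_supp (r := 1) (C := K * del)) => //; first exact: measurable_funM.
  by move=> z _; rewrite normrM ler_pM.
have mg : meas g by apply: measurable_indicM => //; exact: measurable_funM.
have gN : (fun z => g (- 1 *: z + 0)) =1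
    (fun z => - 1 * (\1_(eball 1) z * (H (- hat z) * dot (hat z) d))).
  move=> z; rewrite /g addr0 scaleN1r hatN dotNl !indicE !in_eball enormN; ring.
have igN : integ (fun z => \1_(eball 1) z * (H (- hat z) * dot (hat z) d)).
  apply: (integ_supp (r := 1) (C := K * del)) => //.
    apply: measurable_funM => //.
    have := measurableT_comp mphi (@measurable_rv_affine R n (-1) 0).
    by congr measurable_fun; apply/funext => z /=; rewrite addr0 scaleN1r hatN.
  by move=> z _; rewrite normrM -hatN ler_pM.
have h : Rint (fun z => g (- 1 *: z + 0)) = Rint g.
  by apply: Rint_affine => //; rewrite normrN1.
rewrite (eq_Rint gN) RintZ// in h.
have -> : Rint (fun z => \1_(eball 1) z * ((H (hat z) - H (- hat z)) * dot (hat z) d)) =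
    Rint g - Rint (fun z => \1_(eball 1) z * (H (- hat z) * dot (hat z) d)).
  by rewrite -RintB//; apply: eq_Rint => z; rewrite /g; ring.
rewrite -/g; move: h; move: (Rint _) (Rint g) => p1 p2 <-.
by field.
Qed.

End fixed_function.

(** Subtracting the constant [H 0] changes neither difference and gives the normalisation required
    above. The constant is the sum of those of the radial and the angular error. *)
Lemma shift_ball H K : 0 <= K -> e_lipschitzR K H ->
  `|Rint (fun u => \1_(eball 1) u * H (u + d)) - Rint (fun u => \1_(eball 1) u * H u) -
    n%:R / 2 * Rint (fun z => \1_(eball 1) z * ((H (hat z) - H (- hat z)) * dot (hat z) d))|
  <= (3 * n%:R + 6 * 4 ^+ n) * K * del ^+ 2 * v.
Proof.
move=> K0 HK; pose H' z := H z - H 0.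
have HK' : e_lipschitzR K H' by move=> x x'; rewrite /H' opprB addrA subrK; exact: HK.
have H'0 : H' 0 = 0 by rewrite /H' subrr.
have mH : meas H by exact: continuous_measurable_rv (lipschitz_continuous HK).
have mH' : meas H' by exact: continuous_measurable_rv (lipschitz_continuous HK').
have H_le z b : enorm z <= b -> `|H z| <= `|H 0| + K * b.
  move=> zb; have -> : H z = H 0 + (H z - H 0) by rewrite addrC subrK.
  apply: le_trans (ler_normD _ _) _; rewrite lerD2l (le_trans (HK _ _))// subr0.
  by rewrite ler_wpM2l.
have mB := @measurable_eball R k 1.
have i1 : integ (fun u => \1_(eball 1) u * H u).
  by apply: (integ_supp (r := 1) (C := `|H 0| + K * 1)) => // z; exact: H_le.
have i2 : integ (fun u => \1_(eball 1) u * H (u + d)).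
  apply: (integ_supp (r := 1) (C := `|H 0| + K * 2)) => //.
    have := measurableT_comp mH (@measurable_rv_affine R n 1 d).
    by congr measurable_fun; apply/funext => u /=; rewrite scale1r.
  move=> z z1; apply: H_le; apply: le_trans (ler_enormD _ _) _.
  by have := d2; rewrite /eball/= in z1 *; lra.
have -> : Rint (fun u => \1_(eball 1) u * H (u + d)) - Rint (fun u => \1_(eball 1) u * H u)
   = Rint (fun z => \1_(star radius) z * H' z) - Rint (fun u => \1_(eball 1) u * H' u).
  have i3 : integ (fun u : 'rV[R]_n => H 0 * \1_(eball 1) u).
    by apply: integZ => //; exact: integ_eball.
  rewrite -(shift_ball_star mH').
  have -> : Rint (fun u => \1_(eball 1) u * H' (u + d)) =
     Rint (fun u => \1_(eball 1) u * H (u + d)) - Rint (fun u => H 0 * \1_(eball 1) u).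
    by rewrite -RintB//; apply: eq_Rint => z; rewrite /H'; ring.
  have -> : Rint (fun u => \1_(eball 1) u * H' u) =
     Rint (fun u => \1_(eball 1) u * H u) - Rint (fun u => H 0 * \1_(eball 1) u).
    by rewrite -RintB//; apply: eq_Rint => z; rewrite /H'; ring.
  by ring.
have -> : Rint (fun z => \1_(eball 1) z * ((H (hat z) - H (- hat z)) * dot (hat z) d)) =
   Rint (fun z => \1_(eball 1) z * ((H' (hat z) - H' (- hat z)) * dot (hat z) d)).
  by apply: eq_Rint => z; rewrite /H'; ring.
rewrite -(sphere_reflect K0 HK' H'0).
have := shift_radial_error K0 HK' H'0; have := shift_angular_error K0 HK' H'0.
move: (Rint (fun z => \1_(star radius) z * H' z)) => p1.
move: (Rint (fun z => \1_(eball 1) z * H' z)) => p2.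
move: (Rint (fun z => \1_(star radius) z * H' (hat z))) => p3.
move: (Rint (fun z => \1_(eball 1) z * H' (hat z))) => p4.
move: (n%:R * Rint _) => p5.
have -> : p1 - p2 - p5 = (p1 - p2 - (p3 - p4)) + (p3 - p4 - p5) by ring.
move=> e1 e2; apply: le_trans (ler_normD _ _) _; apply: le_trans (lerD e2 e1) _.
by rewrite le_eqVlt; apply/orP; left; apply/eqP; ring.
Qed.

End fixed_shift.
End Shift.

(** * Taylor estimates and gradients *)

Section Taylor.
Context {R : realType} {n : nat}.
Implicit Types (f : 'rV[R]_n -> R) (x a d : 'rV[R]_n).

Lemma dot_is_linear a : linear (dot a : 'rV[R]_n -> R).
Proof. by move=> c u w; rewrite dotDr dotZr. Qed.

HB.instance Definition _ a :=
  GRing.isLinear.Build R 'rV[R]_n R _ (dot a) (dot_is_linear a).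

Lemma continuous_dot a : continuous (dot a : 'rV[R]_n -> R).
Proof.
apply: (@lipschitz_continuous _ _ (enorm a)) => x x'.
by rewrite -dotNr -dotDr; exact: dot_le_enorm.
Qed.

(** A quadratic remainder makes [dot a] the differential, by uniqueness. The factor [n ^+ 2] passes
    from the Euclidean norm to the maximum norm. *)
Lemma grad_quad f x a (C : R) :
  (forall d, `|f (x + d) - f x - dot a d| <= C * enorm d ^+ 2) -> grad f x = a.
Proof.
move=> hC.
have C0 : 0 <= `|C| by [].
have -> : grad f x = \row_j dot a (delta_mx 0 j).
  apply/rowP => j; rewrite !mxE.
  suff -> : 'd f x = dot a :> ('rV[R]_n -> R) by [].
  apply: diff_unique; first exact: continuous_dot.
  apply/eqaddoP => e e0.
  have K0 : 0 < `|C| * n%:R ^+ 2 + 1 by rewrite ltr_wpDl// mulr_ge0// sqr_ge0.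
  apply/nbhs_ballP; exists ((`|C| * n%:R ^+ 2 + 1)^-1 * e) => /=.
    by rewrite mulr_gt0 ?invr_gt0.
  move=> z; rewrite -ball_normE /= sub0r normrN => zd.
  rewrite !fctE/= opprD addrA (addrC z).
  apply: (le_trans (hC z)).
  apply: (@le_trans _ _ (`|C| * (n%:R * `|z|) ^+ 2)).
    apply: (@le_trans _ _ (`|C| * enorm z ^+ 2)).
      by rewrite ler_wpM2r ?sqr_ge0// ler_norm.
    rewrite ler_wpM2l// ler_pXn2r ?nnegrE ?enorm_ge0 ?mulr_ge0//.
    exact: enorm_le_norm.
  have -> : `|C| * (n%:R * `|z|) ^+ 2 = (`|C| * n%:R ^+ 2) * `|z| * `|z| by ring.
  rewrite ler_wpM2r//; move: zd; rewrite ltr_pdivlMl// => /ltW.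
  by apply: le_trans; rewrite ler_wpM2r// lerDl.
by apply/rowP => j; rewrite mxE dot_delta.
Qed.

(** The mean value theorem along the segment gives [L] in place of the sharp [L / 2]; only the order
    of the remainder matters here. *)
Lemma smooth_quad f L : e_smooth L f -> 0 <= L ->
  forall x d, `|f (x + d) - f x - dot (grad f x) d| <= L * enorm d ^+ 2.
Proof.
move=> [df Lf] L0 x d.
have dE z w : 'd f z w = dot (grad f z) w.
  rewrite {1}(row_sum_delta w) linear_sum/= /dot; apply: eq_bigr => j _.
  by rewrite linearZ/= mxE mulrC.
pose phi t := f (x + t *: d).
have dphi (t : R) : is_derive t (1 : R) phi (dot (grad f (x + t *: d)) d).
  have E : (fun h : R => h^-1 *: (phi (h *: 1 + t) - phi t)) =
     (fun h : R => h^-1 *: (f (h *: d + (x + t *: d)) - f (x + t *: d))).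
    apply/funext => h; rewrite /phi; congr (_ *: (f _ - _)).
    by rewrite scalerDl [h *: 1]mulr1 addrCA.
  have hd := @diff_derivable _ _ _ f (x + t *: d) d (df _).
  apply: DeriveDef; first by rewrite /derivable E.
  by rewrite -dE -deriveE// /derive E.
have [|c c01 hc] := @MVT R phi (fun t => dot (grad f (x + t *: d)) d) 0 1 ltr01.
  apply: continuous_subspaceT => t.
  apply/differentiable_continuous/derivable1_diffP; exact: ex_derive.
have -> : f (x + d) - f x = dot (grad f (x + c *: d)) d.
  by move: hc; rewrite /phi scale1r scale0r addr0 subr0 mulr1.
rewrite -dotNl -dotDl; apply: le_trans (dot_le_enorm _ _) _.
rewrite expr2 mulrA ler_wpM2r ?enorm_ge0//; apply: le_trans (Lf _ _) _.
rewrite ler_wpM2l// addrC addKr enormZ.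
move: c01; rewrite in_itv/= => /andP[c0 c1].
by rewrite gtr0_norm// -[leRHS]mul1r ler_wpM2r ?enorm_ge0// ltW.
Qed.

End Taylor.

(** * Ball and sphere averages *)

Lemma ge0_integral_mscale_push d1 d2 (T1 : measurableType d1) (T2 : measurableType d2)
    (R : realType) (m : {measure set T1 -> \bar R}) (f : T1 -> T2)
    (mf : measurable_fun setT f) (c : R) (c0 : 0 <= c) (g : T2 -> \bar R) :
  measurable_fun setT g -> (forall y, 0 <= g y)%E ->
  (\int[mscale (NngNum c0) (push m mf)]_y g y = c%:E * \int[m]_x g (f x))%E.
Proof.
by move=> mg g0; rewrite ge0_integral_mscale// ge0_integral_push.
Qed.

Section Smoothing.
Context {R : realType}.
Variable k : nat.
Local Notation n := k.+1.
Local Notation lam := (@leb R n).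
Local Notation hat := (@hat R k).
Local Notation eball := (@eball R k).
Local Notation Rint := (@Rint R k).
Local Notation meas f := (measurable_fun (setT : set (rvB R n)) f).
Local Notation integ f := (lam.-integrable setT (EFin \o f)).
Local Notation v := (Rint (\1_(eball 1))).
Implicit Types (f g F : 'rV[R]_n -> R).

Lemma enorm_le_sum (a : 'rV[R]_n) : enorm a <= \sum_(j < n) `|a 0 j|.
Proof.
rewrite {1}(row_sum_delta a); apply: le_trans (enorm_sum _) _.
by apply: ler_sum => j _; rewrite enormZ enorm_delta mulr1.
Qed.

Lemma Rint_ballE : v = fine (lam (eball 1)).
Proof. by rewrite /Rint /Rintegral integral_indic ?setIT//; exact: measurable_eball. Qed.

Lemma iter_int_ball g C : meas g -> (forall z, eball 1 z -> `|g z| <= C) ->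
  iter_int (fun u => \1_(@unit_ball R n) u * g u) = Rint (fun u => \1_(eball 1) u * g u).
Proof.
move=> mg gC; pose M := Num.max C 1.
apply: (@iter_intE R n _ M).
- by apply: measurable_indicM => //; exact: measurable_eball.
- move=> x; rewrite indicE; have [/set_mem xB|_] := boolP (x \in _).
    by rewrite mul1r le_max gC.
  by rewrite mul0r normr0 le_max ler01 orbT.
- move=> x xM; rewrite indicE memNset ?mul0r// => xB; apply: xM => j.
  by rewrite le_max (eball_box xB) orbT.
Qed.

Lemma iter_int_ball1 : iter_int (\1_(@unit_ball R n)) = v.
Proof.
have <- : iter_int (fun u => \1_(@unit_ball R n) u * cst 1 u) = iter_int (\1_(@unit_ball R n)).
  by congr iter_int; apply/funext => u /=; rewrite mulr1.
rewrite (@iter_int_ball (cst 1) 1)//; last by move=> z _; rewrite normr1.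
by apply: eq_Rint => u /=; rewrite mulr1.
Qed.

Lemma ball_avgE g C : meas g -> (forall z, eball 1 z -> `|g z| <= C) ->
  ball_avg g = Rint (fun u => \1_(eball 1) u * g u) / v.
Proof. by move=> mg gC; rewrite /ball_avg (iter_int_ball mg gC) iter_int_ball1. Qed.

(** The average over the sphere as a ball integral of a function of the direction, matching the cone
    measure behind [unif_sphere]. *)
Definition sphere_avg f := Rint (fun z => \1_(eball 1) z * f (hat z)) / v.

(** The two integrands differ at most at the origin, where one is 0 and the other [\1_B 0]. *)
Lemma unif_sphereE (B : set 'rV[R]_n) : measurable (B : set (rvB R n)) ->
  unif_sphere B = sphere_avg (\1_B).
Proof.
move=> mB.
have mz : measurable ([set 0] : set (rvB R n)) by rewrite -eball0; exact: measurable_eball.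
have mBh : meas (fun z => \1_B (hat z) : R).
  by apply: (@measurable_comp_hat R k \1_B); exact: measurable_indic.
pose g (u : 'rV[R]_n) : R := if u == 0 then 0 else \1_B (hat u).
have gE u : g u = (1 - \1_[set 0] u) * \1_B (hat u).
  rewrite /g; have [->|/eqP u0] := eqVneq u 0.
    by rewrite [in RHS]indicE mem_set//= mulr1n subrr mul0r.
  by rewrite [X in 1 - X]indicE memNset//= mulr0n subr0 mul1r.
have mg : meas g.
  rewrite (_ : g = fun u => (1 - \1_[set 0] u) * \1_B (hat u)); last exact/funext.
  by apply: measurable_funM => //; apply: measurable_funB => //; exact: measurable_indic.
have g1 z : `|g z| <= 1.
  rewrite /g; case: ifP => _; rewrite ?normr0// indicE.
  by case: (_ \in _); rewrite ?normr0 ?normr1.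
rewrite /unif_sphere -/g (@ball_avgE g 1)// /sphere_avg; congr (_ / _).
rewrite /Rint /Rintegral; congr fine.
apply: ae_eq_integral => //.
- apply/measurable_EFinP; apply: measurable_indicM => //; exact: measurable_eball.
- apply/measurable_EFinP; apply: measurable_indicM => //; exact: measurable_eball.
exists [set 0]; split => //; first exact: leb0.
move=> z /= hz; apply: contrapT => /eqP z0; apply: hz => _.
by rewrite /g (negbTE z0).
Qed.

Lemma Rint_sum m (f : 'I_m -> 'rV[R]_n -> R) : (forall j, integ (f j)) ->
  integ (fun z => \sum_(j < m) f j z) /\
  Rint (fun z => \sum_(j < m) f j z) = \sum_(j < m) Rint (f j).
Proof.
elim: m f => [f _|m IH f hf].
  have -> : (fun z : 'rV[R]_n => \sum_(j < 0) f j z) = cst 0.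
    by apply/funext => z; rewrite big_ord0.
  rewrite big_ord0; split; first exact: integrable0.
  by rewrite /Rint /Rintegral integral0.
have [i1 e1] := IH (fun j => f (lift ord0 j)) (fun j => hf _).
have -> : (fun z => \sum_(j < m.+1) f j z) =
   (fun z => f ord0 z + \sum_(j < m) f (lift ord0 j) z).
  by apply/funext => z; rewrite big_ord_recl.
split; first exact: (integrableD measurableT (hf ord0) i1).
by rewrite RintD// e1 [RHS]big_ord_recl.
Qed.

Lemma integ_sphere f C : meas f -> (forall z, `|f (hat z)| <= C) ->
  integ (fun z => \1_(eball 1) z * f (hat z)).
Proof.
move=> mf fC; apply: (integ_supp (r := 1) (C := C)) => //.
  exact: measurable_eball.
exact: measurable_comp_hat.
Qed.

Hypothesis V0 : (0 < lam (eball 1))%E.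

Lemma ball_vol_gt0 : 0 < v.
Proof.
rewrite Rint_ballE; apply: fine_gt0; rewrite V0/=; exact: leb_eball_lty.
Qed.

Lemma sphere_avg_le f C : meas f -> (forall z, `|f (hat z)| <= C) ->
  `|sphere_avg f| <= C.
Proof.
move=> mf fC; have v0 := ball_vol_gt0.
rewrite /sphere_avg normrM normfV (gtr0_norm v0) ler_pdivrMr// -RintZ; last exact: integ_eball.
apply: le_norm_Rint; [exact: (integ_sphere mf fC)|exact: integZ (integ_eball _ _)|].
move=> z; have /andP[e0 e1] := indic01 (eball 1) z.
by rewrite normrM (ger0_norm e0) mulrC ler_wpM2r.
Qed.

Lemma sphere_avgB f g C : meas f -> meas g -> (forall z, `|f (hat z)| <= C) ->
  (forall z, `|g (hat z)| <= C) ->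
  sphere_avg (fun s => f s - g s) = sphere_avg f - sphere_avg g.
Proof.
move=> mf mg fC gC; rewrite /sphere_avg -mulrBl -RintB.
- by congr (_ / _); apply: eq_Rint => z; rewrite mulrBr.
- exact: (integ_sphere mf fC).
- exact: (integ_sphere mg gC).
Qed.

Lemma sphere_avg_dot f C (d : 'rV[R]_n) : meas f -> (forall z, `|f (hat z)| <= C) ->
  dot (\row_j sphere_avg (fun s => f s * s 0 j)) d = sphere_avg (fun s => f s * dot s d).
Proof.
move=> mf fC.
have C0 : 0 <= C by exact: le_trans (fC 0).
have ij (j : 'I_n) : integ (fun z => d 0 j * (\1_(eball 1) z * (f (hat z) * (hat z) 0 j))).
  apply: integZ; apply: (@integ_sphere (fun s => f s * s 0 j) C).
    by apply: measurable_funM => //; exact: measurable_coord.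
  move=> z; rewrite normrM -[leRHS]mulr1 ler_pM//.
  by apply: le_trans (coord_le_enorm _ _) _; exact: enorm_hat_le1.
have [_ e] := Rint_sum ij.
have -> : sphere_avg (fun s => f s * dot s d) =
    Rint (fun z => \sum_(j < n) d 0 j * (\1_(eball 1) z * (f (hat z) * (hat z) 0 j))) / v.
  rewrite /sphere_avg; congr (_ / _); apply: eq_Rint => z.
  by rewrite /dot mulr_sumr mulr_sumr; apply: eq_bigr => j _; ring.
rewrite e mulr_suml /dot; apply: eq_bigr => j _; rewrite mxE /sphere_avg.
rewrite RintZ; first by rewrite [RHS]mulrC mulrA [RHS]mulrC [X in X * _ = _]mulrC; ring.
apply: (@integ_sphere (fun s => f s * s 0 j) C).
  by apply: measurable_funM => //; exact: measurable_coord.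
move=> z; rewrite normrM -[leRHS]mulr1 ler_pM//.
by apply: le_trans (coord_le_enorm _ _) _; exact: enorm_hat_le1.
Qed.

(** [nu] is the image under [hat] of the normalised Lebesgue measure on the unit ball. Integrals
    transfer for nonnegative functions first, then through positive and negative parts. *)
Lemma sphere_measure (nu : {measure set (rvB R n) -> \bar R}) f C :
  (forall B, measurable (B : set (rvB R n)) -> nu B = (unif_sphere B)%:E) ->
  meas f -> (forall z, `|f (hat z)| <= C) ->
  Rintegral nu setT f = sphere_avg f.
Proof.
move=> hnu mf fC; have v0 := ball_vol_gt0.
have [c cE vV0] : exists2 c, c = v^-1 & 0 <= c.
  by exists v^-1 => //; rewrite invr_ge0 ltW.
have mB := @measurable_eball R k 1.
pose m1 := mfrestr mB (@leb_eball_lty R k 1).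
have m1hat B : measurable (B : set (rvB R n)) ->
    (c%:E * m1 (hat @^-1` B) = nu B)%E.
  move=> mB'; rewrite hnu// unif_sphereE// /sphere_avg -cE mulrC EFinM; congr (_ * _)%E.
  have mhB := measurable_hat_preimage mB'.
  rewrite /Rint /Rintegral fineK.
    rewrite -(@integral_indicl _ (rvB R n) _ lam (eball 1) (fun z => \1_B (hat z))).
    transitivity (\int[lam]_(z in eball 1) (\1_(hat @^-1` B) z : R)%:E)%E => //.
    by rewrite integral_indic.
  have mI : meas (\1_B : _ -> R) by exact: measurable_indic.
  have I1 z : `|\1_B (hat z) : R| <= 1.
    by rewrite indicE; case: (_ \in _); rewrite ?normr0 ?normr1.
  exact: (integrable_fin_num measurableT (integ_sphere mI I1)).
pose nu' := mscale (NngNum vV0) (push m1 (@measurable_hat R k)).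
have h (g : 'rV[R]_n -> \bar R) : measurable_fun (setT : set (rvB R n)) g ->
    (forall z, 0 <= g z)%E ->
    (\int[nu]_z g z = c%:E * \int[lam]_(z in eball 1) g (hat z))%E.
  move=> mg g0.
  have -> : (\int[nu]_z g z = \int[nu']_z g z)%E.
    by apply: eq_measure_integral => A mA _; rewrite -m1hat.
  have mgh : measurable_fun (setT : set (rvB R n)) (fun z => g (hat z)).
    exact: (measurableT_comp mg (@measurable_hat R k)).
  have e1 := ge0_integral_mscale_push m1 (@measurable_hat R k) vV0 mg g0.
  have e3 := ge0_integral_mfrestr mB (@leb_eball_lty R k 1) mgh (fun z => g0 _).
  transitivity (c%:E * \int[m1]_z g (hat z))%E.
    exact: e1.
  by rewrite -e3.
have mEf : measurable_fun (setT : set (rvB R n)) (EFin \o f) by exact/measurable_EFinP.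
have mfh := measurable_comp_hat mf.
have ifh : lam.-integrable (eball 1) (EFin \o (fun z => f (hat z))).
  apply: measurable_bounded_integrable => //.
  - exact: leb_eball_lty.
  - exact: measurable_funTS.
  - exists C; split; first exact: num_real.
    by move=> M CM z _ /=; rewrite (le_trans (fC z))// ltW.
rewrite /sphere_avg -cE /Rint /Rintegral.
rewrite -(@integral_indicl _ (rvB R n) _ lam (eball 1) (fun z => f (hat z))).
have -> : (\int[nu]_z (f z)%:E = c%:E * \int[lam]_(z in eball 1) (f (hat z))%:E)%E.
  rewrite integralE [in RHS]integralE.
  rewrite (h _ (measurable_funepos mEf)); last by move=> z; exact: funepos_ge0.
  rewrite (h _ (measurable_funeneg mEf)); last by move=> z; exact: funeneg_ge0.
  have -> : (\int[lam]_(z in eball 1) (EFin \o f)^\+ (hat z) =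
    \int[lam]_(z in eball 1) (EFin \o (fun z => f (hat z)))^\+ z)%E.
    by apply: eq_integral => z _; rewrite !funeposE.
  have -> : (\int[lam]_(z in eball 1) (EFin \o f)^\- (hat z) =
    \int[lam]_(z in eball 1) (EFin \o (fun z => f (hat z)))^\- z)%E.
    by apply: eq_integral => z _; rewrite !funenegE.
  rewrite [RHS]muleBr//; apply: fin_num_adde_defr.
  exact: integrable_pos_fin_num.
rewrite fineM//; first by rewrite mulrC.
exact: integrable_fin_num.
Qed.

(** * The smoothed function and its two-point gradient *)

Section zeroth_order.
Variables (F : 'rV[R]_n -> R) (L eta : R).
Hypotheses (eta0 : 0 < eta) (L0 : 0 <= L) (FL : e_lipschitzR L F).

Definition two_point (x s : 'rV[R]_n) : R :=
  n%:R / (2 * eta) * (F (x + eta *: s) - F (x - eta *: s)).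

Definition sgrad (x : 'rV[R]_n) : 'rV[R]_n :=
  \row_j sphere_avg (fun s => two_point x s * s 0 j).

Definition smoothed (x : 'rV[R]_n) : R := ball_avg (fun u => F (x + eta *: u)).

Let lip_ray (x : 'rV[R]_n) (c : R) : e_lipschitzR (L * `|c|) (fun u => F (x + c *: u)).
Proof.
move=> u u'; apply: le_trans (FL _ _) _.
by rewrite opprD addrACA subrr add0r -scalerBr enormZ mulrA.
Qed.

Let meas_ray x c : meas (fun u => F (x + c *: u)).
Proof. exact: continuous_measurable_rv (lipschitz_continuous (lip_ray x c)). Qed.

Lemma measurable_two_point x : meas (two_point x).
Proof.
apply: measurable_funM => //; apply: measurable_funB; first exact: meas_ray.
have := meas_ray x (- eta); by congr measurable_fun; apply/funext => u; rewrite scaleNr.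
Qed.

Let ceta : 0 < n%:R / (2 * eta). Proof. by rewrite divr_gt0// mulr_gt0. Qed.

Lemma two_point_le x s : `|two_point x s| <= n%:R * L * enorm s.
Proof.
rewrite /two_point normrM (gtr0_norm ceta).
have -> : n%:R * L * enorm s = n%:R / (2 * eta) * (L * (2 * eta * enorm s)).
  by field; rewrite gt_eqF.
rewrite ler_wpM2l ?(ltW ceta)//; apply: le_trans (FL _ _) _.
have -> : x + eta *: s - (x - eta *: s) = (2 * eta) *: s.
  by rewrite opprB addrC addrA subrK -scalerDl mulr_natl mulr2n.
by rewrite enormZ gtr0_norm// mulr_gt0.
Qed.

(** Continuity in [x] is wanted for [sgrad], whose measurability follows from it. *)
Lemma two_point_lip x x' s : `|two_point x s - two_point x' s| <= n%:R * L / eta * enorm (x - x').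
Proof.
rewrite /two_point -mulrBr normrM (gtr0_norm ceta).
have -> : n%:R * L / eta * enorm (x - x') =
    n%:R / (2 * eta) * (L * enorm (x - x') + L * enorm (x - x')).
  by field; rewrite gt_eqF.
rewrite ler_wpM2l ?(ltW ceta)//.
have -> : F (x + eta *: s) - F (x - eta *: s) - (F (x' + eta *: s) - F (x' - eta *: s)) =
  (F (x + eta *: s) - F (x' + eta *: s)) - (F (x - eta *: s) - F (x' - eta *: s)) by ring.
apply: le_trans (ler_normB _ _) _; apply: lerD; apply: le_trans (FL _ _) _.
  by rewrite opprD addrACA subrr addr0.
by rewrite opprB addrA subrK.
Qed.

Let tp_hat x z : `|two_point x (hat z)| <= n%:R * L.
Proof.
apply: le_trans (two_point_le _ _) _; rewrite -[leRHS]mulr1 ler_wpM2l ?mulr_ge0//.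
exact: enorm_hat_le1.
Qed.

Let coord_hat z (j : 'I_n) : `|(hat z) 0 j| <= 1.
Proof. by apply: le_trans (coord_le_enorm _ _) _; exact: enorm_hat_le1. Qed.

Lemma measurable_two_pointM x (j : 'I_n) : meas (fun s => two_point x s * s 0 j).
Proof. by apply: measurable_funM; [exact: measurable_two_point|exact: measurable_coord]. Qed.

Let tpM_hat x z (j : 'I_n) : `|two_point x (hat z) * (hat z) 0 j| <= n%:R * L.
Proof. by rewrite normrM -[leRHS]mulr1 ler_pM. Qed.

Lemma sgrad_coord_le x j : `|sgrad x 0 j| <= n%:R * L.
Proof. by rewrite mxE; apply: sphere_avg_le => //; exact: measurable_two_pointM. Qed.

Lemma sgrad_le x : enorm (sgrad x) <= n%:R * (n%:R * L).
Proof.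
apply: le_trans (enorm_le_sum _) _.
apply: (@le_trans _ _ (\sum_(j < n) (n%:R * L))).
  by apply: ler_sum => j _; exact: sgrad_coord_le.
by rewrite sumr_const card_ord -[leLHS]mulr_natl.
Qed.

Lemma sgrad_coord_lip j : e_lipschitzR (n%:R * L / eta) (fun x => sgrad x 0 j).
Proof.
move=> x x'; rewrite !mxE -(sphere_avgB (measurable_two_pointM x j) (measurable_two_pointM x' j)
  (fun z => tpM_hat x z j) (fun z => tpM_hat x' z j)).
apply: sphere_avg_le.
  by apply: measurable_funB; exact: measurable_two_pointM.
move=> z; rewrite -mulrBl normrM -[leRHS]mulr1 ler_pM//.
exact: two_point_lip.
Qed.

Lemma smoothedE x : smoothed x = Rint (fun u => \1_(eball 1) u * F (x + eta *: u)) / v.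
Proof.
apply: (@ball_avgE _ (`|F x| + L * eta)); first exact: meas_ray.
move=> u u1; have -> : F (x + eta *: u) = F x + (F (x + eta *: u) - F x) by rewrite [RHS]addrC subrK.
apply: le_trans (ler_normD _ _) _; rewrite lerD2l; apply: le_trans (FL _ _) _.
rewrite [x + _]addrC addrK enormZ (gtr0_norm eta0) ler_wpM2l// -[leRHS]mulr1.
by rewrite ler_wpM2l// ltW.
Qed.

Let integ_ray x : integ (fun u => \1_(eball 1) u * F (x + eta *: u)).
Proof.
apply: (integ_supp (r := 1) (C := `|F x| + L * eta)) => //.
  exact: measurable_eball.
move=> u u1; have -> : F (x + eta *: u) = F x + (F (x + eta *: u) - F x) by rewrite [RHS]addrC subrK.
apply: le_trans (ler_normD _ _) _; rewrite lerD2l; apply: le_trans (FL _ _) _.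
rewrite [x + _]addrC addrK enormZ (gtr0_norm eta0) ler_wpM2l// -[leRHS]mulr1.
by rewrite ler_wpM2l// ltW.
Qed.

Lemma smoothed_lip : e_lipschitzR L smoothed.
Proof.
move=> x x'; have v0 := ball_vol_gt0.
rewrite !smoothedE -mulrBl -RintB// normrM normfV (gtr0_norm v0) ler_pdivrMr//.
rewrite -RintZ; last exact: integ_eball.
apply: le_norm_Rint; [exact: integB|exact: integZ (integ_eball _ _)|].
move=> u; have /andP[e0 e1] := indic01 (eball 1) u.
rewrite -mulrBr normrM (ger0_norm e0) mulrC ler_wpM2r//.
by apply: le_trans (FL _ _) _; rewrite opprD addrACA subrr addr0.
Qed.

Lemma smoothed_ge x : F x - L * eta <= smoothed x.
Proof.
have v0 := ball_vol_gt0.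
rewrite smoothedE ler_pdivlMr// -RintZ; last exact: integ_eball.
apply: le_Rint; [exact: integZ (integ_eball _ _)|exact: integ_ray|].
move=> u; rewrite indicE in_eball; have [u1|_] := boolP (enorm u <= 1);
  rewrite /= ?mulr1n ?mulr0n ?mulr0 ?mul0r// mulr1 mul1r.
rewrite lerBlDr -lerBlDl; apply: le_trans (ler_norm _) _; apply: le_trans (FL _ _) _.
rewrite opprD addNKr enormN enormZ (gtr0_norm eta0) ler_wpM2l// -[leRHS]mulr1.
by rewrite ler_wpM2l// ltW.
Qed.

(** After rescaling by [eta], [shift_ball] covers shifts of length at most 1/2 and gives [C1]. For
    longer shifts [1 <= (2 / eta) * |d|], so the linear bounds on the increment and on [sgrad] are
    already quadratic, which gives [C2]. *)
Lemma smoothed_taylor : exists2 C, 0 <= C & forall x d,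
  `|smoothed (x + d) - smoothed x - dot (sgrad x) d| <= C * enorm d ^+ 2.
Proof.
have v0 := ball_vol_gt0.
pose C1 : R := (3 * n%:R + 6 * 4 ^+ n) * L / eta.
pose C2 : R := (L + n%:R * (n%:R * L)) * (2 / eta).
have C10 : 0 <= C1.
  by rewrite divr_ge0 ?(ltW eta0)// mulr_ge0// addr_ge0// mulr_ge0// exprn_ge0.
have C20 : 0 <= C2.
  by rewrite mulr_ge0 ?divr_ge0 ?(ltW eta0)// addr_ge0// !mulr_ge0.
exists (C1 + C2); first exact: addr_ge0.
move=> x d; pose d' := eta^-1 *: d.
have dE : d = eta *: d' by rewrite scalerA divff ?scale1r// gt_eqF.
have d'E : enorm d' = enorm d / eta by rewrite enormZ gtr0_norm ?invr_gt0// mulrC.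
have d0 := sqr_ge0 (enorm d).
have [small|large] := leP (enorm d') 2^-1.
  apply: (@le_trans _ _ (C1 * enorm d ^+ 2)); last by rewrite ler_wpM2r// lerDl.
  pose H u := F (x + eta *: u).
  have HK := lip_ray x eta; rewrite (gtr0_norm eta0) in HK.
  have K0 : 0 <= L * eta by rewrite mulr_ge0// ltW.
  have := shift_ball V0 small K0 HK.
  have -> : dot (sgrad x) d =
     (n%:R / 2 * Rint (fun z => \1_(eball 1) z * ((H (hat z) - H (- hat z)) * dot (hat z) d'))) / v.
    rewrite (sphere_avg_dot d (measurable_two_point x) (tp_hat x)) /sphere_avg.
    congr (_ / _); rewrite -RintZ.
      apply: eq_Rint => z; rewrite /two_point /H {1}dE dotZr scalerN.
      by field; rewrite gt_eqF.
    pose h s := (H s - H (- s)) * dot s d'.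
    apply: (@integ_sphere h (2 * (L * eta) * enorm d')).
      apply: measurable_funM; last exact: measurable_dotr.
      apply: measurable_funB; first exact: meas_ray.
      have := meas_ray x (- eta).
      by congr measurable_fun; apply/funext => u; rewrite scaleNr /H scalerN.
    move=> z; rewrite normrM ler_pM//.
      apply: le_trans (HK _ _) _; rewrite opprK (mulrC 2) ler_wpM2l//.
      apply: le_trans (ler_enormD _ _) _; have := enorm_hat_le1 z; lra.
    apply: le_trans (dot_le_enorm _ _) _; rewrite -[leRHS]mul1r ler_wpM2r ?enorm_ge0//.
    exact: enorm_hat_le1.
  rewrite !smoothedE.
  have -> : Rint (fun u => \1_(eball 1) u * F (x + d + eta *: u)) =
     Rint (fun u => \1_(eball 1) u * H (u + d')).
    by apply: eq_Rint => u; rewrite /H scalerDr -dE addrA addrAC.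
  move=> hs; rewrite -!mulrBl normrM normfV (gtr0_norm v0) ler_pdivrMr//.
  apply: le_trans hs _; rewrite -/(enorm d') d'E /C1.
  by rewrite le_eqVlt; apply/orP; left; apply/eqP; field; rewrite gt_eqF.
apply: (@le_trans _ _ (C2 * enorm d ^+ 2)); last by rewrite ler_wpM2r// lerDr.
have e1 : 1 <= (2 / eta) * enorm d.
  by move: large; rewrite d'E => h; rewrite mulrAC -mulrA; move: (enorm d / eta) h => t; lra.
apply: (@le_trans _ _ ((L + n%:R * (n%:R * L)) * enorm d)); last first.
  rewrite /C2 expr2 -mulrA ler_wpM2l//; first by rewrite addr_ge0// !mulr_ge0.
  by rewrite mulrA -[leLHS]mul1r ler_wpM2r// enorm_ge0.
apply: le_trans (ler_normB _ _) _; rewrite mulrDl; apply: lerD.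
  by apply: le_trans (smoothed_lip _ _) _; rewrite addrC addKr.
apply: le_trans (dot_le_enorm _ _) _; rewrite ler_wpM2r ?enorm_ge0//; exact: sgrad_le.
Qed.

End zeroth_order.

End Smoothing.

(** * Stochastic gradient descent *)

Section LiminfZero.
Context {R : realType}.
Implicit Types (g w q : nat -> R).

(** If [q] stayed above [e] from some index on, the partial sums of [g] would exceed a fixed sum by
    at most [B / e], against divergence. The weights [w] may differ from [g] at first, because
    descent is guaranteed only for small steps. *)
Lemma small_terms_of_weighted_sum g w q (B : R) (N : nat) :
  (forall r, 0 <= g r) -> (forall r, 0 <= w r) -> (forall r, 0 <= q r) ->
  (forall r, (N <= r)%N -> w r = g r) -> series g @ \oo --> +oo ->
  (forall M, \sum_(0 <= i < M) w i * q i <= B) ->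
  forall e, 0 < e -> forall m, exists2 r, (m <= r)%N & q r < e.
Proof.
move=> g0 w0 q0 wg goo hB e e0 m; apply: contrapT => hno.
have qe r : (m <= r)%N -> e <= q r.
  by move=> mr; rewrite leNgt; apply/negP => qr; apply: hno; exists r.
pose K := maxn m N.
have B0 : 0 <= B by have := hB 0%N; rewrite big_geq.
have bound M : \sum_(0 <= i < M) g i <= \sum_(0 <= i < K) g i + B / e.
  have [MK|KM] := leqP M K.
    rewrite (@big_cat_nat _ _ _ M 0 K)//= -addrA lerDl addr_ge0//.
      by apply: sumr_ge0.
    by rewrite divr_ge0 ?(ltW e0).
  rewrite (@big_cat_nat _ _ _ K 0 M)//=; last exact: ltnW.
  rewrite lerD2l ler_pdivlMr// mulr_suml.
  apply: le_trans (hB M); rewrite (@big_cat_nat _ _ _ K 0 M)//=; last exact: ltnW.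
  apply: ler_wpDl; first by apply: sumr_ge0 => i _; rewrite mulr_ge0.
  rewrite !big_seq; apply: ler_sum => i; rewrite mem_index_iota => /andP[Ki _].
  rewrite wg; last exact: leq_trans (leq_maxr _ _) Ki.
  by rewrite ler_wpM2l// qe// (leq_trans (leq_maxl _ _) Ki).
move/cvgryPge : goo => /(_ (\sum_(0 <= i < K) g i + B / e + 1))[M _ /(_ M (leqnn M))] /=.
by rewrite /series/= => h; have := le_trans h (bound M); lra.
Qed.

Lemma limn_einf_eq0 q : (forall r, 0 <= q r) ->
  (forall e, 0 < e -> forall m, exists2 r, (m <= r)%N & q r < e) ->
  limn_einf (fun r => (q r)%:E) = 0%E.
Proof.
move=> q0 small; rewrite limn_einf_lim.
have -> : einfs (fun r => (q r)%:E) = cst 0%E.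
  apply/funext => m; rewrite /einfs/=; apply/eqP; rewrite eq_le; apply/andP; split.
    apply/lee_addgt0Pr => e e0; rewrite add0e.
    have [r mr qr] := small e e0 m.
    apply: (@le_trans _ _ (q r)%:E); last by rewrite lee_fin ltW.
    by apply: ereal_inf_lbound; exists r.
  by apply: le_ereal_inf_tmp => _ [r _ <-]; rewrite lee_fin.
exact: lim_cst.
Qed.

End LiminfZero.

Section Expectation.
Context d (T : measurableType d) (R : realType) (P : {measure set T -> \bar R}).
Local Notation meas f := (measurable_fun setT f).
Local Notation integ f := (P.-integrable setT (EFin \o f)).
Local Notation E f := (Rintegral P setT f).
Implicit Types (f g : T -> R).

Lemma integ_dom f g : meas f -> integ g -> (forall w, `|f w| <= g w) -> integ f.
Proof.
move=> mf ig fg; apply: (le_integrable _ _ _ ig) => //.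
  exact/measurable_EFinP.
by move=> w _ /=; rewrite lee_fin (le_trans (fg w))// ler_norm.
Qed.

Lemma integ_add f g : integ f -> integ g -> integ (fun w => f w + g w).
Proof. by move=> hf hg; exact: (integrableD measurableT hf hg). Qed.

Lemma integ_sub f g : integ f -> integ g -> integ (fun w => f w - g w).
Proof. by move=> hf hg; exact: (integrableB measurableT hf hg). Qed.

Lemma integ_scale c f : integ f -> integ (fun w => c * f w).
Proof. by move=> hf; exact: (integrableZl measurableT c hf). Qed.

Lemma integ_meas f : integ f -> meas f.
Proof. by move=> /(measurable_int P)/measurable_EFinP. Qed.

Lemma ge0_integ f (c : R) : meas f -> (forall w, 0 <= f w) ->
  (\int[P]_w (f w)%:E <= c%:E)%E -> integ f /\ E f <= c.
Proof.
move=> mf f0 fc; have fi : integ f.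
  apply/integrableP; split; first exact/measurable_EFinP.
  apply: le_lt_trans (ltry c); apply: le_trans fc.
  by rewrite le_eqVlt; apply/orP; left; apply/eqP; apply: eq_integral => w _ /=; rewrite ger0_norm.
split=> //; rewrite -lee_fin /Rintegral fineK//.
exact: (integrable_fin_num measurableT fi).
Qed.

(* The integral of a nonnegative nonmeasurable function is its lower integral,
   so it still dominates the integrals of the measurable functions below it. *)
Lemma ge0_le_integral_lower (f g : T -> \bar R) :
  (forall w, 0 <= f w)%E -> (forall w, f w <= g w)%E ->
  (\int[P]_w f w <= \int[P]_w g w)%E.
Proof.
move=> f0 fg; have g0 w : (0 <= g w)%E by exact: le_trans (fg w).
rewrite !ge0_integralTE//; apply: ereal_sup_le => _ [h hf <-].
by exists h => // w; exact: le_trans (hf w) (fg w).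
Qed.

End Expectation.

(** * From a descent inequality to almost sure summability *)

Section Descent.
Context d (T : measurableType d) (R : realType) (P : {measure set T -> \bar R}).
Local Notation meas f := (measurable_fun setT f).
Local Notation integ f := (P.-integrable setT (EFin \o f)).
Local Notation E f := (Rintegral P setT f).
Variables (g : nat -> R) (V Q : nat -> T -> R) (b : nat -> R) (C B finf : R).
Hypotheses (g0 : forall r, 0 <= g r) (goo : series g @ \oo --> +oo)
  (gsq : cvgn (series (fun r => g r ^+ 2))).
Hypotheses (iV : forall r, integ (V r)) (Vinf : forall r, finf <= E (V r)).
Hypotheses (iQ : forall r, integ (Q r)) (Q0 : forall r w, 0 <= Q r w).
Hypotheses (b0 : forall r, 0 <= b r) (bB : forall M, \sum_(0 <= r < M) b r <= B).
Hypotheses (C0 : 0 <= C).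
Hypothesis step : forall r,
  E (V r.+1) <= E (V r) - (g r / 2 - C * g r ^+ 2) * E (Q r) + b r.

(** Square summability sends [g r] to 0. The [+ 1] in the threshold keeps the denominator positive
    when [C] is 0. *)
Lemma step_size_eventually_small : exists N, forall r, (N <= r)%N -> C * g r <= 4^-1.
Proof.
have /cvgr0_norm_le h := cvg_series_cvg_0 gsq.
pose e : R := (4 * (C + 1))^-1.
have e0 : 0 < e by rewrite invr_gt0 mulr_gt0// ltr_wpDl.
have [N _ hN] := h (e ^+ 2) (exprn_gt0 2 e0).
exists N => r Nr; have := hN r Nr; rewrite ger0_norm ?sqr_ge0//.
rewrite ler_pXn2r ?nnegrE ?(ltW e0)// => gr.
apply: (@le_trans _ _ ((C + 1) * g r)); first by rewrite ler_wpM2r// lerDl.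
apply: (@le_trans _ _ ((C + 1) * e)); first by rewrite ler_wpM2l// addr_ge0.
rewrite /e le_eqVlt; apply/orP; left; apply/eqP; field.
by rewrite gt_eqF// ltr_wpDl.
Qed.

Lemma descent_small_terms :
  {ae P, forall w, forall e, 0 < e -> forall m, exists2 r, (m <= r)%N & Q r w < e}.
Proof.
have [N hN] := step_size_eventually_small.
have EQ0 r : 0 <= E (Q r) by exact: Rintegral_ge0.
(* Before [N] the coefficient [g r / 2 - C * g r ^+ 2] may be negative, so these rounds get weight
   0. From [N] on it is at least [g r / 4]. *)
pose w_ r : R := if (N <= r)%N then g r else 0.
have w0 r : 0 <= w_ r by rewrite /w_; case: ifP.
have tel M : finf + \sum_(0 <= r < M) (w_ r / 4) * E (Q r) <= E (V N) + B.
  have step' r : (N <= r)%N -> E (V r.+1) <= E (V r) - (w_ r / 4) * E (Q r) + b r.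
    move=> Nr; apply: le_trans (step r) _; rewrite lerD2r lerD2l lerN2 /w_ Nr.
    rewrite ler_wpM2r// lerBrDl expr2 mulrA.
    have := ler_wpM2r (g0 r) (hN r Nr); lra.
  have low : \sum_(0 <= r < N) (w_ r / 4) * E (Q r) = 0.
    rewrite big_seq big1// => i; rewrite mem_index_iota => /andP[_ iN].
    by rewrite /w_ leqNgt iN/= mul0r mul0r.
  have bge i j : 0 <= \sum_(i <= r < j) b r by apply: sumr_ge0.
  have B0 : 0 <= B by have := bB 0%N; rewrite big_geq.
  have high k : E (V (N + k)%N) + \sum_(0 <= r < N + k) (w_ r / 4) * E (Q r) <=
      E (V N) + \sum_(N <= r < N + k) b r.
    elim: k => [|k IH]; first by rewrite addn0 low big_geq// addr0.
    rewrite addnS big_nat_recr//= [X in _ <= _ + X]big_nat_recr ?leq_addr//=.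
    have := step' _ (leq_addr k N); move: IH.
    move: (\sum_(0 <= r < N + k) _) (\sum_(N <= r < N + k) _) (w_ _ / 4 * _) => s1 s2 s3.
    lra.
  have [MN|NM] := leqP M N.
    have -> : \sum_(0 <= r < M) (w_ r / 4) * E (Q r) = 0.
      rewrite big_seq big1// => i; rewrite mem_index_iota => /andP[_ iM].
      by rewrite /w_ leqNgt (leq_trans iM MN)/= mul0r mul0r.
    by have := Vinf N; lra.
  have := high (M - N)%N; rewrite subnKC ?(ltnW NM)// => h.
  have hb : \sum_(N <= r < M) b r <= B.
    apply: le_trans (bB M); rewrite (@big_cat_nat _ _ _ N 0 M)//= ?(ltnW NM)//.
    by rewrite lerDr.
  by have := Vinf M; move: h hb; lra.
pose h r w := (w_ r * Q r w)%:E.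
have mh r : measurable_fun setT (h r).
  by apply/measurable_EFinP; apply: measurable_funM => //; exact: integ_meas (iQ r).
have h0 r w : (0 <= h r w)%E by rewrite lee_fin mulr_ge0.
(* Tonelli exchanges this series with the integral, and a finite integral makes it finite almost
   everywhere. *)
pose S w := (\sum_(0 <= r <oo) h r w)%E.
have intS : (\int[P]_w S w < +oo)%E.
  rewrite /S integral_nneseries//.
  apply: (@le_lt_trans _ _ (4 * (E (V N) + B - finf))%:E); last exact: ltry.
  apply: lime_le; first by apply: is_cvg_nneseries => r _ _; exact: integral_ge0.
  apply: nearW => M /=.
  have -> : (\sum_(0 <= r < M) \int[P]_w h r w =
      (\sum_(0 <= r < M) w_ r * E (Q r))%:E)%E.
    rewrite -sumEFin; apply: eq_bigr => r _.
    rewrite /h; under eq_integral do rewrite EFinM.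
    rewrite ge0_integralZl//; last 3 first.
    - by apply/measurable_EFinP; exact: integ_meas (iQ r).
    - by move=> w _; rewrite lee_fin.
    - by rewrite lee_fin.
    rewrite EFinM /Rintegral fineK//; exact: (integrable_fin_num measurableT (iQ r)).
  rewrite lee_fin; have := tel M.
  have -> : \sum_(0 <= r < M) w_ r * E (Q r) = 4 * \sum_(0 <= r < M) (w_ r / 4) * E (Q r).
    by rewrite mulr_sumr; apply: eq_bigr => r _; field.
  by move: (\sum_(0 <= r < M) _) => s; lra.
have mS : measurable_fun setT S by exact: ge0_emeasurable_sum.
have S0 w : (0 <= S w)%E by apply: nneseries_ge0 => r _ _; exact: h0.
have iS : P.-integrable setT S.
  by apply/integrableP; split => //; under eq_integral do rewrite gee0_abs//.
have := integrable_ae measurableT iS.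
apply: filterS => w /(_ I) Sfin.
apply: (@small_terms_of_weighted_sum _ g w_ (Q ^~ w) (fine (S w)) N) => //.
  by move=> r Nr; rewrite /w_ Nr.
move=> M; rewrite -lee_fin fineK// -sumEFin.
exact: (nneseries_lim_ge M (fun r _ _ => h0 r w)).
Qed.

End Descent.

Section MeasurableVectors.
Context d (T : measurableType d) (R : realType) (n : nat).
Local Notation vmeas X := (measurable_fun setT (X : T -> rvB R n)).
Implicit Types X Y : T -> 'rV[R]_n.

Lemma measurable_dot X Y : vmeas X -> vmeas Y -> measurable_fun setT (fun w => dot (X w) (Y w)).
Proof.
move=> /measurable_rvP mX /measurable_rvP mY.
by apply: measurable_sum => j; exact: measurable_funM.
Qed.

Lemma measurable_enormT X : vmeas X -> measurable_fun setT (fun w => enorm (X w)).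
Proof. by move=> mX; exact: (measurableT_comp (@measurable_enorm R n) mX). Qed.

Lemma measurable_vecD X Y : vmeas X -> vmeas Y -> vmeas (fun w => X w + Y w).
Proof.
move=> /measurable_rvP mX /measurable_rvP mY; apply/measurable_rvP => j.
apply: (eq_measurable_fun (fun w => X w 0 j + Y w 0 j)) => [w _|]; first by rewrite mxE.
exact: measurable_funD.
Qed.

Lemma measurable_vecZ (f : T -> R) X : measurable_fun setT f -> vmeas X ->
  vmeas (fun w => f w *: X w).
Proof.
move=> mf /measurable_rvP mX; apply/measurable_rvP => j.
apply: (eq_measurable_fun (fun w => f w * X w 0 j)) => [w _|]; first by rewrite mxE.
exact: measurable_funM.
Qed.

Lemma measurable_vecB X Y : vmeas X -> vmeas Y -> vmeas (fun w => X w - Y w).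
Proof.
move=> mX mY; have := measurable_vecD mX (measurable_vecZ (@measurable_cst _ _ T R setT (-1)) mY).
by congr measurable_fun; apply/funext => w; rewrite /= scaleN1r.
Qed.

Lemma measurable_vec_sum m (X : 'I_m -> T -> 'rV[R]_n) : (forall i, vmeas (X i)) ->
  vmeas (fun w => \sum_(i < m) X i w).
Proof.
move=> mX; apply/measurable_rvP => j.
apply: (eq_measurable_fun (fun w => \sum_(i < m) X i w 0 j)) => [w _|].
  by rewrite summxE.
by apply: measurable_sum => i; move/measurable_rvP : (mX i).
Qed.

End MeasurableVectors.

Lemma enorm_sqrD (R : realType) n (a b : 'rV[R]_n) :
  enorm (a + b) ^+ 2 <= 2 * enorm a ^+ 2 + 2 * enorm b ^+ 2.
Proof.
have h := sqr_ge0 (enorm (a - b)).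
rewrite enorm_sq dotDl !dotDr !dotNl !dotNr (dotC b a) opprK -!enorm_sq in h.
by rewrite enorm_sq dotDl !dotDr (dotC b a) -!enorm_sq; lra.
Qed.

(** * Stochastic gradient descent with two noises and an error *)

Section SGD.
Context d (T : measurableType d) (R : realType) (P : probability T R) (n : nat).
Local Notation meas f := (measurable_fun setT f).
Local Notation vmeas X := (measurable_fun setT (X : T -> rvB R n)).
Local Notation integ f := (P.-integrable setT (EFin \o f)).
Local Notation Ex f := (Rintegral P setT f).

Variables (f : 'rV[R]_n -> R) (gr : 'rV[R]_n -> 'rV[R]_n) (C a b K s2 finf : R).
Variables (x0 : 'rV[R]_n) (x Z U E : nat -> T -> 'rV[R]_n) (g c : nat -> R).
Hypotheses (C0 : 0 <= C) (a0 : 0 <= a) (b0 : 0 <= b).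
Hypothesis f_taylor : forall y d, `|f (y + d) - f y - dot (gr y) d| <= C * enorm d ^+ 2.
Hypothesis f_ge : forall y, finf <= f y.
Hypothesis mf : measurable_fun (setT : set (rvB R n)) f.
Hypothesis mgr : measurable_fun (setT : set (rvB R n)) (gr : rvB R n -> rvB R n).
Hypothesis gr_le : forall y, enorm (gr y) <= a + b * enorm y.
Hypotheses (mx : forall r, vmeas (x r)) (mZ : forall r, vmeas (Z r))
  (mU : forall r, vmeas (U r)) (mE : forall r, vmeas (E r)).
Hypothesis x_0 : x 0%N = fun=> x0.
Hypothesis x_S : forall r w,
  x r.+1 w = x r w - g r *: (gr (x r w) + Z r w + U r w + E r w).
Hypothesis Z2 : forall r, (\int[P]_w (enorm (Z r w) ^+ 2)%:E <= s2%:E)%E.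
Hypothesis U_le : forall r w, enorm (U r w) <= K.
Hypothesis E2 : forall r, (\int[P]_w (enorm (E r w) ^+ 2)%:E <= (c r)%:E)%E.
Hypothesis Z_mean : forall r, integ (fun w => enorm (x r w) ^+ 2) ->
  Ex (fun w => dot (gr (x r w)) (Z r w)) = 0.
Hypothesis U_mean : forall r, integ (fun w => enorm (x r w) ^+ 2) ->
  Ex (fun w => dot (gr (x r w)) (U r w)) = 0.
Hypotheses (g0 : forall r, 0 <= g r) (goo : series g @ \oo --> +oo)
  (gsq : cvgn (series (fun r => g r ^+ 2)))
  (gc0 : forall r, 0 <= g r * c r) (gc : cvgn (series (fun r => g r * c r))).

Let D r w := gr (x r w) + Z r w + U r w + E r w.

Let mgx r : vmeas (fun w => gr (x r w)).
Proof. exact: (measurableT_comp mgr (mx r)). Qed.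

Let mD r : vmeas (D r).
Proof. by do 3 (apply: measurable_vecD => //). Qed.

Let msq (X : T -> 'rV[R]_n) : vmeas X -> meas (fun w => enorm (X w) ^+ 2).
Proof. by move=> mX; apply: measurable_funX; exact: measurable_enormT. Qed.

Let D2 r w : enorm (D r w) ^+ 2 <= 4 * enorm (gr (x r w)) ^+ 2 +
  (4 * enorm (Z r w) ^+ 2 + (4 * K ^+ 2 + 4 * enorm (E r w) ^+ 2)).
Proof.
rewrite /D -addrA.
have h1 := enorm_sqrD (gr (x r w) + Z r w) (U r w + E r w).
have h2 := enorm_sqrD (gr (x r w)) (Z r w).
have h3 := enorm_sqrD (U r w) (E r w).
have h4 : enorm (U r w) ^+ 2 <= K ^+ 2.
  by rewrite ler_pXn2r ?nnegrE ?enorm_ge0//; exact: le_trans (enorm_ge0 _) (U_le r w).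
by lra.
Qed.

Let iZ r := (ge0_integ (msq (mZ r)) (fun w => sqr_ge0 _) (Z2 r)).1.
Let iE r := (ge0_integ (msq (mE r)) (fun w => sqr_ge0 _) (E2 r)).1.

Let icst (t : R) : integ (fun=> t).
Proof. exact: finite_measure_integrable_cst. Qed.

Let igx r : integ (fun w => enorm (x r w) ^+ 2) ->
  integ (fun w => enorm (gr (x r w)) ^+ 2).
Proof.
move=> ix; apply: (@integ_dom _ _ _ _ _ (fun w => 2 * a ^+ 2 + (2 * b ^+ 2) * enorm (x r w) ^+ 2)).
- exact: msq.
- by apply: integ_add => //; exact: integ_scale.
move=> w; rewrite ger0_norm ?sqr_ge0//.
apply: (@le_trans _ _ ((a + b * enorm (x r w)) ^+ 2)).
  by rewrite ler_pXn2r ?nnegrE ?enorm_ge0// addr_ge0// mulr_ge0// enorm_ge0.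
have := sqr_ge0 (a - b * enorm (x r w)).
by move: (enorm (x r w)) => t; rewrite !expr2; lra.
Qed.

Let iD r : integ (fun w => enorm (x r w) ^+ 2) -> integ (fun w => enorm (D r w) ^+ 2).
Proof.
move=> ix; apply: (integ_dom _ _ (fun w => le_trans _ (D2 r w))).
- exact: msq.
- apply: integ_add; first by apply: integ_scale; exact: igx.
  apply: integ_add; first exact: integ_scale.
  by apply: integ_add => //; exact: integ_scale.
by move=> w; rewrite ger0_norm ?sqr_ge0.
Qed.

(** The gradient grows at most linearly, so its second moment is controlled by that of the iterate,
    and the noises and the error have finite second moments. *)
Lemma iterate_sq_integrable r : integ (fun w => enorm (x r w) ^+ 2).
Proof.
elim: r => [|r IH]; first by rewrite x_0; exact: icst.
apply: (@integ_dom _ _ _ _ _ (fun w => 2 * enorm (x r w) ^+ 2 + (2 * g r ^+ 2) * enorm (D r w) ^+ 2)).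
- exact: msq.
- by apply: integ_add; apply: integ_scale => //; exact: iD.
move=> w; rewrite ger0_norm ?sqr_ge0// x_S; apply: le_trans (enorm_sqrD _ _) _.
by rewrite enormN enormZ exprMn real_normK ?num_real// [X in _ + X <= _]mulrA.
Qed.

Let ix := iterate_sq_integrable.

Let idot (X Y : T -> 'rV[R]_n) : vmeas X -> vmeas Y ->
  integ (fun w => enorm (X w) ^+ 2) -> integ (fun w => enorm (Y w) ^+ 2) ->
  integ (fun w => dot (X w) (Y w)).
Proof.
move=> mX mY iX iY.
apply: (@integ_dom _ _ _ _ _ (fun w => enorm (X w) ^+ 2 + enorm (Y w) ^+ 2)).
- exact: measurable_dot.
- exact: integ_add.
move=> w; apply: le_trans (dot_le_enorm _ _) _.
have := sqr_ge0 (enorm (X w) - enorm (Y w)); have := sqr_ge0 (enorm (X w) + enorm (Y w)).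
by rewrite !expr2; lra.
Qed.

Let iU r : integ (fun w => enorm (U r w) ^+ 2).
Proof.
apply: (@integ_dom _ _ _ _ _ (cst (K ^+ 2))); [exact: msq|exact: icst|].
move=> w; rewrite ger0_norm ?sqr_ge0//.
by rewrite ler_pXn2r ?nnegrE ?enorm_ge0//; exact: le_trans (enorm_ge0 _) (U_le r w).
Qed.

Let ifx r : integ (fun w => f (x r w)).
Proof.
apply: (@integ_dom _ _ _ _ _ (fun w => (`|f 0| + enorm (gr 0) ^+ 2) + (C + 1) * enorm (x r w) ^+ 2)).
- exact: (measurableT_comp mf (mx r)).
- by apply: integ_add; [exact: icst|apply: integ_scale].
move=> w; have := f_taylor 0 (x r w); rewrite add0r.
have hd := dot_le_enorm (gr 0) (x r w).
have h1 := sqr_ge0 (enorm (gr 0) - enorm (x r w)).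
have h2 := sqr_ge0 (enorm (gr 0) + enorm (x r w)).
move=> h3.
have -> : f (x r w) = (f (x r w) - f 0 - dot (gr 0) (x r w)) + (f 0 + dot (gr 0) (x r w)) by ring.
apply: le_trans (ler_normD _ _) _; have h4 := ler_normD (f 0) (dot (gr 0) (x r w)).
by move: h1 h2 h3 h4 hd; rewrite !expr2; lra.
Qed.

(** Taylor at the step [- g r * D]. The two noises vanish in expectation against the gradient. The
    error does not, and Young's inequality for it uses up half of the descent term. The factor 4
    comes from splitting [D] into four summands. *)
Lemma sgd_step r :
  Ex (fun w => f (x r.+1 w)) <= Ex (fun w => f (x r w)) -
    (g r / 2 - 4 * C * g r ^+ 2) * Ex (fun w => enorm (gr (x r w)) ^+ 2) +
    (g r * c r / 2 + 4 * C * g r ^+ 2 * (s2 + K ^+ 2 + c r)).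
Proof.
pose q w := enorm (gr (x r w)) ^+ 2.
pose z w := enorm (Z r w) ^+ 2; pose e w := enorm (E r w) ^+ 2.
pose dz w := dot (gr (x r w)) (Z r w); pose du w := dot (gr (x r w)) (U r w).
have iq : integ q by exact: igx.
have idz : integ dz by exact: idot.
have idu : integ du by exact: idot.
have iz : integ z := iZ r. have ie : integ e := iE r.
pose G := g r. pose H := 4 * C * G ^+ 2.
have H0 : 0 <= H by rewrite /H mulr_ge0 ?sqr_ge0// mulr_ge0.
have bound w : f (x r.+1 w) <= (f (x r w) - (G / 2 - H) * q w) +
   ((- G) * dz w + ((- G) * du w + (H * z w + ((G / 2 + H) * e w + H * K ^+ 2)))).
  have := le_trans (ler_norm _) (f_taylor (x r w) (- (G *: D r w))).
  rewrite -x_S enormN enormZ exprMn real_normK ?num_real// dotNr dotZr -/G.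
  have -> : dot (gr (x r w)) (D r w) = q w + dz w + du w + dot (gr (x r w)) (E r w).
    by rewrite /D !dotDr /q enorm_sq.
  have hE : - dot (gr (x r w)) (E r w) <= q w / 2 + e w / 2.
    have := dot_le_enorm (gr (x r w)) (E r w); rewrite ler_norml => /andP[h _].
    have := sqr_ge0 (enorm (gr (x r w)) - enorm (E r w)).
    by rewrite /q /e !expr2; lra.
  have hE' := ler_wpM2l (g0 r) hE; rewrite -/G in hE'.
  have hD : C * (G ^+ 2 * enorm (D r w) ^+ 2) <=
      H * q w + (H * z w + (H * K ^+ 2 + H * e w)).
    rewrite mulrA; apply: le_trans (ler_wpM2l _ (D2 r w)) _.
      by rewrite mulr_ge0 ?sqr_ge0.
    by rewrite -/(q w) -/(z w) -/(e w) /H le_eqVlt; apply/orP; left; apply/eqP; ring.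
  move: hE' hD; move: (dot (gr (x r w)) (E r w)) (C * (G ^+ 2 * enorm (D r w) ^+ 2)) => t1 t2.
  move=> h1 h2 h3; have -> : (G / 2 - H) * q w = G * (q w / 2) - H * q w by ring.
  have -> : (G / 2 + H) * e w = G * (e w / 2) + H * e w by ring.
  rewrite !mulrDr in h1 h3; lra.
have i1 : integ (fun w => H * z w) by exact: integ_scale.
have i2 : integ (fun w => (G / 2 + H) * e w) by exact: integ_scale.
have i3 : integ (fun w => (- G) * dz w) by exact: integ_scale.
have i4 : integ (fun w => (- G) * du w) by exact: integ_scale.
have i5 : integ (fun w => (G / 2 - H) * q w) by exact: integ_scale.
have i6 : integ (fun w => (G / 2 + H) * e w + H * K ^+ 2) by apply: integ_add => //; exact: icst.
have i7 := integ_add i1 i6. have i8 := integ_add i4 i7. have i9 := integ_add i3 i8.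
have i10 := integ_sub (ifx r) i5.
apply: le_trans (le_Rintegral _ (ifx _) (integ_add i10 i9) (fun w _ => bound w)) _ => //.
rewrite (RintegralD _ i10 i9)// (RintegralB _ (ifx r) i5)// (RintegralD _ i3 i8)//.
rewrite (RintegralD _ i4 i7)// (RintegralD _ i1 i6)// (RintegralD _ i2 (icst _))//.
rewrite !RintegralZl// Rintegral_cst//.
have -> : Ex dz = 0 by exact: Z_mean. have -> : Ex du = 0 by exact: U_mean.
have hz : Ex z <= s2 := (ge0_integ (msq (mZ r)) (fun w => sqr_ge0 _) (Z2 r)).2.
have he : Ex e <= c r := (ge0_integ (msq (mE r)) (fun w => sqr_ge0 _) (E2 r)).2.
rewrite (_ : fine _ = 1); last exact: (congr1 fine (probability_setT P)).
rewrite mulr1 -expr2 !mulr0 !add0r.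
have hz' := ler_wpM2l H0 hz.
have he' : (G / 2 + H) * Ex e <= (G / 2 + H) * c r.
  by rewrite ler_wpM2l// addr_ge0// divr_ge0// g0.
have -> : 4 * C * g r ^+ 2 = H by [].
have -> : g r * c r / 2 + H * (s2 + K ^+ 2 + c r) = H * s2 + ((G / 2 + H) * c r + H * K ^+ 2).
  by rewrite /G; field.
by rewrite -/G; lra.
Qed.

Theorem sgd_liminf : {ae P, forall w,
  limn_einf (fun r => (enorm (gr (x r w)))%:E) = 0%E}.
Proof.
pose S1 := limn (series (fun r => g r * c r)).
pose S2 := limn (series (fun r => g r ^+ 2)).
have hS1 M : \sum_(0 <= r < M) g r * c r <= S1.
  by apply: (@nondecreasing_cvgn_le _ (series (fun r => g r * c r))) => //;
     apply: nondecreasing_series.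
have hS2 M : \sum_(0 <= r < M) g r ^+ 2 <= S2.
  apply: (@nondecreasing_cvgn_le _ (series (fun r => g r ^+ 2))) => //.
  by apply: nondecreasing_series => r _ _; exact: sqr_ge0.
(* A bound on the steps makes [g r ^+ 2 * c r] summable, as a bounded multiple of [g r * c r]. *)
have gle r : g r <= 1 + S2.
  have h : g r ^+ 2 <= S2.
    apply: le_trans (hS2 r.+1); rewrite big_nat_recr//= lerDr.
    by apply: sumr_ge0 => i _; exact: sqr_ge0.
  have [g1|g1] := leP (g r) 1.
    by apply: le_trans g1 _; rewrite lerDl; apply: le_trans h; exact: sqr_ge0.
  apply: (@le_trans _ _ (g r ^+ 2)); first by rewrite expr2 -[leLHS]mulr1 ler_wpM2l// ltW.
  by apply: le_trans h _; rewrite lerDr.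
(* The hypotheses give a sign only to [g r * c r]. The sign of [c r] follows because it bounds a
   nonnegative expectation. *)
have c0 r : 0 <= c r.
  by apply: le_trans _ (ge0_integ (msq (mE r)) (fun w => sqr_ge0 _) (E2 r)).2;
     apply: Rintegral_ge0 => w _; exact: sqr_ge0.
have s20 : 0 <= s2.
  by apply: le_trans _ (ge0_integ (msq (mZ 0)) (fun w => sqr_ge0 _) (Z2 0)).2;
     apply: Rintegral_ge0 => w _; exact: sqr_ge0.
pose bb r := g r * c r / 2 + 4 * C * g r ^+ 2 * (s2 + K ^+ 2 + c r).
have C40 : 0 <= 4 * C by rewrite mulr_ge0.
have S20 : 0 <= S2 by have := hS2 0%N; rewrite big_geq.
have bbB M : \sum_(0 <= r < M) bb r <=
    S1 / 2 + 4 * C * ((s2 + K ^+ 2) * S2 + (1 + S2) * S1).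
  apply: (@le_trans _ _ (\sum_(0 <= r < M) (2^-1 * (g r * c r) +
      4 * C * ((s2 + K ^+ 2) * g r ^+ 2 + (1 + S2) * (g r * c r))))).
    apply: ler_sum => r _; rewrite /bb (mulrC _ 2^-1) lerD2l -mulrA ler_wpM2l//.
    rewrite mulrDr [X in X + _ <= _]mulrC lerD2l.
    have -> : g r ^+ 2 * c r = g r * (g r * c r) by rewrite expr2 mulrA.
    by rewrite ler_wpM2r.
  rewrite big_split/= -!mulr_sumr big_split/= -!mulr_sumr (mulrC S1).
  apply: lerD; first by rewrite ler_wpM2l.
  rewrite ler_wpM2l//; apply: lerD; first by rewrite ler_wpM2l// addr_ge0// sqr_ge0.
  by rewrite ler_wpM2l// addr_ge0.
have small : {ae P, forall w, forall e, 0 < e -> forall m,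
    exists2 r, (m <= r)%N & enorm (gr (x r w)) ^+ 2 < e}.
  apply: (@descent_small_terms _ _ _ P g (fun r w => f (x r w))
    (fun r w => enorm (gr (x r w)) ^+ 2) bb (4 * C)
    (S1 / 2 + 4 * C * ((s2 + K ^+ 2) * S2 + (1 + S2) * S1)) finf) => //.
  - move=> r; have <- : Ex (cst finf) = finf.
      rewrite Rintegral_cst//; rewrite (_ : fine _ = 1) ?mulr1//.
      exact: (congr1 fine (probability_setT P)).
    by apply: le_Rintegral => //; exact: icst.
  - by move=> r; exact: igx.
  - by move=> r w; exact: sqr_ge0.
  - move=> r; rewrite addr_ge0 ?divr_ge0// mulr_ge0 ?mulr_ge0 ?sqr_ge0//.
    by rewrite !addr_ge0// sqr_ge0.
  - exact: sgd_step.
apply: filterS small => w small; apply: limn_einf_eq0; first by move=> r; exact: enorm_ge0.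
move=> e e0 m; have [r mr hr] := small (e ^+ 2) (exprn_gt0 2 e0) m.
by exists r => //; move: hr; rewrite ltr_pXn2r// ?nnegrE ?enorm_ge0// ltW.
Qed.

End SGD.

(** * Conditioning on the past *)

Section TwoArguments.
Context {R : realType} {n : nat}.

Lemma enorm_row_mx (p : nat) (a : 'rV[R]_n) (b : 'rV[R]_p) :
  enorm (row_mx a b) ^+ 2 = enorm a ^+ 2 + enorm b ^+ 2.
Proof.
rewrite !enorm_sq /dot big_split_ord/=; congr (_ + _); apply: eq_bigr => j _.
  by rewrite row_mxEl.
by rewrite row_mxEr.
Qed.

(** Lipschitz bounds in each argument make [f2] Lipschitz on concatenated vectors, hence Borel in
    the pair. *)
Lemma measurable_separately_lipschitz (f2 : 'rV[R]_n -> 'rV[R]_n -> R) (L1 L2 : R)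
    d (T : measurableType d) (X Y : T -> 'rV[R]_n) :
  0 <= L1 -> 0 <= L2 ->
  (forall y, e_lipschitzR L1 (fun x => f2 x y)) -> (forall x, e_lipschitzR L2 (f2 x)) ->
  measurable_fun setT (X : T -> rvB R n) -> measurable_fun setT (Y : T -> rvB R n) ->
  measurable_fun setT (fun w => f2 (X w) (Y w)).
Proof.
move=> L10 L20 h1 h2 mX mY.
pose g (z : 'rV[R]_(n + n)) := f2 (lsubmx z) (rsubmx z).
have gL : e_lipschitzR (L1 + L2) g.
  move=> z z'; have -> : g z - g z' = (f2 (lsubmx z) (rsubmx z) - f2 (lsubmx z') (rsubmx z)) +
    (f2 (lsubmx z') (rsubmx z) - f2 (lsubmx z') (rsubmx z')) by rewrite /g; ring.
  have E := enorm_row_mx (lsubmx (z - z')) (rsubmx (z - z')).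
  rewrite hsubmxK in E.
  apply: le_trans (ler_normD _ _) _; rewrite mulrDl; apply: lerD.
    apply: le_trans (h1 _ _ _) _; rewrite ler_wpM2l// -linearB/=.
    by rewrite -(@ler_pXn2r _ 2) ?nnegrE ?enorm_ge0// E lerDl sqr_ge0.
  apply: le_trans (h2 _ _ _) _; rewrite ler_wpM2l// -linearB/=.
  by rewrite -(@ler_pXn2r _ 2) ?nnegrE ?enorm_ge0// E lerDr sqr_ge0.
have mXY : measurable_fun setT ((fun w => row_mx (X w) (Y w)) : T -> rvB R (n + n)).
  apply/(@measurable_rvP R _ T (n + n)) => j.
  have [i|i] := split_ordP j => ->.
    apply: (eq_measurable_fun (fun w => X w 0 i)) => [w _|]; first by rewrite row_mxEl.
    by move/measurable_rvP : mX.
  apply: (eq_measurable_fun (fun w => Y w 0 i)) => [w _|]; first by rewrite row_mxEr.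
  by move/measurable_rvP : mY.
apply: (eq_measurable_fun (fun w => g (row_mx (X w) (Y w)))) => [w _|].
  by rewrite /g row_mxKl row_mxKr.
exact: (measurableT_comp (continuous_measurable_rv (lipschitz_continuous gL)) mXY).
Qed.

End TwoArguments.

Import HBSimple HBNNSimple.

(** * Orthogonality to functions of the past *)

Section SubSigmaAlgebra.
Context d (T : measurableType d) (R : realType) (G : set (set T)).
Hypotheses (sG : sigma_algebra setT G) (Gm : G `<=` measurable).
Local Notation TG := (g_sigma_algebraType G).

Lemma measurable_gE (A : set T) : measurable (A : set TG) <-> G A.
Proof. by rewrite /measurable/= (sigma_algebra_id sG). Qed.

Lemma sub_measurable_fun d' (T' : measurableType d') (f : T -> T') :
  measurable_fun (setT : set TG) f -> measurable_fun (setT : set T) f.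
Proof.
move=> mf _ B mB; apply: Gm; apply/measurable_gE; exact: mf.
Qed.

Lemma rv_meas_measurable n (X : T -> 'rV[R]_n) :
  rv_meas G X <-> measurable_fun (setT : set TG) (X : TG -> rvB R n).
Proof.
split => [h _ B mB|h B mB].
  by rewrite setTI; apply/measurable_gE; exact: h.
by apply/measurable_gE; have := h measurableT B mB; rewrite setTI.
Qed.

Variable P : {measure set T -> \bar R}.
Local Notation integ f := (P.-integrable setT (EFin \o f)).
Local Notation Ex f := (Rintegral P setT f).

Variable Z : T -> R.
Hypothesis iZ : integ Z.
Hypothesis Z0 : forall A, G A -> (\int[P]_(w in A) (Z w)%:E = 0)%E.

Let simple_orth (h : {nnsfun TG >-> R}) : (\int[P]_w (h w * Z w)%:E = 0)%E.
Proof.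
pose s : seq R := finmap.enum_fset (fset_set ((h : TG -> R) @` setT)).
have GA i : G ((h : TG -> R) @^-1` [set s`_i]).
  by apply/measurable_gE; rewrite -[X in measurable X]setTI; apply: (@measurable_funPT _ _ _ _ h).
have iA i : P.-integrable setT (fun w => (s`_i * (\1_((h : TG -> R) @^-1` [set s`_i]) w * Z w))%:E).
  apply: integ_scale.
  apply: (@integ_dom _ _ _ _ _ (fun w => `|Z w|)).
  - apply: measurable_funM; last exact: integ_meas iZ.
    by apply: measurable_indic; apply: Gm.
  - exact: (integrable_norm iZ).
  - move=> w; rewrite normrM indicE; case: (_ \in _); rewrite ?normr1 ?mul1r//.
    by rewrite normr0 mul0r.
transitivity (\int[P]_w (\sum_(i < size s)
   (s`_i * (\1_((h : TG -> R) @^-1` [set s`_i]) w * Z w))%:E))%E.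
  apply: eq_integral => w _; rewrite sumEFin; congr _%:E.
  rewrite (fimfunEord h) mulr_suml; apply: eq_bigr => i _.
  by rewrite mulrA.
rewrite integral_sum// big1// => i _.
under eq_integral do rewrite EFinM.
rewrite integralZl//; last first.
  apply: (@integ_dom _ _ _ _ _ (fun w => `|Z w|)).
  - apply: measurable_funM; last exact: integ_meas iZ.
    by apply: measurable_indic; apply: Gm.
  - exact: (integrable_norm iZ).
  - move=> w; rewrite normrM indicE; case: (_ \in _); rewrite ?normr1 ?mul1r//.
    by rewrite normr0 mul0r.
by rewrite -integral_indicl Z0// mule0.
Qed.

(** Approximation by simple functions of the sub-sigma-algebra. They increase to [phi], so [|phi Z|]
    dominates the products. *)
Let ge0_orth (phi : T -> R) : measurable_fun (setT : set TG) phi ->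
  (forall w, 0 <= phi w) -> integ (fun w => phi w * Z w) ->
  Ex (fun w => phi w * Z w) = 0.
Proof.
move=> mphi phi0 iphi.
have mE : measurable_fun (setT : set TG) (EFin \o phi) by exact/measurable_EFinP.
pose s := nnsfun_approx measurableT mE.
have E0 w : (setT : set TG) w -> (0 <= (EFin \o phi) w)%E by rewrite lee_fin.
have mZ : measurable_fun (setT : set T) Z by exact: integ_meas iZ.
have mphiT := sub_measurable_fun mphi.
have lim : (\int[P]_w (s i w * Z w)%:E @[i --> \oo] --> \int[P]_w (phi w * Z w)%:E)%E.
  have [] // := @dominated_convergence _ T R P setT measurableT
    (fun i w => (s i w * Z w)%:E) (fun w => (phi w * Z w)%:E) (fun w => `|(phi w * Z w)%:E|%E).
  - move=> i; apply/measurable_EFinP; apply: measurable_funM => //.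
    by apply: sub_measurable_fun; exact: measurable_funPT.
  - by apply/measurable_EFinP; exact: measurable_funM.
  - apply: aeW => w _; have := cvg_nnsfun_approx measurableT mE E0 (x := w) I.
    move=> /(cvgeZr (y := (Z w)%:E) isT); under eq_fun do rewrite /= -EFinM.
    by rewrite /= -EFinM.
  - exact: (integrable_norm iphi).
  - apply: aeW => w i _; rewrite lee_fin !normrM ler_wpM2r// !ger0_norm//.
    by rewrite -lee_fin /s nnsfun_approxE; apply: (le_approx i E0 (x := w)).
have s0 : (fun i => \int[P]_w (s i w * Z w)%:E)%E = (fun=> 0%E).
  by apply/funext => i; exact: simple_orth.
by move: lim; rewrite s0 => h; rewrite /Rintegral -(cvg_lim _ h)// lim_cst.
Qed.

(** This takes the place of conditional expectation: vanishing integrals over the sets of [G] extend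
    to all integrable products with [G]-measurable functions, [phi] being split into positive and
    negative parts. *)
Lemma orth (phi : T -> R) : measurable_fun (setT : set TG) phi ->
  integ (fun w => phi w * Z w) -> Ex (fun w => phi w * Z w) = 0.
Proof.
move=> mphi iphi.
have mphiT := sub_measurable_fun mphi.
have mZ : measurable_fun (setT : set T) Z by exact: integ_meas iZ.
pose p w := Num.max (phi w) 0; pose q w := Num.max (- phi w) 0.
have mp : measurable_fun (setT : set TG) p by exact: measurable_maxr.
have mq : measurable_fun (setT : set TG) q.
  by apply: measurable_maxr => //; exact: measurable_funN.
have p0 w : 0 <= p w by rewrite /p le_max lexx orbT.
have q0 w : 0 <= q w by rewrite /q le_max lexx orbT.
have i_of (h : T -> R) : measurable_fun (setT : set TG) h -> (forall w, `|h w| <= `|phi w|) ->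
    integ (fun w => h w * Z w).
  move=> mh hle; apply: (@integ_dom _ _ _ _ _ (fun w => `|phi w * Z w|)).
  - by apply: measurable_funM => //; exact: sub_measurable_fun.
  - exact: (integrable_norm iphi).
  - by move=> w; rewrite !normrM ler_wpM2r.
have ip : integ (fun w => p w * Z w).
  apply: i_of => // w; rewrite ger0_norm// /p.
  by case: (leP (phi w) 0) => h; rewrite ?normr_ge0 ?ler_norm.
have iq : integ (fun w => q w * Z w).
  apply: i_of => // w; rewrite ger0_norm// /q.
  by case: (leP (- phi w) 0) => h; rewrite ?normr_ge0// -normrN ler_norm.
have -> : (fun w => phi w * Z w) = (fun w => p w * Z w - q w * Z w).
  apply/funext => w; rewrite -mulrBl; congr (_ * _); rewrite /p /q.
  by case: (leP (phi w) 0); case: (leP (- phi w) 0) => h1 h2; lra.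
rewrite RintegralB//; rewrite !ge0_orth//; exact: subrr.
Qed.

End SubSigmaAlgebra.

(** * Uniform directions independent of the past *)

Section SphereLaw.
Context d (T : measurableType d) (R : realType) (P : probability T R) (k : nat).
Local Notation n := k.+1.
Local Notation integ f := (P.-integrable setT (EFin \o f)).
Local Notation Ex f := (Rintegral P setT f).
Hypothesis V0 : (0 < @leb R n (eball 1))%E.
Variables X v : T -> rvB R n.
Hypotheses (mX : measurable_fun setT X) (mv : measurable_fun setT v).
Hypothesis PXv : forall A B : set (rvB R n), measurable A -> measurable B ->
  P (X @^-1` A `&` v @^-1` B) = (P (X @^-1` A) * (unif_sphere B)%:E)%E.

(** By [PXv] the joint law of [(X, v)] is the product of its marginals, so Fubini averages over the
    direction at a fixed position. The bound may depend on [x], since [f] will contain the unbounded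
    gradient. *)
Lemma sphere_law (f : rvB R n -> rvB R n -> R) (C : 'rV[R]_n -> R) :
  measurable_fun setT (fun z : rvB R n * rvB R n => f z.1 z.2) ->
  (forall x s, `|f x s| <= C x) ->
  measurable_fun (setT : set (rvB R n)) (fun x => sphere_avg (f x)) ->
  integ (fun w => f (X w) (v w)) -> integ (fun w => sphere_avg (f (X w))) ->
  Ex (fun w => f (X w) (v w)) = Ex (fun w => sphere_avg (f (X w))).
Proof.
move=> mf fC ms if1 if2.
have mXv : measurable_fun setT (fun w => (X w, v w)) by exact/measurable_fun_pair.
have PvE (B : set (rvB R n)) : measurable B -> push P mv B = (unif_sphere B)%:E.
  move=> mB; have := PXv measurableT mB.
  by rewrite preimage_setT setTI probability_setT mul1e.
have mE : measurable_fun setT (fun z : rvB R n * rvB R n => (f z.1 z.2)%:E).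
  exact/measurable_EFinP.
have fE : (\int[P]_w (f (X w) (v w))%:E = \int[push P mXv]_z (f z.1 z.2)%:E)%E.
  by rewrite /push integral_pushforward ?preimage_setT.
have prodE (A : set (rvB R n * rvB R n)) : measurable A ->
    (push P mX \x push P mv)%E A = push P mXv A.
  apply: product_measure_unique => A1 A2 mA1 mA2.
  transitivity (P (X @^-1` A1) * push P mv A2)%E => //.
  by rewrite (PvE _ mA2) -PXv.
have ifp : (push P mX \x push P mv)%E.-integrable setT (fun z => (f z.1 z.2)%:E).
  apply/integrableP; split => //.
  have -> : (\int[(push P mX \x push P mv)]_z `|(f z.1 z.2)%:E| =
             \int[push P mXv]_z `|(f z.1 z.2)%:E|)%E.
    by apply: eq_measure_integral => A mA _; exact: prodE.
  rewrite (ge0_integral_push P mXv) //; last exact: measurableT_comp.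
  by case/integrableP : if1.
rewrite /Rintegral fE; congr fine.
have -> : (\int[push P mXv]_z (f z.1 z.2)%:E =
           \int[(push P mX \x push P mv)%E]_z (f z.1 z.2)%:E)%E.
  by apply: eq_measure_integral => A mA _; exact/esym/prodE.
rewrite -integral12_prod_meas1//.
have inner x : (\int[push P mv]_s (f x s)%:E = (sphere_avg (f x))%:E)%E.
  have mfx : measurable_fun setT (f x).
    exact: (measurableT_comp mf (measurable_pair1 x)).
  have h : (push P mv).-integrable setT (EFin \o f x).
    apply: (@integ_dom _ _ _ _ _ (fun=> C x)) => //.
    exact: finite_measure_integrable_cst.
  rewrite -(@sphere_measure R k V0 (push P mv) (f x) (C x) PvE mfx)//.
  by rewrite /Rintegral fineK//; exact: integrable_fin_num.
transitivity (\int[push P mX]_x (sphere_avg (f x))%:E)%E.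
  by apply: eq_integral => x _; rewrite -inner.
rewrite /push integral_pushforward ?preimage_setT//.
exact/measurable_EFinP.
Qed.

End SphereLaw.

(** * The smoothed objective *)

Section Constants.
Context {R : realType} {k : nat}.
Local Notation n := k.+1.

Lemma enorm_delta_sub : enorm (delta_mx 0 0 - 0 : 'rV[R]_n) = 1.
Proof. by rewrite subr0 enorm_delta. Qed.

Lemma lipschitzR_const_ge0 L (g : 'rV[R]_n -> R) : e_lipschitzR L g -> 0 <= L.
Proof.
move=> gL; have := gL (delta_mx 0 0) 0; rewrite enorm_delta_sub mulr1.
exact: le_trans.
Qed.

Lemma lipschitz_const_ge0 p L (g : 'rV[R]_n -> 'rV[R]_p) : e_lipschitz L g -> 0 <= L.
Proof.
move=> gL; have := gL (delta_mx 0 0) 0; rewrite enorm_delta_sub mulr1.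
exact/le_trans/enorm_ge0.
Qed.

Lemma lipschitz_measurable p L (g : 'rV[R]_n -> 'rV[R]_p) : e_lipschitz L g ->
  measurable_fun setT (g : rvB R n -> rvB R p).
Proof.
move=> gL; apply/measurable_rvP => j.
apply: continuous_measurable_rv; apply: (@lipschitz_continuous _ _ L) => x x'.
apply: le_trans (gL x x'); apply: le_trans (coord_le_enorm _ j).
by rewrite !mxE.
Qed.

(** With zero volume the normalisation divides by 0 and returns 0, so any nonzero mass forces a
    positive volume. *)
Lemma unif_sphereT_neq0 : unif_sphere (setT : set 'rV[R]_n) != 0 ->
  (0 < leb n (eball 1 : set 'rV[R]_n))%E.
Proof.
rewrite unif_sphereE//; apply: contraNT; rewrite -leNgt => le0.
by rewrite /sphere_avg Rint_ballE (_ : leb n _ = 0%E) ?invr0 ?mulr0//; apply/le_anti/andP; split.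
Qed.

Lemma unif_sphereT : (0 < leb n (eball 1 : set 'rV[R]_n))%E ->
  unif_sphere (setT : set 'rV[R]_n) = 1.
Proof.
move=> V0; rewrite unif_sphereE// /sphere_avg.
under [X in X / _]eq_Rintegral do rewrite indicT mulr1.
by rewrite divff// gt_eqF// ball_vol_gt0.
Qed.

Lemma unif_sphere_unit : unif_sphere ([set s | enorm s = 1] : set 'rV[R]_n) =
  unif_sphere (setT : set 'rV[R]_n).
Proof.
rewrite /unif_sphere; congr ball_avg; apply/funext => u; case: eqVneq => // u0.
by rewrite indicT indicE mem_set//= -/(hat u) enorm_hat.
Qed.

End Constants.

Section Objective.
Context {R : realType} (k m : nat).
Local Notation n := k.+1.
Variables (f1 : 'rV[R]_n -> R) (F : 'I_m -> 'rV[R]_n -> R) (L1 L eta : R).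
Hypotheses (V0 : (0 < leb n (eball 1 : set 'rV[R]_n))%E) (eta0 : 0 < eta) (m0 : (0 < m)%N).
Hypotheses (f1S : e_smooth L1 f1) (FL : forall i, e_lipschitzR L (F i)).

Definition smoothed_objective (x : 'rV[R]_n) : R :=
  f1 x + m%:R^-1 * \sum_(i < m) smoothed (F i) eta x.

Definition smoothed_gradient (x : 'rV[R]_n) : 'rV[R]_n :=
  grad f1 x + m%:R^-1 *: \sum_(i < m) sgrad (F i) eta x.

Let L0 : 0 <= L. Proof. exact: lipschitzR_const_ge0 (FL (Ordinal m0)). Qed.
Let L10 : 0 <= L1. Proof. exact: lipschitz_const_ge0 f1S.2. Qed.

Lemma dot_suml (a : 'I_m -> 'rV[R]_n) b : dot (\sum_(i < m) a i) b = \sum_(i < m) dot (a i) b.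
Proof.
elim/big_rec2: _ => [|i x y _ <-]; last by rewrite dotDl.
by rewrite /dot big1// => j _; rewrite mxE mul0r.
Qed.

Lemma ler_mean (a : 'I_m -> R) c : (forall i, a i <= c) -> m%:R^-1 * \sum_(i < m) a i <= c.
Proof.
move=> ac; rewrite mulrC ler_pdivrMr ?ltr0n//.
apply: le_trans (ler_sum _ (fun i _ => ac i)) _.
by rewrite sumr_const card_ord mulr_natr.
Qed.

Lemma enorm_mean (a : 'I_m -> 'rV[R]_n) c : (forall i, enorm (a i) <= c) ->
  enorm (m%:R^-1 *: \sum_(i < m) a i) <= c.
Proof.
move=> ac; rewrite enormZ ger0_norm ?invr_ge0//.
apply: le_trans (ler_mean ac); rewrite ler_wpM2l ?invr_ge0//; exact: enorm_sum.
Qed.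

Lemma smoothed_objective_taylor : exists2 C, 0 <= C & forall x d,
  `|smoothed_objective (x + d) - smoothed_objective x - dot (smoothed_gradient x) d|
    <= C * enorm d ^+ 2.
Proof.
have /choice[C hC] : forall i, exists C, 0 <= C /\ forall x d,
    `|smoothed (F i) eta (x + d) - smoothed (F i) eta x - dot (sgrad (F i) eta x) d|
      <= C * enorm d ^+ 2.
  by move=> i; have [C C0 hC] := smoothed_taylor V0 eta0 L0 (FL i); exists C.
exists (L1 + m%:R^-1 * \sum_(i < m) C i).
  by rewrite addr_ge0// mulr_ge0 ?invr_ge0// sumr_ge0// => i _; case: (hC i).
move=> x d; rewrite /smoothed_objective /smoothed_gradient dotDl dotZl dot_suml.
set a := grad f1 x.
have -> : f1 (x + d) + m%:R^-1 * \sum_(i < m) smoothed (F i) eta (x + d) -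
   (f1 x + m%:R^-1 * \sum_(i < m) smoothed (F i) eta x) -
   (dot a d + m%:R^-1 * \sum_(i < m) dot (sgrad (F i) eta x) d) =
   (f1 (x + d) - f1 x - dot a d) + m%:R^-1 * \sum_(i < m)
     (smoothed (F i) eta (x + d) - smoothed (F i) eta x - dot (sgrad (F i) eta x) d).
  by rewrite !sumrB; ring.
apply: le_trans (ler_normD _ _) _; rewrite [leRHS]mulrDl; apply: lerD.
  exact: smooth_quad.
rewrite normrM ger0_norm ?invr_ge0// -mulrA ler_wpM2l ?invr_ge0//.
apply: le_trans (ler_norm_sum _ _ _) _; rewrite mulr_suml; apply: ler_sum => i _.
by case: (hC i) => _; exact.
Qed.

Lemma grad_smoothed_objective x : grad smoothed_objective x = smoothed_gradient x.
Proof. by have [C C0 hC] := smoothed_objective_taylor; exact: (grad_quad (hC x)). Qed.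

Lemma smoothed_gradient_le x : enorm (smoothed_gradient x) <=
  enorm (grad f1 0) + n%:R * (n%:R * L) + L1 * enorm x.
Proof.
apply: le_trans (ler_enormD _ _) _; rewrite addrAC; apply: lerD; last first.
  by apply: enorm_mean => i; exact: sgrad_le.
have := f1S.2 x 0; rewrite subr0 => h.
have := ler_enormD (grad f1 x - grad f1 0) (grad f1 0); rewrite subrK => /le_trans; apply.
by rewrite [leLHS]addrC lerD2l.
Qed.

Lemma measurable_sgrad i : measurable_fun setT (sgrad (F i) eta : rvB R n -> rvB R n).
Proof.
apply/measurable_rvP => j; apply: continuous_measurable_rv.
exact: (lipschitz_continuous (sgrad_coord_lip V0 eta0 L0 (FL i) j)).
Qed.

Lemma measurable_smoothed_gradient :
  measurable_fun setT (smoothed_gradient : rvB R n -> rvB R n).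
Proof.
apply: measurable_vecD; first exact: lipschitz_measurable f1S.2.
apply: measurable_vecZ; first exact: measurable_cst.
by apply: measurable_vec_sum => i; exact: measurable_sgrad.
Qed.

Lemma measurable_smoothed_objective :
  measurable_fun (setT : set (rvB R n)) smoothed_objective.
Proof.
apply: measurable_funD.
  by apply: continuous_measurable_rv => x; exact/differentiable_continuous/f1S.1.
apply: measurable_funM => //; apply: measurable_sum => i.
by apply: continuous_measurable_rv; exact: (lipschitz_continuous (smoothed_lip V0 eta0 L0 (FL i))).
Qed.

Lemma smoothed_objective_ge c : (forall x, c <= f1 x + m%:R^-1 * \sum_(i < m) F i x) ->
  forall x, c - L * eta <= smoothed_objective x.
Proof.
move=> hc x; rewrite lerBlDr; apply: le_trans (hc x) _.
rewrite -[leRHS]addrA lerD2l -lerBlDl -mulrBr -sumrB.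
apply: ler_mean => i; rewrite lerBlDr addrC -lerBlDr.
exact: smoothed_ge.
Qed.

End Objective.

(** * Noise and local errors *)

Section ZeroMeanNoise.
Context d (T : measurableType d) (R : realType) (P : probability T R).
Local Notation integ f := (P.-integrable setT (EFin \o f)).
Local Notation Ex f := (Rintegral P setT f).

Lemma Rintegral_sum_ord m (f : 'I_m -> T -> R) : (forall j, integ (f j)) ->
  Ex (fun w => \sum_(j < m) f j w) = \sum_(j < m) Ex (f j).
Proof.
move=> hf; rewrite /Rintegral.
under eq_integral do rewrite -sumEFin.
rewrite integral_sum// sum_fine// => j _; apply: integrable_fin_num => //; exact: hf.
Qed.

Lemma integ_sum_ord m (f : 'I_m -> T -> R) : (forall j, integ (f j)) ->
  integ (fun w => \sum_(j < m) f j w).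
Proof.
move=> hf; have := integrable_sum measurableT (index_enum 'I_m) (P := xpredT) (fun j _ => hf j).
by congr integrable; apply/funext => w /=; rewrite sumEFin.
Qed.

Variable n : nat.
Local Notation vmeas X := (measurable_fun setT (X : T -> rvB R n)).

Lemma integ_dot (X Y : T -> 'rV[R]_n) : vmeas X -> vmeas Y ->
  integ (fun w => enorm (X w) ^+ 2) -> integ (fun w => enorm (Y w) ^+ 2) ->
  integ (fun w => dot (X w) (Y w)).
Proof.
move=> mX mY iX iY.
apply: (@integ_dom _ _ _ _ _ (fun w => enorm (X w) ^+ 2 + enorm (Y w) ^+ 2)).
- exact: measurable_dot.
- exact: integ_add.
- move=> w; apply: le_trans (dot_le_enorm _ _) _.
  by have := enorm_ge0 (X w); have := enorm_ge0 (Y w); nra.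
Qed.

Lemma integ_enorm_sqr_affine (a b : R) (X Y : T -> 'rV[R]_n) : vmeas Y -> 0 <= a -> 0 <= b ->
  (forall w, enorm (Y w) <= a + b * enorm (X w)) ->
  integ (fun w => enorm (X w) ^+ 2) -> integ (fun w => enorm (Y w) ^+ 2).
Proof.
move=> mY a0 b0 hY iX.
apply: (@integ_dom _ _ _ _ _ (fun w => 2 * a ^+ 2 + (2 * b ^+ 2) * enorm (X w) ^+ 2)).
- by apply: measurable_funX; exact: measurable_enormT.
- apply: integ_add; last exact: integ_scale.
  exact: finite_measure_integrable_cst.
- move=> w; rewrite ger0_norm ?sqr_ge0//.
  apply: (@le_trans _ _ ((a + b * enorm (X w)) ^+ 2)).
    by rewrite ler_pXn2r ?nnegrE ?enorm_ge0// (le_trans (enorm_ge0 (Y w))).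
  have := sqr_ge0 (a - b * enorm (X w)); nra.
Qed.

Lemma noise_mean (G : set (set T)) (sG : sigma_algebra setT G) (Gm : G `<=` measurable)
    (X Z : T -> 'rV[R]_n) :
  measurable_fun (setT : set (g_sigma_algebraType G)) (X : g_sigma_algebraType G -> rvB R n) ->
  vmeas Z -> integ (fun w => enorm (X w) ^+ 2) -> integ (fun w => enorm (Z w) ^+ 2) ->
  (forall A (j : 'I_n), G A -> (\int[P]_(w in A) (Z w 0 j)%:E = 0)%E) ->
  Ex (fun w => dot (X w) (Z w)) = 0.
Proof.
move=> mXG mZ iX iZ Z0.
have mX : vmeas X by apply: (sub_measurable_fun sG Gm); exact: mXG.
have iXZ j : integ (fun w => X w 0 j * Z w 0 j).
  apply: (@integ_dom _ _ _ _ _ (fun w => enorm (X w) ^+ 2 + enorm (Z w) ^+ 2)).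
  - by apply: measurable_funM; [move/measurable_rvP : mX|move/measurable_rvP : mZ].
  - exact: integ_add.
  - move=> w; rewrite normrM; apply: le_trans (ler_pM _ _ (coord_le_enorm _ j) (coord_le_enorm _ j)) _ => //.
    by have := enorm_ge0 (X w); have := enorm_ge0 (Z w); nra.
have iZj j : integ (fun w => Z w 0 j).
  apply: (@integ_dom _ _ _ _ _ (fun w => 1 + enorm (Z w) ^+ 2)).
  - by move/measurable_rvP : mZ.
  - apply: integ_add => //; exact: finite_measure_integrable_cst.
  - move=> w; apply: le_trans (coord_le_enorm (Z w) j) _.
    have := sqr_ge0 (enorm (Z w) - 1); nra.
rewrite /dot Rintegral_sum_ord// big1// => j _.
apply: (orth sG Gm (iZj j)) => //.
- by move=> A GA; exact: Z0.
- by move/measurable_rvP : mXG.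
Qed.

End ZeroMeanNoise.

(** * Noise of the sampled directions *)

Section SamplingNoise.
Context {R : realType} {k : nat}.
Local Notation n := k.+1.

Lemma hat_idem (z : 'rV[R]_n) : hat (hat z) = hat z.
Proof.
have [->|z0] := eqVneq z 0; first by rewrite !hat0.
by rewrite {1}/hat enorm_hat// invr1 scale1r.
Qed.

Lemma sphere_avg_hat (f : 'rV[R]_n -> R) : sphere_avg (fun s => f (hat s)) = sphere_avg f.
Proof. by rewrite /sphere_avg; under eq_fun do rewrite hat_idem. Qed.

Context d (T : measurableType d) (P : probability T R).
Local Notation integ f := (P.-integrable setT (EFin \o f)).
Local Notation Ex f := (Rintegral P setT f).
Local Notation vmeas X := (measurable_fun setT (X : T -> rvB R n)).
Variables (F : 'rV[R]_n -> R) (L eta : R) (gr : 'rV[R]_n -> 'rV[R]_n) (X v : T -> 'rV[R]_n).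
Hypotheses (V0 : (0 < leb n (eball 1 : set 'rV[R]_n))%E) (eta0 : 0 < eta).
Hypotheses (FL : e_lipschitzR L F).
Hypothesis mgr : measurable_fun setT (gr : rvB R n -> rvB R n).
Hypotheses (mX : vmeas X) (mv : vmeas v).

(* The radial projection [hat] changes nothing almost surely, since [v] lies on
   the sphere, but makes the noise bounded everywhere. *)
Definition sample_noise w :=
  two_point F eta (X w) (hat (v w)) *: hat (v w) - sgrad F eta (X w).

Let L0 : 0 <= L. Proof. exact: lipschitzR_const_ge0 FL. Qed.

Let mF : measurable_fun (setT : set (rvB R n)) F.
Proof. by apply: continuous_measurable_rv; exact: lipschitz_continuous FL. Qed.

Lemma measurable_two_point_pair d' (T' : measurableType d') (A B : T' -> rvB R n) :
  measurable_fun setT A -> measurable_fun setT B ->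
  measurable_fun setT (fun w => two_point F eta (A w) (B w)).
Proof.
move=> mA mB; apply: measurable_funM => //; apply: measurable_funB.
  apply: (measurableT_comp mF); apply: measurable_vecD => //.
  by apply: measurable_vecZ.
apply: (measurableT_comp mF); apply: measurable_vecB => //.
by apply: measurable_vecZ.
Qed.

Let mhatv : vmeas (fun w => hat (v w)).
Proof. exact: (measurableT_comp (@measurable_hat R k) mv). Qed.

Let msg : measurable_fun setT (sgrad F eta : rvB R n -> rvB R n).
Proof.
apply/measurable_rvP => j; apply: continuous_measurable_rv.
exact: (lipschitz_continuous (sgrad_coord_lip V0 eta0 L0 FL j)).
Qed.

Lemma measurable_sample_noise : vmeas sample_noise.
Proof.
apply: measurable_vecB; last exact: (measurableT_comp msg mX).
by apply: measurable_vecZ => //; exact: measurable_two_point_pair.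
Qed.

Let scaled_le x s : enorm (two_point F eta x (hat s) *: hat s) <= n%:R * L.
Proof.
rewrite enormZ; have := two_point_le eta0 FL x (hat s).
have h1 := enorm_hat_le1 s; have h0 := enorm_ge0 (hat s).
have : 0 <= n%:R * L by rewrite mulr_ge0.
move: (normr_ge0 (two_point F eta x (hat s))).
move: `|_| (n%:R * L) => t c t0 c0 ht.
move: (enorm _) h0 h1 ht => e h0 h1 ht; nra.
Qed.

Lemma sample_noise_le w : enorm (sample_noise w) <= n%:R * L + n%:R * (n%:R * L).
Proof.
by apply: le_trans (ler_enormB _ _) _; apply: lerD; [exact: scaled_le|exact: sgrad_le].
Qed.

Hypothesis PXv : forall A B : set (rvB R n), measurable A -> measurable B ->
  P (X @^-1` A `&` v @^-1` B) = (P (X @^-1` A) * (unif_sphere B)%:E)%E.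

(** At a fixed position the average over the directions is [sgrad] itself, so by [sphere_law] both
    halves of the noise have the same expectation against [gr (X w)]. *)
Lemma sample_noise_mean : integ (fun w => enorm (gr (X w)) ^+ 2) ->
  Ex (fun w => dot (gr (X w)) (sample_noise w)) = 0.
Proof.
move=> igr.
have mgrX : vmeas (fun w => gr (X w)) by exact: (measurableT_comp mgr mX).
have nL : 0 <= n%:R * L by rewrite mulr_ge0.
pose f (x s : 'rV[R]_n) := two_point F eta x (hat s) * dot (hat s) (gr x).
have fE x : sphere_avg (f x) = dot (sgrad F eta x) (gr x).
  rewrite (sphere_avg_hat (fun s => two_point F eta x s * dot s (gr x))).
  rewrite -(@sphere_avg_dot _ _ _ (n%:R * L))//; first exact: measurable_two_point FL _.
  move=> z; apply: le_trans (two_point_le eta0 FL _ _) _.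
  by rewrite -[leRHS]mulr1 ler_wpM2l// enorm_hat_le1.
have idot (Y : T -> 'rV[R]_n) c : vmeas Y -> (forall w, enorm (Y w) <= c) ->
    integ (fun w => dot (Y w) (gr (X w))).
  move=> mY Yc; apply: integ_dot => //.
  apply: (@integ_dom _ _ _ _ _ (fun=> c ^+ 2)).
  - by apply: measurable_funX; exact: measurable_enormT.
  - exact: finite_measure_integrable_cst.
  - by move=> w; rewrite ger0_norm ?sqr_ge0// ler_pXn2r ?nnegrE ?enorm_ge0// (le_trans (enorm_ge0 (Y w))).
have fn w : f (X w) (v w) = dot (two_point F eta (X w) (hat (v w)) *: hat (v w)) (gr (X w)).
  by rewrite dotZl.
have i2 : integ (fun w => sphere_avg (f (X w))).
  have -> : (fun w => sphere_avg (f (X w))) = (fun w => dot (sgrad F eta (X w)) (gr (X w))).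
    by apply/funext => w; exact: fE.
  apply: idot; first exact: (measurableT_comp msg mX).
  by move=> w; exact: (sgrad_le V0 eta0 L0 FL).
have i1 : integ (fun w => f (X w) (v w)).
  rewrite (_ : (fun w => f (X w) (v w)) = (fun w => dot (two_point F eta (X w) (hat (v w)) *: hat (v w)) (gr (X w)))); last exact/funext.
  apply: idot; first by apply: measurable_vecZ => //; exact: measurable_two_point_pair.
  by move=> w; exact: scaled_le.
have -> : (fun w => dot (gr (X w)) (sample_noise w)) =
    (fun w => f (X w) (v w) - sphere_avg (f (X w))).
  by apply/funext => w; rewrite fE /f /sample_noise dotDr dotNr dotZr ![dot (gr _) _]dotC.
rewrite RintegralB//; rewrite (sphere_law V0 mX mv PXv (C := fun x => n%:R * L * enorm (gr x)))//.
- exact: subrr.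
- apply: measurable_funM.
    apply: measurable_two_point_pair => //.
    exact: (measurableT_comp (@measurable_hat R k) measurable_snd).
  apply: measurable_dot.
    exact: (measurableT_comp (@measurable_hat R k) measurable_snd).
  exact: (measurableT_comp mgr measurable_fst).
- move=> x s; rewrite /f -dotZl; apply: le_trans (dot_le_enorm _ _) _.
  by rewrite ler_wpM2r ?enorm_ge0.
- have := measurable_dot msg mgr; congr measurable_fun; apply/funext => x; exact/esym/fE.
Qed.

End SamplingNoise.

(** * Error of the inexact local solutions *)

Section LocalError.
Context {R : realType} {k : nat} d (T : measurableType d) (P : probability T R).
Local Notation n := k.+1.
Local Notation integ f := (P.-integrable setT (EFin \o f)).
Local Notation Ex f := (Rintegral P setT f).
Local Notation vmeas X := (measurable_fun setT (X : T -> rvB R n)).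
Variables (f2 : 'rV[R]_n -> 'rV[R]_n -> R) (L L1 L2 eta : R).
Hypotheses (eta0 : 0 < eta).
Hypotheses (f2L1 : forall y, e_lipschitzR L1 (fun x => f2 x y))
  (f2L2 : forall x, e_lipschitzR L2 (f2 x)).

Let L10 : 0 <= L1. Proof. exact: lipschitzR_const_ge0 (f2L1 0). Qed.
Let L20 : 0 <= L2. Proof. exact: lipschitzR_const_ge0 (f2L2 0). Qed.

Lemma value_gap_sq (y : 'rV[R]_n -> 'rV[R]_n) (A Y : T -> 'rV[R]_n) (e : R) :
  e_lipschitzR L (fun x => f2 x (y x)) -> vmeas A -> vmeas Y ->
  (\int[P]_w (enorm (Y w - y (A w)) ^+ 2)%:E <= e%:E)%E ->
  let p w := (f2 (A w) (Y w) - f2 (A w) (y (A w))) ^+ 2 in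
  integ p /\ Ex p <= L2 ^+ 2 * e.
Proof.
move=> FL mA mY hY p.
(* The composite is Lipschitz in [x], hence measurable whatever [y] is. *)
have mF : measurable_fun setT (fun w => f2 (A w) (y (A w))).
  exact: (measurableT_comp (continuous_measurable_rv (lipschitz_continuous FL)) mA).
have mp : measurable_fun setT p.
  apply: measurable_funX; apply: measurable_funB => //.
  exact: (measurable_separately_lipschitz L10 L20 f2L1 f2L2 mA mY).
have pL w : p w <= L2 ^+ 2 * enorm (Y w - y (A w)) ^+ 2.
  have h := f2L2 (A w) (Y w) (y (A w)).
  by rewrite -exprMn /p -real_normK ?num_real// ler_pXn2r ?nnegrE// mulr_ge0 ?enorm_ge0.
(* [y] need not be measurable, so the hypothesis bounds a lower integral, out of
   which the factor [L2 ^+ 2] is not moved: it is divided out of [p] instead. *)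
have [L2z|L2z] := eqVneq L2 0.
  have -> : p = fun=> 0.
    apply/funext => w; apply/le_anti; rewrite sqr_ge0 andbT.
    by apply: le_trans (pL w) _; rewrite L2z expr0n mul0r.
  split; first exact: finite_measure_integrable_cst.
  by rewrite Rintegral_cst// L2z expr0n !mul0r.
have L2s : 0 < L2 ^+ 2 by rewrite exprn_gt0// lt_def L2z.
have [i1 e1] : integ (fun w => (L2 ^+ 2)^-1 * p w) /\ Ex (fun w => (L2 ^+ 2)^-1 * p w) <= e.
  apply: ge0_integ.
  - exact: measurable_funM.
  - by move=> w; rewrite mulr_ge0 ?invr_ge0 ?sqr_ge0.
  - apply: le_trans hY; apply: ge0_le_integral_lower => w; rewrite lee_fin.
      by rewrite mulr_ge0 ?invr_ge0 ?sqr_ge0.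
    by rewrite ler_pdivrMl.
have pE : p = fun w => L2 ^+ 2 * ((L2 ^+ 2)^-1 * p w).
  by apply/funext => w; rewrite mulVKf// gt_eqF.
rewrite pE; split; first exact: integ_scale.
by rewrite RintegralZl// ler_wpM2l// ltW.
Qed.

(** The exact difference is taken at [hat (v w)] so that it cancels against the leading term of
    [sample_noise]. *)
Definition local_error (y : 'rV[R]_n -> 'rV[R]_n) (X v yp ym : T -> 'rV[R]_n) w :=
  (n%:R / (2 * eta) * (f2 (X w + eta *: v w) (yp w) - f2 (X w - eta *: v w) (ym w))) *: v w
  - two_point (fun x => f2 x (y x)) eta (X w) (hat (v w)) *: hat (v w).

Lemma local_error_sq_le y X v yp ym w : enorm (v w) = 1 ->
  enorm (local_error y X v yp ym w) ^+ 2 <= 2 * (n%:R / (2 * eta)) ^+ 2 *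
    ((f2 (X w + eta *: v w) (yp w) - f2 (X w + eta *: v w) (y (X w + eta *: v w))) ^+ 2 +
     (f2 (X w - eta *: v w) (ym w) - f2 (X w - eta *: v w) (y (X w - eta *: v w))) ^+ 2).
Proof.
move=> v1; rewrite /local_error.
have -> : hat (v w) = v w by rewrite /hat v1 invr1 scale1r.
rewrite -scalerBl enormZ v1 mulr1 real_normK ?num_real// /two_point -mulrBr.
move: (_ / _) => c; set a := f2 _ (yp w); set b := f2 _ (ym w); set a' := f2 _ (y _); set b' := f2 _ (y _).
have -> : a - b - (a' - b') = (a - a') - (b - b') by ring.
move: (a - a') (b - b') => s t; rewrite [leLHS]exprMn [leRHS](_ : _ = c ^+ 2 * (2 * (s ^+ 2 + t ^+ 2))); last by ring.
apply: ler_wpM2l; first exact: sqr_ge0.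
have := sqr_ge0 (s + t); nra.
Qed.

(** The sum of squared deviations from the mean is nonnegative. *)
Lemma sqr_mean_le m (a : 'I_m -> R) : (0 < m)%N ->
  (m%:R^-1 * \sum_(i < m) a i) ^+ 2 <= m%:R^-1 * \sum_(i < m) a i ^+ 2.
Proof.
move=> m0; set A := m%:R^-1 * _.
have mA : \sum_(i < m) a i = m%:R * A by rewrite mulVKf// pnatr_eq0 -lt0n.
have h : 0 <= \sum_(i < m) (a i - A) ^+ 2 by apply: sumr_ge0 => i _; exact: sqr_ge0.
have e : \sum_(i < m) (a i - A) ^+ 2 = \sum_(i < m) a i ^+ 2 - m%:R * A ^+ 2.
  have -> : \sum_(i < m) (a i - A) ^+ 2 = \sum_(i < m) (a i ^+ 2 - 2 * A * a i + A ^+ 2).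
    by apply: eq_bigr => i _; ring.
  rewrite big_split/= sumrB -mulr_sumr mA sumr_const card_ord.
  by rewrite -[A ^+ 2 *+ m]mulr_natl; ring.
by rewrite ler_pdivlMl ?ltr0n// -subr_ge0 -e.
Qed.

Lemma enorm_mean_sq_le m (a : 'I_m -> 'rV[R]_n) : (0 < m)%N ->
  enorm (m%:R^-1 *: \sum_(i < m) a i) ^+ 2 <= m%:R^-1 * \sum_(i < m) enorm (a i) ^+ 2.
Proof.
move=> m0; apply: le_trans (sqr_mean_le (fun i => enorm (a i)) m0).
have h : enorm (m%:R^-1 *: \sum_(i < m) a i) <= m%:R^-1 * \sum_(i < m) enorm (a i).
  by rewrite enormZ ger0_norm ?invr_ge0// ler_wpM2l ?invr_ge0// enorm_sum.
by rewrite ler_pXn2r ?nnegrE ?enorm_ge0// (le_trans (enorm_ge0 _) h).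
Qed.

Variables (m : nat) (y : 'I_m -> 'rV[R]_n -> 'rV[R]_n) (X : T -> 'rV[R]_n)
  (v yp ym : 'I_m -> T -> 'rV[R]_n) (e : 'I_m -> R).
Hypotheses (m0 : (0 < m)%N) (FL : forall i, e_lipschitzR L (fun x => f2 x (y i x))).
Hypotheses (mX : vmeas X) (mv : forall i, vmeas (v i)) (myp : forall i, vmeas (yp i))
  (mym : forall i, vmeas (ym i)).
Hypothesis v1 : forall i, {ae P, forall w, enorm (v i w) = 1}.
Hypotheses
  (hyp : forall i, (\int[P]_w (enorm (yp i w - y i (X w + eta *: v i w)) ^+ 2)%:E <= (e i)%:E)%E)
  (hym : forall i, (\int[P]_w (enorm (ym i w - y i (X w - eta *: v i w)) ^+ 2)%:E <= (e i)%:E)%E).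

Let mXp i : vmeas (fun w => X w + eta *: v i w).
Proof. by apply: measurable_vecD => //; exact: measurable_vecZ. Qed.

Let mXm i : vmeas (fun w => X w - eta *: v i w).
Proof. by apply: measurable_vecB => //; exact: measurable_vecZ. Qed.

Lemma measurable_local_error i : vmeas (local_error (y i) X (v i) (yp i) (ym i)).
Proof.
have mh : vmeas (fun w => hat (v i w)) by exact: (measurableT_comp (@measurable_hat R k) (mv i)).
apply: measurable_vecB; apply: measurable_vecZ => //.
  apply: measurable_funM => //; apply: measurable_funB.
    exact: (measurable_separately_lipschitz L10 L20 f2L1 f2L2 (mXp i) (myp i)).
  exact: (measurable_separately_lipschitz L10 L20 f2L1 f2L2 (mXm i) (mym i)).
exact: (measurable_two_point_pair _ (FL i) mX mh).
Qed.

(** The factor 4 is 2 from the square of a difference times 2 for the plus and minus solves. Unit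
    length of the directions holds only almost surely, for the finitely many clients at once. *)
Lemma mean_local_error_sq :
  (\int[P]_w (enorm (m%:R^-1 *: \sum_(i < m) local_error (y i) X (v i) (yp i) (ym i) w) ^+ 2)%:E
   <= ((n%:R / (2 * eta)) ^+ 2 * 4 * L2 ^+ 2 * (m%:R^-1 * \sum_(i < m) e i))%:E)%E.
Proof.
pose p i w := (f2 (X w + eta *: v i w) (yp i w) -
  f2 (X w + eta *: v i w) (y i (X w + eta *: v i w))) ^+ 2.
pose q i w := (f2 (X w - eta *: v i w) (ym i w) -
  f2 (X w - eta *: v i w) (y i (X w - eta *: v i w))) ^+ 2.
pose c : R := 2 * (n%:R / (2 * eta)) ^+ 2.
have c0 : 0 <= c by rewrite mulr_ge0 ?sqr_ge0.
have hp i := value_gap_sq (FL i) (mXp i) (myp i) (hyp i).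
have hq i := value_gap_sq (FL i) (mXm i) (mym i) (hym i).
have ipq i : integ (fun w => c * (p i w + q i w)).
  by apply: integ_scale; apply: integ_add; [case: (hp i)|case: (hq i)].
have isum0 : integ (fun w => \sum_(i < m) (c * (p i w + q i w))) by exact: integ_sum_ord.
have isum := integ_scale m%:R^-1 isum0.
apply: (@le_trans _ _ (\int[P]_w (m%:R^-1 * \sum_(i < m) (c * (p i w + q i w)))%:E)%E).
  apply: ae_ge0_le_integral => //.
  - by move=> w _; rewrite lee_fin sqr_ge0.
  - apply/measurable_EFinP; apply: measurable_funX; apply: measurable_enormT.
    by apply: measurable_vecZ => //; apply: measurable_vec_sum => i; exact: measurable_local_error.
  - move=> w _; rewrite lee_fin mulr_ge0 ?invr_ge0// sumr_ge0// => i _.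
    by rewrite mulr_ge0// addr_ge0 ?sqr_ge0.
  - exact: measurable_int isum.
  have ae1 : {ae P, forall w, forall i, enorm (v i w) = 1}.
    exact: filter_forall.
  apply: filterS ae1 => w hw _; rewrite lee_fin; apply: le_trans (enorm_mean_sq_le _ m0) _.
  rewrite ler_wpM2l ?invr_ge0//; apply: ler_sum => i _.
  exact: local_error_sq_le.
have -> : (\int[P]_w (m%:R^-1 * \sum_(i < m) (c * (p i w + q i w)))%:E =
   (Ex (fun w => m%:R^-1 * \sum_(i < m) (c * (p i w + q i w)))%R)%:E)%E.
  by rewrite /Rintegral fineK//; exact: integrable_fin_num isum.
rewrite lee_fin RintegralZl//; rewrite Rintegral_sum_ord// [leRHS]mulrCA ler_wpM2l ?invr_ge0// mulr_sumr.
apply: ler_sum => i _; have [ip pe] := hp i; have [iq qe] := hq i.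
rewrite RintegralZl//; last exact: integ_add.
rewrite RintegralD//.
apply: (@le_trans _ _ (c * (L2 ^+ 2 * e i + L2 ^+ 2 * e i))).
  by rewrite ler_wpM2l// lerD.
by rewrite /c le_eqVlt; apply/orP; left; apply/eqP; ring.
Qed.

End LocalError.

(** * The zeroth-order method *)

Theorem theorem2
  (R : realType) (m n : nat) (hm : (0 < m)%N) (hn : (0 < n)%N)
  (eta : R) (heta : 0 < eta)
  (* constants of Assumption A *)
  (L0imp L0xf2 L0yf2 L1f1 sigma : R)
  (L1yh L0xgh mu : 'I_m -> R)
  (* problem data *)
  (f1 : 'rV[R]_n -> R) (f2 : 'rV[R]_n -> 'rV[R]_n -> R)
  (h : 'I_m -> 'rV[R]_n -> 'rV[R]_n -> R)
  (Y : 'I_m -> 'rV[R]_n -> set 'rV[R]_n)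
  (y : 'I_m -> 'rV[R]_n -> 'rV[R]_n)
  (* y_i(x) = argmin_{y in Y_i(x)} h_i(x, y) *)
  (hy : forall i x, Y i x (y i x) /\
          (forall z, Y i x z -> h i x (y i x) <= h i x z))
  (* the problem min_x f(x) has a finite optimal value *)
  (hbnd : exists fstar : R, forall x,
            fstar <= f1 x + m%:R^-1 * \sum_(i < m) f2 x (y i x))
  (* Assumption A(i) *)
  (hA1a : forall i, e_lipschitzR L0imp (fun x => f2 x (y i x)))
  (hA1b : forall yy, e_lipschitzR L0xf2 (fun x => f2 x yy))
  (hA1c : forall x, e_lipschitzR L0yf2 (f2 x))
  (* Assumption A(ii), deterministic part *)
  (hA2a : forall i x, e_smooth (L1yh i) (h i x))
  (hA2b : forall i, 0 < mu i)
  (hA2c : forall i x, e_strongly_convex (mu i) (h i x))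
  (hA2d : forall i yy, e_lipschitz (L0xgh i) (fun x => grad (h i x) yy))
  (* Assumption A(iii), deterministic part *)
  (hA3 : e_smooth L1f1 f1)
  (* Assumption A(iv) *)
  (hA4 : forall i x, Y i x !=set0 /\ closed (Y i x) /\ e_convex_set (Y i x))
  (* probability space, filtration and sample space of xi *)
  (d : measure_display) (Omega : measurableType d) (P : probability Omega R)
  (dX : measure_display) (Xi : measurableType dX)
  (F : nat -> set (set Omega))
  (hF1 : forall r, sigma_algebra setT (F r))
  (hF2 : forall r, F r `<=` measurable)
  (hF3 : forall r, F r `<=` F r.+1)
  (* the method ZO-HFL *)
  (x0 : 'rV[R]_n) (gamma : nat -> R) (eps : 'I_m -> nat -> R)
  (G1 : 'rV[R]_n -> Xi -> 'rV[R]_n) (* stochastic gradient of f_1 *)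
  (xi : nat -> Omega -> Xi)
  (v : 'I_m -> nat -> Omega -> 'rV[R]_n)
  (yp ym : 'I_m -> nat -> Omega -> 'rV[R]_n)
  (xhat : nat -> Omega -> 'rV[R]_n)
  (hx0 : xhat 0%N = fun _ => x0)
  (hxS : forall r w, xhat r.+1 w =
     xhat r w - gamma r *: (G1 (xhat r w) (xi r w)
       + m%:R^-1 *: \sum_(i < m)
           ((n%:R / (2 * eta) *
              (f2 (xhat r w + eta *: v i r w) (yp i r w)
               - f2 (xhat r w - eta *: v i r w) (ym i r w))) *: v i r w)))
  (* round-r randomness is revealed by time r+1 *)
  (hmxi : forall r B, measurable B -> F r.+1 (xi r @^-1` B))
  (hmG : forall r, rv_meas (F r.+1) (fun w => G1 (xhat r w) (xi r w)))
  (hmv : forall i r, rv_meas (F r.+1) (v i r))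
  (hmyp : forall i r, rv_meas (F r.+1) (yp i r))
  (hmym : forall i r, rv_meas (F r.+1) (ym i r))
  (* v_{1,r}, ..., v_{m,r} i.i.d. uniform on the unit sphere, independent of F_r *)
  (hv : forall r (A : set Omega) (B : 'I_m -> set 'rV[R]_n), F r A ->
          (forall i, rv_borel (B i)) ->
          P (A `&` \bigcap_(i in [set: 'I_m]) (v i r @^-1` B i)) =
          (P A * (\prod_(i < m) unif_sphere (B i))%:E)%E)
  (* Assumption A(iii), stochastic part: unbiasedness and variance bound,
     conditionally on the past F_r *)
  (hG1 : forall r (A : set Omega) (j : 'I_n), F r A ->
     (\int[P]_(w in A) ((G1 (xhat r w) (xi r w) - grad f1 (xhat r w)) 0 j)%:E
       = 0)%E)
  (hG2 : forall r (A : set Omega), F r A ->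
     (\int[P]_(w in A)
        ((enorm (G1 (xhat r w) (xi r w) - grad f1 (xhat r w))) ^+ 2)%:E
      <= (sigma ^+ 2)%:E * P A)%E)
  (* accuracy of the local outputs *)
  (hyp : forall i r, (\int[P]_w
      ((enorm (yp i r w - y i (xhat r w + eta *: v i r w))) ^+ 2)%:E
      <= (eps i r)%:E)%E)
  (hym : forall i r, (\int[P]_w
      ((enorm (ym i r w - y i (xhat r w - eta *: v i r w))) ^+ 2)%:E
      <= (eps i r)%:E)%E)
  (* step sizes *)
  (hg0 : forall r, 0 <= gamma r)
  (hg1 : forall r,
      gamma r * (4 * (eta * L1f1 + L0imp * Num.sqrt n%:R)) <= eta)
  (hg2 : series gamma @ \oo --> +oo)
  (hg3 : cvgn (series (fun r => gamma r ^+ 2)))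
  (he0 : forall r, 0 <= gamma r * (m%:R^-1 * \sum_(i < m) eps i r))
  (he1 : cvgn (series (fun r => gamma r * (m%:R^-1 * \sum_(i < m) eps i r)))) :
  {ae P, forall w,
     limn_einf (fun r => (enorm (grad (f_eta eta f1 f2 y) (xhat r w)))%:E)
     = 0%E}.

Proof.
destruct n as [|k]; first by [].
pose Fi i x := f2 x (y i x).
have L00 : 0 <= L0imp by exact: lipschitzR_const_ge0 (hA1a (Ordinal hm)).
have L1f0 : 0 <= L1f1 by exact: lipschitz_const_ge0 hA3.2.
have FT r : F r setT.
  by case: (hF1 r) => F0 FC _; rewrite -(setD0 setT); exact: FC.
(* With every event equal to the whole space, the law of the directions says that the total mass has
   [m]-th power 1. Hence it is nonzero, and the ball has positive volume. *)
have UT1 : unif_sphere (setT : set 'rV[R]_k.+1) ^+ m = 1.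
  have := hv 0%N setT (fun=> setT) (FT 0%N) (fun _ => @measurableT _ (rvB R k.+1)).
  rewrite (_ : \bigcap_(i in _) _ = setT); last by apply/seteqP; split.
  rewrite setIT probability_setT mul1e prodr_const card_ord => /esym.
  by case.
have V0 : (0 < @leb R k.+1 (eball 1))%E.
  apply: unif_sphereT_neq0; apply/eqP => U0; move: UT1; rewrite U0 expr0n.
  by move/eqP; rewrite gtn_eqF// eq_sym oner_eq0.
have {}UT1 := unif_sphereT V0.
(* The marginal law of one direction: the other sets are the whole space, of mass 1. *)
have hv1 i r (A : set Omega) (B : set 'rV[R]_k.+1) : F r A -> rv_borel B ->
    P (A `&` v i r @^-1` B) = (P A * (unif_sphere B)%:E)%E.
  move=> FA mB; have := hv r A (fun j => if j == i then B else setT) FA.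
  rewrite (_ : \bigcap_(j in _) _ = v i r @^-1` B); last first.
    apply/seteqP; split => [w /(_ i I)|w wB j _ /=]; first by rewrite /= eqxx.
    by case: eqP => [->|].
  rewrite (bigD1 i)//= eqxx big1 ?mulr1 => [|j /negPf ->//]; apply.
  by move=> j; case: (j == i) => //; exact: (@measurableT _ (rvB R k.+1)).
have mof r p (X : Omega -> 'rV[R]_p) : rv_meas (F r) X ->
    measurable_fun setT (X : Omega -> rvB R p).
  by move=> /(rv_meas_measurable (hF1 r))/(sub_measurable_fun (hF1 r) (hF2 r)).
have mv i r : measurable_fun setT (v i r : Omega -> rvB R k.+1) by exact: mof (hmv i r).
have myp i r : measurable_fun setT (yp i r : Omega -> rvB R k.+1) by exact: mof (hmyp i r).
have mym i r : measurable_fun setT (ym i r : Omega -> rvB R k.+1) by exact: mof (hmym i r).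
have L20 : 0 <= L0yf2 by exact: lipschitzR_const_ge0 (hA1c 0).
have L30 : 0 <= L0xf2 by exact: lipschitzR_const_ge0 (hA1b 0).
(* The iterate of round [r] is known at time [r], whereas the randomness of that round is revealed
   at time [r.+1]. This shift puts the gradient at [xhat r] in the past of the noises. *)
have xF r : rv_meas (F r) (xhat r).
  elim: r => [|r IH].
    by apply/(rv_meas_measurable (hF1 0%N)); rewrite hx0; exact: measurable_cst.
  apply/(rv_meas_measurable (hF1 r.+1)).
  have mx : rv_meas (F r.+1) (xhat r) by move=> B mB; apply: hF3; exact: IH.
  move/(rv_meas_measurable (hF1 r.+1)) : mx => mx.
  have /(rv_meas_measurable (hF1 r.+1)) mg := hmG r.
  have mvF i : measurable_fun setT (v i r : g_sigma_algebraType (F r.+1) -> rvB R k.+1).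
    by apply/rv_meas_measurable => //; exact: hF1.
  have mpF i : measurable_fun setT (yp i r : g_sigma_algebraType (F r.+1) -> rvB R k.+1).
    by apply/rv_meas_measurable => //; exact: hF1.
  have mmF i : measurable_fun setT (ym i r : g_sigma_algebraType (F r.+1) -> rvB R k.+1).
    by apply/rv_meas_measurable => //; exact: hF1.
  rewrite (funext (hxS r)).
  apply: measurable_vecB => //; apply: measurable_vecZ => //.
  apply: measurable_vecD => //; apply: measurable_vecZ => //.
  apply: measurable_vec_sum => i; apply: measurable_vecZ => //.
  apply: measurable_funM => //; apply: measurable_funB.
    apply: (measurable_separately_lipschitz L30 L20 hA1b hA1c) => //.
    by apply: measurable_vecD => //; exact: measurable_vecZ.
  apply: (measurable_separately_lipschitz L30 L20 hA1b hA1c) => //.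
  by apply: measurable_vecB => //; exact: measurable_vecZ.
have mx r : measurable_fun setT (xhat r : Omega -> rvB R k.+1) by exact: mof (xF r).
have mxF r : measurable_fun setT (xhat r : g_sigma_algebraType (F r) -> rvB R k.+1).
  by apply/rv_meas_measurable; [exact: hF1|exact: xF].
have v1 i r : {ae P, forall w, enorm (v i r w) = 1}.
  have mB : measurable ([set s | enorm s = 1] : set (rvB R k.+1)).
    have := @measurable_enorm R k.+1 measurableT _ (measurable_set1 1).
    by rewrite setTI.
  have mvB : measurable (v i r @^-1` [set s | enorm s = 1]).
    by have := mv i r measurableT _ mB; rewrite setTI.
  exists (~` (v i r @^-1` [set s | enorm s = 1])); split => //.
    exact: measurableC.
  rewrite probability_setC//.
  have := hv1 i r setT _ (FT r) mB; rewrite setTI => ->.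
  by rewrite unif_sphere_unit UT1 probability_setT mule1 subee.
(* [f_eta] unfolds to [smoothed_objective] for the functions [Fi], so its gradient is already
   computed. *)
have -> : grad (f_eta eta f1 f2 y) = smoothed_gradient f1 Fi eta.
  apply/funext => x; exact: (grad_smoothed_objective V0 heta hm hA3 hA1a).
pose Z r w := G1 (xhat r w) (xi r w) - grad f1 (xhat r w).
pose U r w := m%:R^-1 *: \sum_(i < m) sample_noise (Fi i) eta (xhat r) (v i r) w.
pose E r w := m%:R^-1 *: \sum_(i < m)
  local_error f2 eta (y i) (xhat r) (v i r) (yp i r) (ym i r) w.
have mgf1 : measurable_fun setT (grad f1 : rvB R k.+1 -> rvB R k.+1).
  exact: lipschitz_measurable hA3.2.
have mgr : measurable_fun setT (smoothed_gradient f1 Fi eta : rvB R k.+1 -> rvB R k.+1).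
  exact: (measurable_smoothed_gradient V0 heta hm hA3 hA1a).
have gr_le x : enorm (smoothed_gradient f1 Fi eta x) <=
    enorm (grad f1 0) + k.+1%:R * (k.+1%:R * L0imp) + L1f1 * enorm x.
  exact: (smoothed_gradient_le V0 heta hm hA3 hA1a).
have mZ r : measurable_fun setT (Z r : Omega -> rvB R k.+1).
  apply: measurable_vecB; first exact: mof (hmG r).
  exact: (measurableT_comp mgf1 (mx r)).
have Z2 r : (\int[P]_w (enorm (Z r w) ^+ 2)%:E <= (sigma ^+ 2)%:E)%E.
  by have := hG2 r setT (FT r); rewrite probability_setT mule1.
have iZ2 r : P.-integrable setT (EFin \o (fun w => enorm (Z r w) ^+ 2)).
  have [] // := ge0_integ _ _ (Z2 r).
  - by apply: measurable_funX; exact: measurable_enormT.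
  - by move=> w; exact: sqr_ge0.
have a0 : 0 <= enorm (grad f1 0) + k.+1%:R * (k.+1%:R * L0imp).
  by rewrite addr_ge0 ?enorm_ge0// mulr_ge0// mulr_ge0.
have igr r : P.-integrable setT (EFin \o (fun w => enorm (xhat r w) ^+ 2)) ->
    P.-integrable setT (EFin \o (fun w => enorm (smoothed_gradient f1 Fi eta (xhat r w)) ^+ 2)).
  apply: integ_enorm_sqr_affine; [|exact: a0|exact: L1f0|by move=> w; exact: gr_le].
  exact: (measurableT_comp mgr (mx r)).
have mU0 r i : measurable_fun setT
    (sample_noise (Fi i) eta (xhat r) (v i r) : Omega -> rvB R k.+1).
  exact: (measurable_sample_noise V0 heta (hA1a i)).
have [C C0 taylor] := smoothed_objective_taylor V0 heta hm hA3 hA1a.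
have [fstar hfstar] := hbnd.
pose K := k.+1%:R * L0imp + k.+1%:R * (k.+1%:R * L0imp).
(* The mean-square bound on the averaged local errors. Multiplied by [gamma r], it is a constant
   times the sequence assumed summable. *)
pose c r := (k.+1%:R / (2 * eta)) ^+ 2 * 4 * L0yf2 ^+ 2 * (m%:R^-1 * \sum_(i < m) eps i r).
have gcE r : gamma r * c r = (k.+1%:R / (2 * eta)) ^+ 2 * 4 * L0yf2 ^+ 2 *
    (gamma r * (m%:R^-1 * \sum_(i < m) eps i r)).
  by rewrite /c mulrCA.
apply: (@sgd_liminf _ _ _ P _ (smoothed_objective f1 Fi eta) (smoothed_gradient f1 Fi eta)
  C (enorm (grad f1 0) + k.+1%:R * (k.+1%:R * L0imp)) L1f1 K (sigma ^+ 2)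
  (fstar - L0imp * eta) x0 xhat Z U E gamma c) => //.
- exact: (smoothed_objective_ge V0 heta hm hA1a hfstar).
- exact: (measurable_smoothed_objective V0 heta hm hA3 hA1a).
- move=> r; apply: measurable_vecZ => //; exact: measurable_vec_sum.
- move=> r; apply: measurable_vecZ => //; apply: measurable_vec_sum => i.
  exact: (measurable_local_error eta hA1b hA1c hA1a (mx r) (mv ^~ r) (myp ^~ r) (mym ^~ r) i).
(* For each client the estimator is [sgrad] plus [sample_noise] plus [local_error]; the intermediate
   terms telescope. *)
- move=> r w; rewrite hxS /Z /U /E /smoothed_gradient; congr (_ - _ *: _).
  set s := \sum_(i < m) _; set a := \sum_(i < m) sgrad _ _ _.
  set b := \sum_(i < m) sample_noise _ _ _ _ _; set e := \sum_(i < m) local_error _ _ _ _ _ _ _ _.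
  have -> : s = a + b + e.
    by rewrite /a /b /e -!big_split/=; apply: eq_bigr => i _; rewrite subrKC addrC subrK.
  by rewrite !scalerDr; apply/rowP => j; rewrite !mxE; ring.
- move=> r w; apply: (enorm_mean hm) => i.
  exact: (sample_noise_le (xhat r) (v i r) V0 heta (hA1a i) w).
- move=> r; exact: (mean_local_error_sq hA1b hA1c hm hA1a (mx r) (mv ^~ r) (myp ^~ r) (mym ^~ r) (v1 ^~ r)
    (hyp ^~ r) (hym ^~ r)).
- move=> r ix; apply: (noise_mean (hF1 r) (hF2 r)) => //.
  + exact: (measurableT_comp mgr (mxF r)).
  + exact: igr.
  + by move=> A j FA; exact: hG1.
- move=> r ix; rewrite /U.
  have iN i : P.-integrable setT (EFin \o (fun w =>
      dot (smoothed_gradient f1 Fi eta (xhat r w)) (sample_noise (Fi i) eta (xhat r) (v i r) w))).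
    apply: integ_dot => //; [exact: (measurableT_comp mgr (mx r))|exact: igr|].
    apply: (@integ_dom _ _ _ _ _ (fun=> K ^+ 2)).
    + by apply: measurable_funX; exact: measurable_enormT.
    + exact: finite_measure_integrable_cst.
    + move=> w; have hN := sample_noise_le (xhat r) (v i r) V0 heta (hA1a i) w.
      by rewrite ger0_norm ?sqr_ge0// ler_pXn2r ?nnegrE ?enorm_ge0// (le_trans (enorm_ge0 _) hN).
  rewrite (_ : (fun w => dot _ _) = (fun w => m%:R^-1 * \sum_(i < m)
    dot (smoothed_gradient f1 Fi eta (xhat r w)) (sample_noise (Fi i) eta (xhat r) (v i r) w))).
    rewrite RintegralZl//; last exact: integ_sum_ord.
    rewrite Rintegral_sum_ord// big1 ?mulr0// => i _.
    apply: (sample_noise_mean V0 heta (hA1a i)) => //; last exact: igr.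
    by move=> A B mA mB; apply: hv1 => //; exact: xF.
  apply/funext => w; rewrite dotZr dotC dot_suml; congr (_ * _).
  by apply: eq_bigr => i _; rewrite dotC.
- by move=> r; rewrite gcE mulr_ge0// mulr_ge0 ?sqr_ge0// mulr_ge0 ?sqr_ge0.
- rewrite (_ : (fun r => gamma r * c r) = (fun r => (k.+1%:R / (2 * eta)) ^+ 2 * 4 * L0yf2 ^+ 2 *
    (gamma r * (m%:R^-1 * \sum_(i < m) eps i r)))); last exact/funext.
  exact: is_cvg_seriesZ.
Qed.
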